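(* Let $N=2$, $M\ge2$, $b>0$, let $X_1,\dots,X_M\in\mathbb{R}^3$ be distinct points and let $Z_1,\dots,Z_M>0$. Let $G:\mathcal{P}^-\to\mathbb{R}$ be the $\Gamma$-limit of $G_\varepsilon$ as $\varepsilon\to0$ with respect to weak* convergence. Then the minimization problem $$\min\{G(\rho)\ :\ \rho\in\mathcal{P}^-\}$$ has a solution $\rho\in\mathcal{P}^-$. Moreover, every minimizer $\rho$ belongs to $\mathcal{P}$ and is of the form $$\rho=\sum_{i=1}^M\alpha_i\delta_{X_i}\qquad\text{with }\alpha_i\ge 0,\ \sum_{i=1}^M\alpha_i=1.$$
   Context: $\mathcal{P}$ is the set of Borel probability measures on $\mathbb{R}^3$ and $\mathcal{P}^-$ the set of nonnegative Borel measures $\rho$ on $\mathbb{R}^3$ with $\int d\rho\le 1$; weak* convergence is tested against continuous functions vanishing at infinity. $\delta_X$ is the Dirac mass at $X$. For $\rho\in\mathcal{P}$ define - $T(\rho)=\int_{\mathbb{R}^3}|\nabla\sqrt\rho|^2\,dx$ if $\rho$ is absolutely continuous with (density satisfying) $\sqrt\rho\in H^1(\mathbb{R}^3)$, and $T(\rho)=+\infty$ otherwise; - (case $N=2$) $C(\rho)=\inf\{\int_{\mathbb{R}^3\times\mathbb{R}^3}\frac{1}{|x_1-x_2|}\,dP(x_1,x_2)\}$, the infimum being over Borel probability measures $P$ on $\mathbb{R}^3\times\mathbb{R}^3$ with both marginals equal to $\rho$; - $U(\rho)=\sum_{k=1}^M Z_k\int\frac{1}{|x-X_k|}\,d\rho(x)$.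 For $\varepsilon>0$ and $\rho\in\mathcal{P}$, $G_\varepsilon(\rho)=\varepsilon^2T(\rho)+\varepsilon bC(\rho)-\varepsilon U(\rho)$, with $G_\varepsilon(\rho)=+\infty$ if $T(\rho)=+\infty$. For $\rho\in\mathcal{P}^-$, $G^-(\rho)$ and $G^+(\rho)$ are the infima of $\liminf_{\varepsilon\to0}G_\varepsilon(\rho_\varepsilon)$ and $\limsup_{\varepsilon\to0}G_\varepsilon(\rho_\varepsilon)$ respectively, over all families $(\rho_\varepsilon)_{\varepsilon>0}$ in $\mathcal{P}$ converging weakly* to $\rho$ as $\varepsilon\to0$. The $\Gamma$-limit $G$ is the common value $G=G^-=G^+$ (for $N=2$ these two functionals coincide on $\mathcal{P}^-$). *)

(* Defs.v *)
From HB Require Import structures.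
From mathcomp Require Import all_boot all_order all_algebra.
From mathcomp Require Import all_classical all_reals all_analysis.

Set Implicit Arguments.
Unset Strict Implicit.
Unset Printing Implicit Defensive.

Import Order.TTheory GRing.Theory Num.Theory.
Import numFieldNormedType.Exports.

Local Open Scope classical_set_scope.
Local Open Scope ring_scope.

(* R^3 as a product of real lines: it carries the product topology and the
   product (= Borel) sigma-algebra. Its library norm is the sup norm, so the
   Euclidean norm is given separately. *)
Notation R3 R :=
  (measurableTypeR R * measurableTypeR R * measurableTypeR R)%type.

Definition coord3 (R : realType) (x : R3 R) (i : 'I_3) : R :=
  [:: x.1.1; x.1.2; x.2]`_i.

Definition enorm (R : realType) (x : R3 R) : R :=
  Num.sqrt (\sum_(i < 3) coord3 x i ^+ 2).

Definition basis3 (R : realType) (i : 'I_3) : R3 R :=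
  ((i == 0%N :> nat)%:R : R, (i == 1%N :> nat)%:R : R, (i == 2%N :> nat)%:R : R).

Definition leb3 (R : realType) : set (R3 R) -> \bar R :=
  ((lebesgue_measure \x lebesgue_measure) \x lebesgue_measure)%E.

HB.instance Definition _ (R : realType) := Measure.on (@leb3 R).

Fixpoint Ck (R : realType) (n : nat) (f : R3 R -> R) : Prop :=
  continuous f /\
  match n with
  | 0%N => True
  | n'.+1 => forall i : 'I_3,
      (forall x, derivable f x (basis3 R i)) /\ Ck n' ('D_(basis3 R i) f)
  end.

Definition test_function (R : realType) (phi : R3 R -> R) : Prop :=
  (forall n, Ck n phi) /\ compact (closure [set x | phi x != 0]).

Definition L2 (R : realType) (u : R3 R -> R) : Prop :=
  measurable_fun [set: R3 R] u /\
  (\int[@leb3 R]_x (u x ^+ 2)%:E < +oo)%E.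

Definition weak_partial (R : realType) (i : 'I_3) (u g : R3 R -> R) : Prop :=
  forall phi : R3 R -> R, test_function phi ->
  (\int[@leb3 R]_x (u x * 'D_(basis3 R i) phi x)%:E =
   - \int[@leb3 R]_x (g x * phi x)%:E)%E.

(* u is in H^1(R^3), with weak gradient g. *)
Definition H1_gradient (R : realType) (u : R3 R -> R)
    (g : 'I_3 -> R3 R -> R) : Prop :=
  L2 u /\ forall i, L2 (g i) /\ weak_partial i u (g i).

Definition density (R : realType) (rho : set (R3 R) -> \bar R)
    (f : R3 R -> R) : Prop :=
  [/\ measurable_fun [set: R3 R] f, forall x, 0 <= f x &
      forall A, measurable A -> rho A = (\int[@leb3 R]_(x in A) (f x)%:E)%E].

(* The density and the weak gradient are unique almost everywhere, so the
   infimum ranges over at most one value; it is +oo when there is none. *)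
Definition kinetic (R : realType) (rho : probability (R3 R) R) : \bar R :=
  ereal_inf [set t | exists (f : R3 R -> R) (g : 'I_3 -> R3 R -> R),
    [/\ density rho f, H1_gradient (fun x => Num.sqrt (f x)) g &
        t = (\int[@leb3 R]_x (\sum_(i < 3) g i x ^+ 2)%:E)%E]].

(* Inverse taken in the extended reals: the value at y = x is +oo. *)
Definition coulomb (R : realType) (x y : R3 R) : \bar R :=
  ((enorm (x - y))%:E^-1)%E.

Definition coupling (R : realType) (rho : probability (R3 R) R)
    (P : probability (R3 R * R3 R)%type R) : Prop :=
  forall A : set (R3 R), measurable A ->
    P (fst @^-1` A) = rho A /\ P (snd @^-1` A) = rho A.

Definition ot_cost (R : realType) (rho : probability (R3 R) R) : \bar R :=
  ereal_inf [set (\int[P]_z coulomb z.1 z.2)%E | P in coupling rho].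

Definition nuclear (R : realType) (M : nat) (X : 'I_M -> R3 R)
    (Z : 'I_M -> R) (rho : probability (R3 R) R) : \bar R :=
  (\sum_(k < M) (Z k)%:E * \int[rho]_x coulomb x (X k))%E.

Definition Geps (R : realType) (b : R) (M : nat) (X : 'I_M -> R3 R)
    (Z : 'I_M -> R) (eps : R) (rho : probability (R3 R) R) : \bar R :=
  (if kinetic rho == +oo then +oo
   else (eps ^+ 2)%:E * kinetic rho + (eps * b)%:E * ot_cost rho
        - eps%:E * nuclear X Z rho)%E.

Definition C0 (R : realType) (phi : R3 R -> R) : Prop :=
  continuous phi /\
  forall e : R, 0 < e -> exists K : R, forall x, K < enorm x -> `|phi x| < e.

(* Only the values rho_ eps with eps > 0 matter. *)
Definition weak_star_cvg (R : realType) (rho_ : R -> probability (R3 R) R)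
    (rho : subprobability (R3 R) R) : Prop :=
  forall phi : R3 R -> R, C0 phi ->
    (\int[rho_ eps]_x (phi x)%:E)%E @[eps --> (0 : R)^'+] -->
    (\int[rho]_x (phi x)%:E)%E.

Definition Gminus (R : realType) (b : R) (M : nat) (X : 'I_M -> R3 R)
    (Z : 'I_M -> R) (rho : subprobability (R3 R) R) : \bar R :=
  ereal_inf [set limf_einf (fun eps => Geps b X Z eps (rho_ eps)) (0 : R)^'+
            | rho_ in [set rho_ | weak_star_cvg rho_ rho]].

Definition Gplus (R : realType) (b : R) (M : nat) (X : 'I_M -> R3 R)
    (Z : 'I_M -> R) (rho : subprobability (R3 R) R) : \bar R :=
  ereal_inf [set limf_esup (fun eps => Geps b X Z eps (rho_ eps)) (0 : R)^'+
            | rho_ in [set rho_ | weak_star_cvg rho_ rho]].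

Definition Gamma_limit (R : realType) (b : R) (M : nat) (X : 'I_M -> R3 R)
    (Z : 'I_M -> R) (G : subprobability (R3 R) R -> R) : Prop :=
  forall rho, (G rho)%:E = Gminus b X Z rho /\ (G rho)%:E = Gplus b X Z rho.

Definition minimizer (R : realType) (G : subprobability (R3 R) R -> R)
    (rho : subprobability (R3 R) R) : Prop :=
  forall mu, G rho <= G mu.

(* Main.v *)
(* The Gamma-limit never has to be computed. Suppose rho puts mass less than one
   on the nuclei, so that along a recovery family a mass q, bounded below, stays
   away from them. Surgery at scale eps: two balls of radius delta eps, at
   distance of order delta N eps from two distinct nuclei X_1 and X_2, are first
   cleared at small cost (pigeonhole: one of N disjoint balls has mass at most
   1/N); then all the mass away from the nuclei and in the two balls is put into
   smooth bumps on them. In the coupling, a flagged electron goes to X_1 or X_2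
   according to where the other one is, so the electrons stay apart and the
   repulsion cost is O(eps). The energy changes by at most
   o(1) + A/delta^2 + B/(delta N^2) - D q/(delta N), which is negative for N large
   and then delta large, and the new measures live near the nuclei. Vectors of
   masses near the nuclei lie in a compact simplex, so such measures subconverge
   to sums of Dirac masses: this gives existence, and a minimizer with q > 0 would
   be beaten. *)
Require Import Defs.
From HB Require Import structures.
From mathcomp Require Import all_boot all_order all_algebra.
From mathcomp Require Import all_classical all_reals all_analysis.
From mathcomp Require Import measurable_realfun ring lra.

Set Implicit Arguments.
Unset Strict Implicit.
Unset Printing Implicit Defensive.

Import Order.TTheory GRing.Theory Num.Theory.
Import numFieldNormedType.Exports.

Local Open Scope classical_set_scope.
Local Open Scope ring_scope.

(** * A smooth step *)

(** Every scale is dictated by the gain. Unit mass at distance of order [delta * N * eps] from a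
    nucleus lowers the energy by [eps / (delta * N * eps)], a quantity free of [eps]. Holes and
    bumps of size [delta * eps] cost kinetic energy [eps^2 / (delta * eps)^2 = 1 / delta^2]. The
    cleared mass, at most [2 / N], had potential at most of order [1 / (delta * N * eps)], so its
    loss carries one more factor [1 / N] than the gain. The balls are cleared so that the old and
    new densities have disjoint supports: the square root of their sum is then a sum of square
    roots, and the kinetic energies add. Two nuclei are used because a displaced electron sent next
    to the only one might meet the other electron there. Cutoffs are built with squared gradient at
    most [K * (1 - xi)], so that the cross term of [grad (xi * u)] is absorbed by the kinetic energy
    which the cutoff removes. Boundedness of [G] from below comes out of the same compactness
    argument: otherwise one measure would have a value below every negative integer, whereas [G] is
    real-valued. *)

Fixpoint Ck1 (R : realType) (n : nat) (f : R -> R) : Prop :=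
  continuous f /\
  match n with
  | 0%N => True
  | n'.+1 => (forall x, derivable f x 1) /\ Ck1 n' (derive1 f)
  end.

Section smooth_line.
Context {R : realType}.
Implicit Types (f g : R -> R) (n m : nat).

Lemma Ck1_continuous n f : Ck1 n f -> continuous f.
Proof. by case: n => [|n] []. Qed.

Lemma Ck1W n f : Ck1 n.+1 f -> Ck1 n f.
Proof.
elim: n f => [|n IH] f [cf [df dCf]]; first by split.
by split=> //; split=> //; exact: IH.
Qed.

Lemma Ck1S n f (df : R -> R) : (forall x : R, is_derive x (1 : R) f (df x)) -> Ck1 n df ->
  Ck1 n.+1 f.
Proof.
move=> fdf Cdf; have dfE : derive1 f = df.
  by apply/funext => x; rewrite derive1E derive_val.
split.
  move=> x; apply: differentiable_continuous; apply/derivable1_diffP.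
  by have [] := fdf x.
by split=> [x|]; [have [] := fdf x|rewrite dfE].
Qed.

Lemma Ck1_is_derive n f (x : R) : Ck1 n.+1 f -> is_derive x (1 : R) f (derive1 f x).
Proof. by case=> _ [df _]; rewrite derive1E; apply: DeriveDef. Qed.

Lemma Ck1_cst n (c : R) : Ck1 n (cst c).
Proof.
elim: n c => [|n IH] c; first by split=> //; exact: cst_continuous.
by apply: (@Ck1S _ _ (cst 0)) => // x; exact: is_derive_cst.
Qed.

Lemma Ck1D n f g : Ck1 n f -> Ck1 n g -> Ck1 n (f \+ g).
Proof.
elim: n f g => [|n IH] f g Cf Cg.
  split=> // x; apply: continuousD; [exact: (Ck1_continuous Cf)|].
  exact: (Ck1_continuous Cg).
apply: (@Ck1S _ _ (derive1 f \+ derive1 g)).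
  move=> x; have := Ck1_is_derive x Cf; have := Ck1_is_derive x Cg => ? ?.
  exact: is_deriveD.
by apply: IH; [case: Cf => _ []|case: Cg => _ []].
Qed.

Lemma Ck1M n f g : Ck1 n f -> Ck1 n g -> Ck1 n (f \* g).
Proof.
elim: n f g => [|n IH] f g Cf Cg.
  split=> // x; apply: continuousM; [exact: (Ck1_continuous Cf)|].
  exact: (Ck1_continuous Cg).
apply: (@Ck1S _ _ (f \* derive1 g \+ g \* derive1 f)).
  move=> x; have := Ck1_is_derive x Cf; have := Ck1_is_derive x Cg => ? ?.
  exact: is_deriveM.
by apply: Ck1D; apply: IH; try exact: Ck1W; [case: Cg => _ []|case: Cf => _ []].
Qed.

Lemma Ck1_comp n f g : Ck1 n f -> Ck1 n g -> Ck1 n (f \o g).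
Proof.
elim: n f g => [|n IH] f g Cf Cg.
  split=> // x; apply: continuous_comp; [exact: (Ck1_continuous Cg)|].
  exact: (Ck1_continuous Cf).
apply: (@Ck1S _ _ ((derive1 f \o g) \* derive1 g)).
  move=> x; apply: is_derive1_comp; [exact: Ck1_is_derive Cf|].
  exact: Ck1_is_derive Cg.
apply: Ck1M; last by case: Cg => _ [].
by apply: IH; [case: Cf => _ []|exact: Ck1W].
Qed.

Lemma Ck1_id n : Ck1 n (@idfun R).
Proof.
case: n => [|n]; first by split=> // x; exact: cvg_id.
by apply: (@Ck1S _ _ (cst 1)) (Ck1_cst n 1) => x; exact: is_derive_id.
Qed.

(** The weight [t^-m] makes the family stable under differentiation, which raises [m]. Smoothness of
    [exp(-1/t)] extended by 0, the case [m = 0], then follows by induction on the order, with [m]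
    general. *)
Definition flat m (t : R) : R :=
  if 0 < t then t^-1 ^+ m * expR (- t^-1) else 0.

(** The single term [y^m / m!] of the exponential series already bounds [expR y] from below. *)
Lemma expRN_poly_bound m (y : R) : 0 <= y -> y ^+ m * expR (- y) <= m`!%:R.
Proof.
move=> y0; rewrite expRN ler_pdivrMr ?expR_gt0//.
case: m => [|m]; first by rewrite expr0 fact0 mul1r -expR0 ler_expR.
have := expR_ge1Dxn m y0.
rewrite -lerBrDl ler_pdivrMr ?ltr0n ?fact_gt0// => /le_trans; apply.
by rewrite mulrC ler_wpM2l// lerBlDr lerDl.
Qed.

Lemma flat_ge0 m t : 0 <= flat m t.
Proof.
by rewrite /flat; case: ifPn => // t0; rewrite mulr_ge0 ?expR_ge0// exprn_ge0// invr_ge0 ltW.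
Qed.

(** Two powers of [t^-(m+2) * exp(-1/t)] are traded for [t^2]; this quadratic decay yields the
    derivative 0 at the origin. *)
Lemma flat_le_sqr m t : `|flat m t| <= m.+2`!%:R * t ^+ 2.
Proof.
rewrite ger0_norm ?flat_ge0// /flat; case: ifPn => t0; last first.
  by rewrite mulr_ge0 ?sqr_ge0.
have t0' : t != 0 by rewrite gt_eqF.
have -> : t^-1 ^+ m * expR (- t^-1) = t^-1 ^+ m.+2 * expR (- t^-1) * t ^+ 2.
  by rewrite !exprS; field.
by rewrite ler_wpM2r ?sqr_ge0// expRN_poly_bound// invr_ge0 ltW.
Qed.

Lemma is_derive_flat m (t : R) :
  is_derive t (1 : R) (flat m) (flat m.+2 t - m%:R * flat m.+1 t).
Proof.
have [t0|t0|->] := ltgtP t 0.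
- rewrite /flat ltNge (ltW t0)/= mulr0 subr0.
  apply: (@near_eq_is_derive _ _ _ (cst 0)).
  near=> u; rewrite ltNge; suff -> : u <= 0 by [].
  by near: u; exact: lt_le_nbhsl.
- rewrite /flat t0.
  apply: (@near_eq_is_derive _ _ _
      (fun u : R => u^-1 ^+ m * expR (- u^-1))).
    near=> u; suff -> : 0 < u by [].
    by near: u; exact: lt_nbhsr.
  have t0' : t != 0 by rewrite gt_eqF.
  have dV : is_derive t (1 : R) (fun u : R => u^-1) (- t ^- 2 *: 1).
    exact: is_deriveV.
  have dE : is_derive t (1 : R) (expR \o (fun u : R => - u^-1))
      (expR (- t^-1) * - (- t ^- 2 *: 1)).
    by apply: is_derive1_comp; apply: is_deriveN.
  have dX : is_derive t (1 : R) ((fun u : R => u^-1) ^+ m)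
      ((m%:R * t^-1 ^+ m.-1) *: (- t ^- 2 *: 1)).
    exact: is_deriveX.
  have -> : (fun u : R => u^-1 ^+ m * expR (- u^-1)) =
      ((fun u : R => u^-1) ^+ m) * (expR \o (fun u : R => - u^-1)).
    by apply/funext => u; rewrite /= !fctE.
  apply: is_derive_eq.
  rewrite !fctE /= /GRing.scale /= !mulr1.
  case: m dX => [|m] _ /=.
    by rewrite !expr0 !exprS; field.
  by rewrite !exprS; field.
- rewrite /flat ltxx mulr0 subr0.
  apply/is_derive1_caratheodory.
  (* The Caratheodory slope at 0. Since [0^-1 = 0], its value there is 0, and the bound
     [(m+2)! * |u|] makes it continuous. *)
  exists (fun u => u^-1 * flat m u); split => //=.
  + move=> z; rewrite ltxx !subr0; have [->|z0] := eqVneq z 0.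
      by rewrite ltxx mulr0.
    by rewrite -/(flat m z); field.
  + have bnd (u : R) : `|u^-1 * flat m u| <= m.+2`!%:R * `|u|.
      have [->|u0] := eqVneq u 0; first by rewrite invr0 mul0r normr0 mulr0.
      rewrite normrM normfV ler_pdivrMl ?normr_gt0//.
      by rewrite mulrCA -expr2 real_normK ?num_real// flat_le_sqr.
    rewrite /prop_for /continuous_at invr0 mul0r.
    apply/cvgr0Pnorm_le => e e0.
    near=> u; apply: le_trans (bnd u) _.
    rewrite mulrC -ler_pdivlMr ?ltr0n ?fact_gt0//.
    near: u; apply: cvgr0_norm_le; first exact: cvg_id.
    by rewrite divr_gt0// ltr0n fact_gt0.
  + by rewrite /flat ltxx mulr0.
Unshelve. all: by end_near. Qed.

Lemma Ck1_flat n m : Ck1 n (flat m).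
Proof.
elim: n m => [|n IH] m.
  split=> // x; apply: differentiable_continuous; apply/derivable1_diffP.
  by have [] := is_derive_flat m x.
apply: (@Ck1S _ _ (flat m.+2 \+ cst (- m%:R) \* flat m.+1)).
  by move=> x; rewrite /= mulNr; exact: is_derive_flat.
by apply: Ck1D => //; apply: Ck1M => //; exact: Ck1_cst.
Qed.

Definition smooth1 f := forall n, Ck1 n f.

Lemma smooth1_is_derive f (x : R) : smooth1 f ->
  is_derive x (1 : R) f (derive1 f x).
Proof. by move=> sf; apply: Ck1_is_derive (sf 1%N). Qed.

Lemma flat0_0 (t : R) : t <= 0 -> flat 0 t = 0.
Proof. by rewrite /flat ltNge => ->. Qed.

Lemma flat0_gt0 (t : R) : 0 < t -> 0 < flat 0 t.
Proof. by move=> t0; rewrite /flat t0 expr0 mul1r expR_gt0. Qed.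

Lemma flat0_le (s t : R) : s <= t -> flat 0 s <= flat 0 t.
Proof.
move=> st; have [s0|s0] := leP s 0; first by rewrite (flat0_0 s0) flat_ge0.
have t0 := lt_le_trans s0 st.
by rewrite /flat s0 t0 !expr0 !mul1r ler_expR lerN2 lef_pV2.
Qed.

(** The nesting gives a transition from 0 to 1 with a constant denominator: [flat 0 (1 - t)] is at
    least [c] for [t <= 0] and 0 for [t >= 1]. Only sums, products and compositions have to be
    differentiated. *)
Let c : R := flat 0 1.
Let kappa (t : R) : R := flat 0 (c - flat 0 (1 - t)) / flat 0 c.

(** Squaring the distance of a transition to 1 produces the derivative bound: for
    [w = 1 - (1 - kappa)^2] one has [w'^2 = 4 * kappa'^2 * (1 - w)], and [kappa'] is bounded. It is
    this bound near the value 1 that lets the gradient of a cutoff be absorbed. *)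
Lemma smooth_step : exists (w : R -> R) (K : R),
  [/\ 0 < K, smooth1 w, forall t, t <= 0 -> w t = 0 /\ derive1 w t = 0,
    forall t, 1 <= t -> w t = 1 /\ derive1 w t = 0 &
    forall t, 0 <= w t <= 1 /\ derive1 w t ^+ 2 <= K * (1 - w t)].
Proof.
have c0 : 0 < c by exact: flat0_gt0.
have fc0 : 0 < flat 0 c by exact: flat0_gt0.
(* The derivative of [flat 0], in the unsimplified form that [is_derive_flat] returns. The bound 2
   below is [2!]. *)
pose d0 (t : R) : R := flat 2 t - 0%:R * flat 1 t.
have d00 t : t <= 0 -> d0 t = 0.
  by move=> t0; rewrite /d0 /flat ltNge t0/= mulr0 subr0.
have d0b t : `|d0 t| <= 2.
  rewrite /d0 mul0r subr0 ger0_norm ?flat_ge0// /flat; case: ifPn => // t0.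
  by apply: (expRN_poly_bound 2); rewrite invr_ge0 ltW.
have dflat (t : R) : is_derive t (1 : R) (flat 0) (d0 t) by exact: is_derive_flat.
pose dk (t : R) : R := d0 (c - flat 0 (1 - t)) * d0 (1 - t) / flat 0 c.
have dkappa (t : R) : is_derive t (1 : R) kappa (dk t).
  have d1 : is_derive t (1 : R) (fun u : R => 1 - u) (- 1).
    have -> : (fun u : R => 1 - u) = cst 1 - id by apply/funext.
    by rewrite -[X in is_derive _ _ _ X]sub0r; exact: is_deriveB.
  have d2 : is_derive t (1 : R) (flat 0 \o (fun u : R => 1 - u)) (d0 (1 - t) * - 1).
    exact: is_derive1_comp.
  have d3 : is_derive t (1 : R) (fun u : R => c - flat 0 (1 - u)) (d0 (1 - t)).
    have -> : (fun u : R => c - flat 0 (1 - u)) =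
        cst c - (flat 0 \o (fun u : R => 1 - u)) by apply/funext.
    by apply: is_derive_eq (is_deriveB (is_derive_cst c t 1) d2) _; rewrite sub0r mulrN1 opprK.
  have d4 : is_derive t (1 : R) (flat 0 \o (fun u : R => c - flat 0 (1 - u)))
      (d0 (c - flat 0 (1 - t)) * d0 (1 - t)).
    exact: is_derive1_comp.
  have := @is_deriveM _ _ _ (cst (flat 0 c)^-1) t _ _ _ d4 (is_derive_cst _ _ _).
  have -> : (flat 0 \o (fun u : R => c - flat 0 (1 - u))) * cst (flat 0 c)^-1 = kappa.
    by apply/funext => u.
  move=> dM; apply: is_derive_eq dM _.
  by rewrite /GRing.scale/= mulr0 add0r /dk mulrC.
have kappa_ge0 t : 0 <= kappa t by rewrite divr_ge0 ?flat_ge0.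
have kappa_le1 t : kappa t <= 1.
  by rewrite ler_pdivrMr// mul1r flat0_le// lerBlDr lerDl flat_ge0.
have kappa0 t : t <= 0 -> kappa t = 0.
  move=> t0; rewrite /kappa flat0_0 ?mul0r// subr_le0 flat0_le//.
  by rewrite lerBrDr -lerBrDl subrr.
have kappa1 t : 1 <= t -> kappa t = 1.
  by move=> t1; rewrite /kappa (@flat0_0 (1 - t)) ?subr0 ?divff ?gt_eqF// subr_le0.
have dk0 t : t <= 0 -> dk t = 0.
  move=> t0; rewrite /dk d00 ?mul0r// subr_le0 flat0_le//.
  by rewrite lerBrDr -lerBrDl subrr.
pose w t := 1 - (1 - kappa t) ^+ 2.
have dw (t : R) : is_derive t (1 : R) w (2 * (1 - kappa t) * dk t).
  have d1 : is_derive t (1 : R) (cst 1 - kappa) (0 - dk t).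
    exact: is_deriveB.
  have d2 : is_derive t (1 : R) (cst 1 - (cst 1 - kappa) ^+ 2)
     (0 - (2%:R * (cst 1 - kappa) t ^+ 1) *: (0 - dk t)).
    by apply: is_deriveB; exact: is_deriveX.
  have -> : w = cst 1 - (cst 1 - kappa) ^+ 2 by apply/funext.
  apply: is_derive_eq d2 _.
  by rewrite /GRing.scale/= expr1 !sub0r mulrN opprK.
have dwE t : derive1 w t = 2 * (1 - kappa t) * dk t by rewrite derive1E derive_val.
(* [dk] is a product of two values of [d0], each at most 2 in absolute value, over [flat 0 c]. *)
pose B : R := 4 / flat 0 c.
have dkB t : `|dk t| <= B.
  rewrite /dk normrM [X in _ * X]gtr0_norm ?invr_gt0// ler_wpM2r ?invr_ge0 ?(ltW fc0)//.
  rewrite normrM (_ : 4 = 2 * 2 :> R); last by rewrite -natrM.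
  by apply: ler_pM; rewrite ?normr_ge0.
exists w, (4 * B ^+ 2); split.
- by rewrite mulr_gt0// exprn_gt0// divr_gt0.
- have sf1 : smooth1 (fun t : R => 1 - t).
    move=> n; apply: (@Ck1D n (cst 1) (fun t => - t)); first exact: Ck1_cst.
    rewrite (_ : (fun t : R => - t) = cst (-1) \* idfun); last first.
      by apply/funext => t /=; rewrite mulN1r.
    by apply: Ck1M; [exact: Ck1_cst|exact: Ck1_id].
  have sB f g : smooth1 f -> smooth1 g -> smooth1 (fun t => f t - g t).
    move=> sf sg n; apply: (@Ck1D n f (fun t => - g t)) => //.
    rewrite (_ : (fun t : R => - g t) = cst (-1) \* g); last first.
      by apply/funext => t /=; rewrite mulN1r.
    by apply: Ck1M; [exact: Ck1_cst|].
  have sk : smooth1 kappa.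
    move=> n; apply: (@Ck1M n _ (cst (flat 0 c)^-1)); last exact: Ck1_cst.
    apply: (@Ck1_comp n (flat 0)); first exact: Ck1_flat.
    apply: (sB (cst c) (fun t => flat 0 (1 - t))) => m; first exact: Ck1_cst.
    by apply: (@Ck1_comp m (flat 0)); [exact: Ck1_flat|exact: sf1].
  apply: (sB (cst 1) (fun t => (1 - kappa t) ^+ 2)) => m; first exact: Ck1_cst.
  have s1k : smooth1 (fun t => 1 - kappa t).
    by apply: (sB (cst 1) kappa) => // n; exact: Ck1_cst.
  exact: (Ck1M (s1k m) (s1k m)).
- move=> t t0; rewrite dwE dk0// mulr0 /w kappa0// subr0 expr1n subrr; split=> //.
- by move=> t t1; rewrite dwE /w kappa1// subrr expr0n subr0 mulr0 mul0r.
- move=> t; split.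
    rewrite /w subr_ge0 expr_le1 ?subr_ge0//= lerBlDr lerDl kappa_ge0/=.
    by rewrite lerBlDr lerDl sqr_ge0.
  rewrite dwE /w subKr [(_ * dk t) ^+ 2]exprMn [(_ * (1 - _)) ^+ 2]exprMn mulrAC ler_wpM2r ?sqr_ge0//.
  rewrite (_ : 2 ^+ 2 = 4 :> R); last by rewrite -natrX.
  apply: ler_wpM2l => //; rewrite -[X in X <= _]real_normK ?num_real//.
  apply: lerXn2r (dkB t); rewrite nnegrE ?normr_ge0//.
  exact: le_trans (normr_ge0 _) (dkB t).
Qed.

End smooth_line.

(** * Smooth functions of three variables *)

(** [g] is only known to be continuous at [x] and derivable along [v]. The Caratheodory slope of
    [F], continuous at [g x], factors the difference quotient of the composite, so this suffices. *)
Lemma is_derive_comp1 (R : realType) (V : normedModType R) (F : R -> R)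
    (g : V -> R) (x v : V) (a b : R) :
  {for x, continuous g} ->
  is_derive (g x) (1 : R) F a -> is_derive x v g b ->
  is_derive x v (F \o g) (a * b).
Proof.
move=> cg /is_derive1_caratheodory[h [hF ch ha]] [dg gb].
have lcvg : (fun t : R => t *: v + x) t @[t --> (0 : R)^'] --> x.
  have -> : nbhs x = nbhs ((fun t : R => t *: v + x) 0) by rewrite scale0r add0r.
  apply/continuous_withinNx => t.
  apply: cvgD; last exact: cvg_cst.
  by apply: cvgZr_tmp; exact: cvg_id.
have gcvg : g (t *: v + x) @[t --> (0 : R)^'] --> g x.
  exact: (cvg_comp _ _ lcvg cg).
have hcvg : h (g (t *: v + x)) @[t --> (0 : R)^'] --> a.
  by rewrite -ha; exact: (cvg_comp _ _ gcvg ch).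
have : t^-1 *: (((F \o g) \o shift x) (t *: v) - (F \o g) x)
    @[t --> (0 : R)^'] --> a * b.
  have -> : (fun t : R => t^-1 *: (((F \o g) \o shift x) (t *: v) - (F \o g) x))
      = (fun t : R => h (g (t *: v + x)) *
          (t^-1 *: ((g \o shift x) (t *: v) - g x))).
    by apply/funext => t /=; rewrite hF /GRing.scale/= mulrCA.
  by apply: cvgM => //; rewrite -gb; exact: dg.
move=> Fg; apply: DeriveDef; first by apply/cvg_ex; exists (a * b).
by rewrite /derive; apply/cvg_lim.
Qed.

Section smooth_space.
Context {R : realType}.
Implicit Types (f g : R3 R -> R) (n m : nat) (x : R3 R) (i j : 'I_3).

Lemma Ck_continuous n f : Ck n f -> continuous f.
Proof. by case: n => [|n] []. Qed.

Lemma CkW n f : Ck n.+1 f -> Ck n f.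
Proof.
elim: n f => [|n IH] f [cf df]; first by split.
by split=> // i; have [dfi Cdf] := df i; split=> //; exact: IH.
Qed.

Lemma CkS n f (df : 'I_3 -> R3 R -> R) : continuous f ->
  (forall i x, is_derive x (basis3 R i) f (df i x)) ->
  (forall i, Ck n (df i)) -> Ck n.+1 f.
Proof.
move=> cf fdf Cdf; split=> // i; split => [x|]; first by have [] := fdf i x.
rewrite (_ : 'D_(basis3 R i) f = df i)//.
by apply/funext => x; have fi := fdf i x; rewrite derive_val.
Qed.

Lemma Ck_is_derive n f i x : Ck n.+1 f ->
  is_derive x (basis3 R i) f ('D_(basis3 R i) f x).
Proof. by case=> _ /(_ i)[df _]; apply: DeriveDef. Qed.

Lemma Ck_derive n f i : Ck n.+1 f -> Ck n ('D_(basis3 R i) f).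
Proof. by case=> _ /(_ i)[]. Qed.

Lemma Ck_cst n (c : R) : Ck n (fun _ => c).
Proof.
elim: n c => [|n IH] c; first by split=> //; exact: cst_continuous.
apply: (@CkS _ _ (fun _ _ => 0)) => //; first exact: cst_continuous.
Qed.

Lemma CkD n f g : Ck n f -> Ck n g -> Ck n (f \+ g).
Proof.
elim: n f g => [|n IH] f g Cf Cg.
  split=> // x; apply: continuousD; [exact: (Ck_continuous Cf)|].
  exact: (Ck_continuous Cg).
apply: (@CkS _ _ (fun i => 'D_(basis3 R i) f \+ 'D_(basis3 R i) g)).
- move=> x; apply: continuousD; [exact: (Ck_continuous Cf)|].
  exact: (Ck_continuous Cg).
- move=> i x; have := Ck_is_derive i x Cf; have := Ck_is_derive i x Cg => ? ?.
  exact: is_deriveD.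
- by move=> i; apply: IH; exact: Ck_derive.
Qed.

Lemma CkM n f g : Ck n f -> Ck n g -> Ck n (f \* g).
Proof.
elim: n f g => [|n IH] f g Cf Cg.
  split=> // x; apply: continuousM; [exact: (Ck_continuous Cf)|].
  exact: (Ck_continuous Cg).
apply: (@CkS _ _ (fun i => f \* 'D_(basis3 R i) g \+ g \* 'D_(basis3 R i) f)).
- move=> x; apply: continuousM; [exact: (Ck_continuous Cf)|].
  exact: (Ck_continuous Cg).
- move=> i x; have := Ck_is_derive i x Cf; have := Ck_is_derive i x Cg => ? ?.
  exact: is_deriveM.
- by move=> i; apply: CkD; apply: IH; try exact: Ck_derive; exact: CkW.
Qed.

Lemma Ck_comp n (F : R -> R) g : Ck1 n F -> Ck n g -> Ck n (F \o g).
Proof.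
elim: n F g => [|n IH] F g CF Cg.
  split=> // x; apply: continuous_comp; [exact: (Ck_continuous Cg)|].
  exact: (Ck1_continuous CF).
apply: (@CkS _ _ (fun i => (derive1 F \o g) \* 'D_(basis3 R i) g)).
- move=> x; apply: continuous_comp; [exact: (Ck_continuous Cg)|].
  exact: (Ck1_continuous CF).
- move=> i x; apply: is_derive_comp1; first exact: (Ck_continuous Cg).
    exact: Ck1_is_derive CF.
  exact: Ck_is_derive Cg.
- move=> i; apply: CkM; last exact: Ck_derive.
  by apply: IH; [case: CF => _ []|exact: CkW].
Qed.

Lemma coord3_continuous i : continuous (fun x : R3 R => coord3 x i).
Proof.
case: i => -[|[|[|//]]] ?; rewrite /coord3 /= => x.
- by apply: (@continuous_comp (R3 R) _ _ fst fst x); exact: cvg_fst.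
- by apply: (@continuous_comp (R3 R) _ _ fst snd x); [exact: cvg_fst|exact: cvg_snd].
- exact: cvg_snd.
Qed.

Lemma coord3D (x y : R3 R) i : coord3 (x + y) i = coord3 x i + coord3 y i.
Proof. by case: i => -[|[|[|//]]]. Qed.

Lemma coord3N (x : R3 R) i : coord3 (- x) i = - coord3 x i.
Proof. by case: i => -[|[|[|//]]]. Qed.

Lemma coord3B (x y : R3 R) i : coord3 (x - y) i = coord3 x i - coord3 y i.
Proof. by rewrite coord3D coord3N. Qed.

Lemma coord3Z (t : R) (x : R3 R) i : coord3 (t *: x) i = t * coord3 x i.
Proof. by case: i => -[|[|[|//]]]. Qed.

Lemma coord3_basis i j : coord3 (basis3 R j) i = (i == j)%:R.
Proof. by case: i => -[|[|[|//]]] ?; case: j => -[|[|[|//]]] ?. Qed.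

Lemma is_derive_coord3 i j x :
  is_derive x (basis3 R j) (fun x : R3 R => coord3 x i) (i == j)%:R.
Proof.
have : t^-1 *: (((fun x : R3 R => coord3 x i) \o shift x) (t *: basis3 R j)
    - coord3 x i) @[t --> (0 : R)^'] --> ((i == j)%:R : R).
  apply: cvg_near_cst; near=> t.
  rewrite /= coord3D coord3Z coord3_basis addrK /GRing.scale/= mulrA mulVf ?mul1r//.
  by near: t; exact: nbhs_dnbhs_neq.
move=> cv; apply: DeriveDef; first by apply/cvg_ex; exists (i == j)%:R.
by rewrite /derive; apply/cvg_lim.
Unshelve. all: by end_near. Qed.

Lemma Ck_coord3 n i : Ck n (fun x : R3 R => coord3 x i).
Proof.
case: n => [|n]; first by split=> //; exact: coord3_continuous.
apply: (@CkS _ _ (fun j _ => (i == j)%:R)); first exact: coord3_continuous.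
  by move=> j x; exact: is_derive_coord3.
by move=> j; exact: Ck_cst.
Qed.

Definition smooth3 f := forall n, Ck n f.

Lemma smooth3_is_derive f i x : smooth3 f ->
  is_derive x (basis3 R i) f ('D_(basis3 R i) f x).
Proof. by move=> sf; apply: Ck_is_derive (sf 1%N). Qed.

Lemma smooth3_derive f i : smooth3 f -> smooth3 ('D_(basis3 R i) f).
Proof. by move=> sf n; apply: Ck_derive (sf n.+1). Qed.

Lemma smooth3_continuous f : smooth3 f -> continuous f.
Proof. by move=> sf; exact: Ck_continuous (sf 0%N). Qed.

Lemma smooth3_sum (I : Type) (r : seq I) (F : I -> R3 R -> R) :
  (forall k, smooth3 (F k)) -> smooth3 (fun x => \sum_(k <- r) F k x).
Proof.
move=> sF n; elim: r => [|k r IH].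
  by under eq_fun do rewrite big_nil; exact: Ck_cst.
by under eq_fun do rewrite big_cons; apply: CkD => //; exact: sF.
Qed.

(** Squared Euclidean distance. All geometry is expressed through it, since it is a polynomial,
    hence smooth also at [Y], and avoids square roots. *)
Definition dist2 (Y x : R3 R) : R := \sum_(i < 3) (coord3 x i - coord3 Y i) ^+ 2.

Lemma smooth3_dist2 Y : smooth3 (dist2 Y).
Proof.
apply: smooth3_sum => i n.
have c1 : Ck n (fun x : R3 R => coord3 x i - coord3 Y i).
  by apply: CkD; [exact: Ck_coord3|exact: Ck_cst].
exact: (CkM c1 c1).
Qed.

Lemma is_derive_dist2 Y i x :
  is_derive x (basis3 R i) (dist2 Y) (2 * (coord3 x i - coord3 Y i)).
Proof.
pose c j : R3 R -> R := fun x => coord3 x j - coord3 Y j.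
have dc j : is_derive x (basis3 R i) (c j) (j == i)%:R.
  rewrite -[X in is_derive _ _ _ X]subr0.
  have -> : c j = (fun x : R3 R => coord3 x j) - cst (coord3 Y j) by apply/funext.
  by apply: is_deriveB; exact: is_derive_coord3.
have -> : dist2 Y = \sum_(j < 3) (c j ^+ 2).
  by apply/funext => y; rewrite fct_sumE.
have := @is_derive_sum _ _ _ 3 (fun j => c j ^+ 2) x (basis3 R i)
  (fun j => (2%:R * c j x ^+ 1) *: ((j == i)%:R : R))
  (fun j => is_deriveX 2 (dc j)).
move=> h; apply: is_derive_eq h _.
rewrite (bigD1 i)//= big1 ?addr0 => [|j /negPf ->]; last by rewrite scaler0.
by rewrite eqxx /GRing.scale/= mulr1 expr1.
Qed.

Lemma dist2_ge0 Y x : 0 <= dist2 Y x.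
Proof. by apply: sumr_ge0 => i _; exact: sqr_ge0. Qed.

Lemma enorm_dist2 (x y : R3 R) : enorm (x - y) ^+ 2 = dist2 y x.
Proof.
rewrite /enorm sqr_sqrtr; last by apply: sumr_ge0 => i _; exact: sqr_ge0.
by apply: eq_bigr => i _; rewrite coord3B.
Qed.

End smooth_space.

(** * Integrability of functions with bounded support and Borel measurability *)

Section bounded_support.
Context d (T : measurableType d) (R : realType) (mu : {measure set T -> \bar R}).

Lemma integrable_bounded_support (D : set T) (C : R) (f : T -> R) :
  measurable D -> (mu D < +oo)%E -> measurable_fun setT f ->
  (forall x, `|f x| <= C) -> (forall x, ~ D x -> f x = 0) ->
  mu.-integrable setT (EFin \o f).
Proof.
move=> mD Dfin mf fC f0.
have iD : mu.-integrable setT (EFin \o (fun x => C * \1_D x)).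
  have -> : EFin \o (fun x => C * \1_D x) = (fun x => C%:E * (EFin \o \1_D) x)%E.
    by apply/funext => x /=; rewrite EFinM.
  apply: integrableZl => //.
  apply/integrableP; split; first exact/measurable_EFinP.
  under eq_integral => x _ do rewrite /= ger0_norm ?indicE//.
  by under eq_integral => x _ do rewrite -indicE; rewrite integral_indic// setIT.
apply: le_integrable iD => //; first exact/measurable_EFinP.
move=> x _ /=; rewrite lee_fin.
have [Dx|nDx] := pselect (D x).
  by rewrite indicE mem_set// mulr1 (le_trans (fC x))// ler_norm.
by rewrite f0// normr0.
Qed.

End bounded_support.

Section space_integrals.
Context {R : realType}.
Implicit Types (f g : R3 R -> R) (x : R3 R) (i j : 'I_3).

(** Balls of the library norm are cubes, products of intervals. Those with rational centre and
    radius [1 / (n + 1)] that lie inside an open set are countably many and cover it. *)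
Lemma open_measurable3 (U : set (R3 R)) : open U -> measurable U.
Proof.
move=> oU.
pose q3 (q : rat * rat * rat) : R3 R := (ratr q.1.1, ratr q.1.2, ratr q.2).
pose B (k : rat * rat * rat * nat) : set (R3 R) := ball (q3 k.1) (k.2.+1%:R^-1).
pose F (k : rat * rat * rat * nat) : set (R3 R) :=
  if pselect (B k `<=` U) then B k else set0.
have mB k : measurable (B k).
  rewrite (_ : B k = (ball (q3 k.1).1.1 k.2.+1%:R^-1 `*` ball (q3 k.1).1.2 k.2.+1%:R^-1)
      `*` ball (q3 k.1).2 k.2.+1%:R^-1).
    by apply: measurableX; [apply: measurableX|]; exact: measurable_ball.
  by apply/seteqP; split => -[[a b] c] //=.
have mF k : measurable (F k).
  by rewrite /F; case: (pselect (B k `<=` U)) => ?; [exact: mB|exact: measurable0].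
suff -> : U = \bigcup_k F k.
  by apply: countable_bigcupT_measurable => //; exact: countableP.
apply/seteqP; split => [x Ux|x [k _]]; last by rewrite /F; case: (pselect (B k `<=` U)) => //= BU; exact: BU.
have /nbhs_ballP[e /= e0 xeU] : nbhs x U by exact: open_nbhs_nbhs.
have [m me] : exists m : nat, m.+1%:R^-1 < e / 2.
  exists (Num.truncn ((e / 2)^-1)).
  rewrite invf_plt ?posrE ?divr_gt0// truncnS_gt// .
have appr (t : R) : exists q : rat, `|t - ratr q| < m.+1%:R^-1.
  have [|q] := @rat_in_itvoo R (t - m.+1%:R^-1) (t + m.+1%:R^-1).
    by rewrite ltrBlDr -addrA ltrDl addr_gt0// invr_gt0.
  rewrite in_itv/= => /andP[q1 q2]; exists q.
  by rewrite distrC ltr_distl q1 q2.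
have [a Ha] := appr x.1.1; have [b Hb] := appr x.1.2; have [c Hc] := appr x.2.
have xB : B (a, b, c, m) x.
  split; first split; rewrite /ball/=; rewrite /ball_ /=; by rewrite distrC.
exists (a, b, c, m) => //; rewrite /F; case: (pselect (B (a, b, c, m) `<=` U)) => //= nBU; exfalso; apply: nBU.
move=> y yB; apply: xeU; apply: (@ball_splitr _ _ (q3 (a, b, c))).
  apply: le_ball xB; exact: ltW.
apply: le_ball yB; exact: ltW.
Qed.

Lemma continuous_measurable3 f : continuous f -> measurable_fun setT f.
Proof.
move=> /continuousP cf; apply: (measurability _ (RGenOpens.measurableE R)).
move=> _ [_ [a [b ->] <-]]; rewrite setTI; apply: open_measurable3.
exact/cf/interval_open.
Qed.

End space_integrals.

(** * Integration by parts against Lebesgue measure *)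

Section space_integrals2.
Context {R : realType}.
Implicit Types (f g phi : R3 R -> R) (x : R3 R) (i j : 'I_3).

Definition box (a : R3 R) (r : R) : set (R3 R) :=
  (`[a.1.1 - r, a.1.1 + r] `*` `[a.1.2 - r, a.1.2 + r]) `*` `[a.2 - r, a.2 + r].

Lemma boxP a r x : box a r x <-> forall i, `|coord3 x i - coord3 a i| <= r.
Proof.
have itvP (s t : R) : `[t - r, t + r]%classic s <-> `|s - t| <= r.
  by rewrite /= in_itv/= ler_distl.
split=> [[[/itvP ? /itvP ?] /itvP ?] [[|[|[|//]]] ?]//|h].
by split; [split|]; apply/itvP; [exact: (h 0)|exact: (h 1)|exact: (h (@Ordinal 3 2 isT))].
Qed.

Lemma measurable_box a r : measurable (box a r).
Proof. by apply: measurableX; [apply: measurableX|]; exact: measurable_itv. Qed.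

Lemma leb3_box a r : 0 <= r -> leb3 (box a r) = ((2 * r) ^+ 3)%:E.
Proof.
move=> r0; have itvE (t : R) : lebesgue_measure `[t - r, t + r]%classic = (2 * r)%:E.
  rewrite lebesgue_measure_itv /= lte_fin; have [rr|rr] := ltP (t - r) (t + r).
    by rewrite -EFinB; congr (_%:E); ring.
  by have -> : r = 0 by [lra]; rewrite mulr0.
have E1 : leb3 (box a r) =
    ((lebesgue_measure \x lebesgue_measure)%E
       (`[(a.1.1 - r)%R, (a.1.1 + r)%R] `*` `[(a.1.2 - r)%R, (a.1.2 + r)%R]) *
     lebesgue_measure `[(a.2 - r)%R, (a.2 + r)%R]%classic)%E.
  by apply: product_measure1E; [apply: measurableX|]; exact: measurable_itv.
rewrite E1 product_measure1E; [|exact: measurable_itv|exact: measurable_itv].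
transitivity ((2 * r)%:E * (2 * r)%:E * (2 * r)%:E)%E.
  by congr (_ * _ * _)%E; exact: itvE.
by rewrite -!EFinM; congr (_%:E); ring.
Qed.

(** Support in the cube of half-side [r]. The function vanishes on an open set, so its directional
    derivatives vanish there too. *)
Definition suppb (r : R) f := forall x i, r < `|coord3 x i| -> f x = 0.

Lemma suppb_derive r f i : suppb r f -> suppb r ('D_(basis3 R i) f).
Proof.
move=> sf x j rx.
have -> : 'D_(basis3 R i) f x = 'D_(basis3 R i) (cst 0) x.
  apply: near_eq_derive.
  have : \forall y \near x, r < `|coord3 y j|.
    have cc : {for x, continuous (fun y : R3 R => `|coord3 y j|)}.
      apply: (@continuous_comp _ _ _ (fun y : R3 R => coord3 y j) (fun t : R => `|t|)).
        exact: coord3_continuous.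
      exact: norm_continuous.
    exact: (cc _ (lt_nbhsr rx)).
  by apply: filterS => y ry /=; exact: sf ry.
exact: derive_cst.
Qed.

Lemma compact_suppb f : compact (closure [set x | f x != 0]) ->
  exists2 r : R, 0 < r & suppb r f.
Proof.
move=> /compact_bounded; rewrite /bounded_near => -[M [_ MP]].
pose r := Num.max (M + 1) 1.
exists r; first by rewrite lt_max ltr01 orbT.
move=> x i rx; apply/eqP; apply: contraT => fx0.
have := MP r; rewrite lt_max ltrDl ltr01/= => /(_ isT x).
have cl : closure [set x | f x != 0] x by exact: subset_closure.
move=> /(_ cl); rewrite leNgt => /negP []; apply: lt_le_trans rx _.
rewrite prod_normE; case: i => -[|[|[|//]]] ?; rewrite le_max/= ?prod_normE.
- by rewrite le_max lexx.
- by rewrite le_max lexx orbT.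
- by rewrite lexx orbT.
Qed.

Lemma suppb_bounded r f : continuous f -> suppb r f ->
  exists C : R, forall x, `|f x| <= C.
Proof.
move=> cf sf.
have cK : compact (box 0 r).
  by apply: compact_setX; [apply: compact_setX|]; exact: segment_compact.
have := @continuous_compact _ _ _ _ (continuous_subspaceT cf) cK.
move=> /compact_bounded; rewrite /bounded_near => -[M [_ MP]].
exists (Num.max (M + 1) 0) => x.
have [xb|nxb] := pselect (box 0 r x).
  apply: (MP (Num.max (M + 1) 0)); last by exists x.
  by rewrite lt_max ltrDl ltr01.
suff -> : f x = 0 by rewrite normr0 le_max lexx orbT.
apply/eqP; apply: contraT => fx0; exfalso; apply: nxb; apply/boxP => i.
rewrite leNgt; apply/negP => rx; move/eqP: fx0; apply; apply: (sf x i).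
by move: rx; rewrite (_ : coord3 0 i = 0) ?subr0//; case: i => -[|[|[|//]]].
Qed.

Lemma suppb_boxN r f x : suppb r f -> ~ box 0 r x -> f x = 0.
Proof.
move=> sf nxb; apply/eqP; apply: contraT => fx0; exfalso; apply: nxb; apply/boxP => i.
rewrite leNgt; apply/negP => rx; move/eqP: fx0; apply; apply: (sf x i).
by move: rx; rewrite (_ : coord3 0 i = 0) ?subr0//; case: i => -[|[|[|//]]].
Qed.

Lemma suppb_integrable r f : 0 <= r -> continuous f -> suppb r f ->
  (@leb3 R).-integrable setT (EFin \o f).
Proof.
move=> r0 cf sf; have [C fC] := suppb_bounded cf sf.
apply: (@integrable_bounded_support _ _ _ _ (box 0 r) C) => //.
- exact: measurable_box.
- by rewrite [X in (X < _)%E]leb3_box// ltry.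
- exact: continuous_measurable3.
- by move=> x; exact: suppb_boxN.
Qed.

Lemma integral_derive1_eq0 (r : R) (F f : R -> R) : 0 < r -> continuous f ->
  (forall x : R, is_derive x (1 : R) F (f x)) ->
  (forall x : R, r < `|x| -> F x = 0) ->
  (\int[lebesgue_measure]_x (f x)%:E = 0)%E.
Proof.
move=> r0 cf dF F0.
have f0 (x : R) : r < `|x| -> f x = 0.
  move=> rx; have dFx := dF x; rewrite -(derive_val (is_derive := dFx)).
  have -> : 'D_1 F x = 'D_1 (cst 0) x; last exact: derive_cst.
  apply: near_eq_derive.
  have cc : {for x, continuous (fun t : R => `|t|)} by exact: norm_continuous.
  have : \forall y \near x, r < `|y| by exact: (cc _ (lt_nbhsr rx)).
  by apply: filterS => y /F0.
(* The margin puts both endpoints strictly outside [[-r, r]], where [F] vanishes. *)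
pose q := r + 1.
have q0 : - q < q by rewrite /q; lra.
have -> : (\int[lebesgue_measure]_x (f x)%:E =
    \int[lebesgue_measure]_(x in `[(- q)%R, q]) (f x)%:E)%E.
  rewrite [RHS]integral_mkcond; apply: eq_integral => x _.
  rewrite patchE; case: ifPn => // /negP; rewrite inE /= in_itv/= => nx.
  rewrite f0//; rewrite ltNge; apply/negP => xr; apply: nx.
  by move: xr; rewrite ler_norml /q => /andP[? ?]; apply/andP; split; lra.
have cF : continuous F.
  move=> x; apply: differentiable_continuous; apply/derivable1_diffP.
  by have [] := dF x.
rewrite (@continuous_FTC2 _ f F)//.
- have q' : r < `|q| by rewrite ger0_norm /q; lra.
  by rewrite (F0 q)// (F0 (- q)) ?normrN// subee.
- exact: continuous_subspaceT.
- split.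
  + by move=> x _; have [] := dF x.
  + by apply: cvg_at_right_filter; exact: cF.
  + by apply: cvg_at_left_filter; exact: cF.
- by move=> x _; rewrite derive1E; have dFx := dF x; rewrite derive_val.
Qed.
End space_integrals2.

(** Fubini for [leb3] is applied with this product as first factor; for that it needs a name
    carrying a measure and a sigma-finite structure. *)
Definition leb2 (R : realType) : set (measurableTypeR R * measurableTypeR R)%type -> \bar R := (@lebesgue_measure R \x @lebesgue_measure R)%E.
HB.instance Definition _ (R : realType) := Measure.on (@leb2 R).
Lemma leb2_sf (R : realType) : sigma_finite setT (@leb2 R).
Proof.
pose I (n : nat) : set (measurableTypeR R) := `[(- n%:R)%R, n%:R]%classic.
have mI n : measurable (I n) by exact: measurable_itv.
exists (fun n => I n `*` I n).
  apply/esym; rewrite -subTset => -[x y] _.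
  exists (Num.truncn (`|x| + `|y|)).+1 => //.
  have h : `|x| + `|y| < (Num.truncn (`|x| + `|y|)).+1%:R by exact: truncnS_gt.
  split; rewrite /I /= in_itv/= -ler_norml (le_trans _ (ltW h))//.
    by rewrite lerDl.
  by rewrite lerDr.
move=> n; split; first exact: measurableX.
have E2 : leb2 (I n `*` I n) = (lebesgue_measure (I n) * lebesgue_measure (I n))%E.
  exact: product_measure1E.
rewrite [X in (X < _)%E]E2 lebesgue_measure_itv/=.
by case: ifP => _; rewrite ?mule0 ?ltry// -EFinB -EFinM ltry.
Qed.
HB.instance Definition _ (R : realType) := Measure_isSigmaFinite.Build _ _ _ (@leb2 R) (@leb2_sf R).
Lemma continuous_at_pair (T U V : topologicalType) (f : T -> U) (g : T -> V) (x : T) :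
  {for x, continuous f} -> {for x, continuous g} ->
  {for x, continuous (fun u => (f u, g u))}.
Proof. by move=> cf cg; exact: (cvg_pair cf cg). Qed.

Section integral_of_derivative.
Context {R : realType}.
Implicit Types (f g phi : R3 R -> R) (x : R3 R) (i j : 'I_3).
Local Notation leb := (@lebesgue_measure R).
Local Notation leb2 := (@leb2 R).

Lemma is_derive_line phi (L : R -> R3 R) (v : R3 R) (t d : R) :
  (forall h s, L (h + s) = h *: v + L s) -> is_derive (L t) v phi d ->
  is_derive t (1 : R) (phi \o L) d.
Proof.
move=> HL [dphi <-].
have E : (fun h : R => h^-1 *: (((phi \o L) \o shift t) (h *: (1 : R)) - (phi \o L) t))
    = (fun h : R => h^-1 *: ((phi \o shift (L t)) (h *: v) - phi (L t))).
  by apply/funext => h /=; rewrite -HL /GRing.scale/= mulr1.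
by apply: DeriveDef; [rewrite /derivable E|rewrite /derive E].
Qed.

(** By Fubini the lines in direction [i] are integrated innermost, and on each of them the
    fundamental theorem of calculus gives 0. *)
Lemma integral_derive_eq0 r phi i : 0 < r -> suppb r phi -> Ck 1 phi ->
  (\int[@leb3 R]_x ('D_(basis3 R i) phi x)%:E = 0)%E.
Proof.
move=> r0 sphi C1.
set f := 'D_(basis3 R i) phi.
have cf : continuous f by apply: Ck_continuous (Ck_derive i C1).
have sf : suppb r f by exact: suppb_derive.
have intf : (leb2 \x leb)%E.-integrable setT (EFin \o f).
  exact: suppb_integrable (ltW r0) cf sf.
have [C fC] := suppb_bounded cf sf.
have slice (L : R -> R3 R) : (forall h s, L (h + s) = h *: basis3 R i + L s) ->
    (forall s, coord3 (L s) i = s) -> continuous L ->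
    (\int[leb]_s (f (L s))%:E = 0)%E.
  move=> HL Li cL; apply: (@integral_derive1_eq0 _ r (phi \o L)) => //.
  - by move=> s; apply: continuous_comp; [exact: cL|exact: cf].
  - by move=> s; apply: (is_derive_line HL); exact: Ck_is_derive C1.
  - by move=> s rs; apply: (sphi _ i); rewrite Li.
have slice2 (t : R) : leb2.-integrable setT (EFin \o (fun z : measurableTypeR R * measurableTypeR R => f (z, t))).
  pose D2 : set (measurableTypeR R * measurableTypeR R) := `[(- r)%R, r] `*` `[(- r)%R, r].
  have := @integrable_bounded_support _ _ _ leb2 D2 C (fun z => f (z, t)).
  apply => //.
  - by apply: measurableX; exact: measurable_itv.
  - have E2 : leb2 D2 = (leb `[(- r)%R, r]%classic * leb `[(- r)%R, r]%classic)%E.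
      by apply: product_measure1E; exact: measurable_itv.
    rewrite [X in (X < _)%E]E2 lebesgue_measure_itv/= lte_fin gtrN// -EFinB -EFinM.
    exact: ltry.
  - apply: (measurableT_comp (continuous_measurable3 cf)).
    exact: measurable_fun_pair.
  - move=> z nz; apply: (@suppb_boxN _ r) => // -[[z1 z2] _]; apply: nz; split.
      by move: z1; rewrite /= !(sub0r, add0r).
    by move: z2; rewrite /= !(sub0r, add0r).
have i3 : [\/ i = 0, i = 1 | i = @Ordinal 3 2 isT].
  by case: i {f cf sf intf fC slice slice2} => -[|[|[|//]]] ?;
    [apply: Or31|apply: Or32|apply: Or33]; exact/val_inj.
have E3 := @integral12_prod_meas1 _ _ (measurableTypeR R * measurableTypeR R)%type
  (measurableTypeR R) R leb2 leb (EFin \o f) intf.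
have E3' := @Fubini _ _ (measurableTypeR R * measurableTypeR R)%type
  (measurableTypeR R) R leb2 leb (EFin \o f) intf.
have E2 t := @integral12_prod_meas1 _ _ (measurableTypeR R) (measurableTypeR R) R
  leb leb _ (slice2 t).
have E2' t := @Fubini _ _ (measurableTypeR R) (measurableTypeR R) R
  leb leb _ (slice2 t).
transitivity (\int[leb2]_z \int[leb]_t (f (z, t))%:E)%E; first exact/esym/E3.
have lineE (L : R -> R3 R) (e : R3 R) : basis3 R i = e ->
    (forall h s, L (h + s) = h *: e + L s) -> forall h s, L (h + s) = h *: basis3 R i + L s.
  by move=> ->.
(* The first coordinate is brought innermost by exchanging both orders of integration, the second by
   exchanging only the outer one; the third is innermost already. *)
case: i3 => Ei.
- rewrite E3'; apply: integral0_eq => t _.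
  rewrite -[LHS]E2 E2'; apply: integral0_eq => s _.
  apply: (slice (fun u => (u, s, t))) => [|u|u]; last 2 first.
  + by rewrite Ei.
  + by apply: continuous_at_pair; [apply: continuous_at_pair|]; [exact: cvg_id|exact: cvg_cst|exact: cvg_cst].
  apply: (lineE (fun u => (u, s, t)) _ (congr1 (@basis3 R) Ei)) => h u.
  by congr (_, _, _) => /=; rewrite /GRing.scale/= ?mulr1 ?mulr0 ?add0r.
- rewrite E3'; apply: integral0_eq => t _.
  rewrite -[LHS]E2; apply: integral0_eq => s _.
  apply: (slice (fun u => (s, u, t))) => [|u|u]; last 2 first.
  + by rewrite Ei.
  + by apply: continuous_at_pair; [apply: continuous_at_pair|]; [exact: cvg_cst|exact: cvg_id|exact: cvg_cst].
  apply: (lineE (fun u => (s, u, t)) _ (congr1 (@basis3 R) Ei)) => h u.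
  by congr (_, _, _) => /=; rewrite /GRing.scale/= ?mulr1 ?mulr0 ?add0r.
- apply: integral0_eq => -[s t] _.
  apply: (slice (fun u => (s, t, u))) => [|u|u]; last 2 first.
  + by rewrite Ei.
  + by apply: continuous_at_pair; [apply: continuous_at_pair|]; [exact: cvg_cst|exact: cvg_cst|exact: cvg_id].
  apply: (lineE (fun u => (s, t, u)) _ (congr1 (@basis3 R) Ei)) => h u.
  by congr (_, _, _) => /=; rewrite /GRing.scale/= ?mulr1 ?mulr0 ?add0r.
Qed.

End integral_of_derivative.

(** * Cutoffs in H^1 *)

Section weak_gradient.
Context {R : realType}.
Implicit Types (u v xi phi psi : R3 R -> R) (x : R3 R) (i j : 'I_3).
Local Notation leb3 := (@leb3 R).

Lemma continuous_mul u v : continuous u -> continuous v ->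
  continuous (fun x => u x * v x).
Proof. by move=> cu cv x; apply: continuousM; [exact: cu|exact: cv]. Qed.

Lemma test_function_suppb phi : test_function phi ->
  exists2 r : R, 0 < r & suppb r phi.
Proof. by case=> _ /compact_suppb. Qed.

Lemma test_functionM xi phi : smooth3 xi -> test_function phi ->
  test_function (xi \* phi).
Proof.
move=> sxi [sphi cphi]; split; first by move=> n; apply: CkM.
apply: (@subclosed_compact _ _ _ _ cphi); first exact: closed_closure.
apply: closureS => x /= h; apply: contra_neq h => ->.
by rewrite mulr0.
Qed.

Lemma derive_mul xi phi i x : smooth3 xi -> smooth3 phi ->
  'D_(basis3 R i) (xi \* phi) x =
  xi x * 'D_(basis3 R i) phi x + phi x * 'D_(basis3 R i) xi x.
Proof.
move=> sx sp; have dx := smooth3_is_derive i x sx; have dp := smooth3_is_derive i x sp.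
have d := is_deriveM (f := xi) (g := phi) dx dp.
exact: (derive_val (is_derive := d)).
Qed.

Lemma L2_sqr_integrable u : L2 u -> leb3.-integrable setT (fun x => (u x ^+ 2)%:E).
Proof.
move=> [mu iu]; apply/integrableP; split.
  by apply/measurable_EFinP; exact: measurable_funX.
by under eq_integral => x _ do rewrite gee0_abs ?lee_fin ?sqr_ge0//.
Qed.

(** Dominated by [u^2 + psi^2], both terms being integrable. *)
Lemma L2_mul_integrable r u psi : 0 < r -> L2 u -> continuous psi -> suppb r psi ->
  leb3.-integrable setT (fun x => (u x * psi x)%:E).
Proof.
move=> r0 L2u cpsi spsi.
have i2 : leb3.-integrable setT (fun x => (psi x ^+ 2)%:E).
  apply: (@suppb_integrable _ r (fun x => psi x ^+ 2)); first exact: ltW.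
    exact: continuous_mul.
  by move=> x i rx; rewrite (spsi x i rx) expr0n.
have := integrableD measurableT (L2_sqr_integrable L2u) i2.
apply: le_integrable => //.
  apply/measurable_EFinP; apply: measurable_funM; first by case: L2u.
  exact: continuous_measurable3.
move=> x _; rewrite /= lee_fin [leRHS]ger0_norm ?addr_ge0 ?sqr_ge0//.
rewrite normrM -[X in _ <= X + _]real_normK ?num_real// -[X in _ <= _ + X]real_normK ?num_real//.
have := sqr_ge0 (`|u x| - `|psi x|); have := normr_ge0 (u x); have := normr_ge0 (psi x).
nra.
Qed.

Lemma L2D u v : L2 u -> L2 v -> L2 (u \+ v).
Proof.
move=> Lu Lv; have [mu iu] := Lu; have [mv iv] := Lv.
split; first exact: measurable_funD.
have i1 := integrableD measurableT (L2_sqr_integrable Lu) (L2_sqr_integrable Lv).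
have i2 := integrableZl measurableT 2 i1.
apply: le_lt_trans (integrable_lty measurableT i2).
apply: ge0_le_integral => //.
- by move=> x _; rewrite lee_fin sqr_ge0.
- by apply/measurable_EFinP; apply: measurable_funX; exact: measurable_funD.
- by case/integrableP: i2.
- move=> x _; rewrite /= -EFinD -EFinM lee_fin.
  have := sqr_ge0 (u x - v x); nra.
Qed.

Lemma L2M (C : R) u xi : L2 u -> measurable_fun setT xi ->
  (forall x, `|xi x| <= C) -> L2 (xi \* u).
Proof.
move=> Lu mxi xiC; have [mu iu] := Lu.
have i2 := integrableZl measurableT (C ^+ 2) (L2_sqr_integrable Lu).
split; first exact: measurable_funM.
apply: le_lt_trans (integrable_lty measurableT i2).
apply: ge0_le_integral => //.
- by move=> x _; rewrite lee_fin sqr_ge0.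
- by apply/measurable_EFinP; apply: measurable_funX; exact: measurable_funM.
- by case/integrableP: i2.
- move=> x _; rewrite /= -EFinM lee_fin exprMn ler_wpM2r ?sqr_ge0//.
  rewrite -[leLHS]real_normK ?num_real//; apply: lerXn2r (xiC x); rewrite nnegrE//.
  exact: le_trans (normr_ge0 _) (xiC x).
Qed.

Lemma L2_suppb r psi : 0 < r -> continuous psi -> suppb r psi -> L2 psi.
Proof.
move=> r0 cpsi spsi; split; first exact: continuous_measurable3.
apply: integrable_lty => //.
apply: (@suppb_integrable _ r (fun x => psi x ^+ 2)); first exact: ltW.
  exact: continuous_mul.
by move=> x i rx; rewrite (spsi x i rx) expr0n.
Qed.

(** The weak derivative of [u] is tested against [xi * phi], which is again a test function; the
    product rule then leaves a term in ['D xi] that moves to the other side. Boundedness of [xi] and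
    of its derivatives keeps everything in L2. *)
Lemma H1_gradient_mul (C : R) u (g : 'I_3 -> R3 R -> R) xi : smooth3 xi ->
  (forall x, `|xi x| <= C) -> (forall i x, `|'D_(basis3 R i) xi x| <= C) ->
  H1_gradient u g ->
  H1_gradient (xi \* u) (fun i => (xi \* g i) \+ ('D_(basis3 R i) xi \* u)).
Proof.
move=> sxi xiC dxiC [L2u gu].
have mxi : measurable_fun setT xi.
  by apply: continuous_measurable3; exact: smooth3_continuous.
have mdxi i : measurable_fun setT ('D_(basis3 R i) xi).
  by apply: continuous_measurable3; apply: smooth3_continuous; exact: smooth3_derive.
split; first exact: L2M xiC.
move=> i; have [L2g wg] := gu i; split.
  by apply: L2D; [exact: L2M xiC|exact: (L2M L2u (mdxi i) (dxiC i))].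
move=> phi tphi; have txp := test_functionM sxi tphi.
have [r r0 sphi] := test_function_suppb tphi; have [smphi _] := tphi.
have sdphi := suppb_derive i sphi.
have cphi := smooth3_continuous smphi.
have cdphi := smooth3_continuous (smooth3_derive i smphi).
have cxi := smooth3_continuous sxi; have cdxi := smooth3_continuous (smooth3_derive i sxi).
have I1 : leb3.-integrable setT (fun x => (u x * (xi x * 'D_(basis3 R i) phi x))%:E).
  apply: (@L2_mul_integrable r) => //.
    exact: continuous_mul.
  by move=> x j rx; rewrite (sdphi x j rx) mulr0.
have I2 : leb3.-integrable setT (fun x => (u x * (phi x * 'D_(basis3 R i) xi x))%:E).
  apply: (@L2_mul_integrable r) => //.
    exact: continuous_mul.
  by move=> x j rx; rewrite (sphi x j rx) mul0r.
have I3 : leb3.-integrable setT (fun x => (g i x * (xi x * phi x))%:E).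
  apply: (@L2_mul_integrable r) => //.
    exact: continuous_mul.
  by move=> x j rx; rewrite (sphi x j rx) mulr0.
have := wg _ txp.
have -> : (\int[leb3]_x (u x * 'D_(basis3 R i) (xi \* phi) x)%:E =
    \int[leb3]_x (u x * (xi x * 'D_(basis3 R i) phi x))%:E +
    \int[leb3]_x (u x * (phi x * 'D_(basis3 R i) xi x))%:E)%E.
  rewrite -integralD//; apply: eq_integral => x _.
  by rewrite derive_mul// mulrDr EFinD.
have -> : (\int[leb3]_x (((xi \* u) x) * 'D_(basis3 R i) phi x)%:E =
    \int[leb3]_x (u x * (xi x * 'D_(basis3 R i) phi x))%:E)%E.
  by apply: eq_integral => x _ /=; rewrite mulrCA mulrA.
have -> : (\int[leb3]_x (((xi \* g i) \+ ('D_(basis3 R i) xi \* u)) x * phi x)%:E =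
    \int[leb3]_x (g i x * (xi x * phi x))%:E +
    \int[leb3]_x (u x * (phi x * 'D_(basis3 R i) xi x))%:E)%E.
  rewrite -integralD//; apply: eq_integral => x _.
  by rewrite -EFinD; congr (_%:E) => /=; ring.
(* Finiteness of the three integrals allows the rearrangement to be done among real numbers. *)
have F1 := integrable_fin_num measurableT I1.
have F2 := integrable_fin_num measurableT I2.
have F3 := integrable_fin_num measurableT I3.
rewrite -(fineK F1) -(fineK F2) -(fineK F3) -!EFinD -!EFinN => -[E].
by congr (_%:E); rewrite opprD -E addrK.
Qed.

(** Integration by parts: the integral of the derivative of [w * phi] vanishes. *)
Lemma H1_gradient_test w : test_function w ->
  H1_gradient w (fun i => 'D_(basis3 R i) w).
Proof.
move=> tw; have [sw _] := tw; have [r r0 spw] := test_function_suppb tw.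
have cw := smooth3_continuous sw.
split; first exact: L2_suppb spw.
move=> i; have cdw := smooth3_continuous (smooth3_derive i sw).
have sdw := suppb_derive i spw.
split; first exact: L2_suppb sdw.
move=> phi tphi; have [sphi _] := tphi.
have [r' r'0 spphi] := test_function_suppb tphi.
have cphi := smooth3_continuous sphi.
have cdphi := smooth3_continuous (smooth3_derive i sphi).
have sdphi := suppb_derive i spphi.
have I1 : leb3.-integrable setT (fun x => (w x * 'D_(basis3 R i) phi x)%:E).
  apply: L2_mul_integrable sdphi => //.
  exact: L2_suppb spw.
have I2 : leb3.-integrable setT (fun x => ('D_(basis3 R i) w x * phi x)%:E).
  apply: L2_mul_integrable spphi => //.
  exact: L2_suppb sdw.
have [r'' r''0 sp] := test_function_suppb (test_functionM sw tphi).
have := @integral_derive_eq0 _ r'' (w \* phi) i r''0 sp (CkM (sw 1%N) (sphi 1%N)).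
have -> : (\int[leb3]_x ('D_(basis3 R i) (w \* phi) x)%:E =
    \int[leb3]_x (w x * 'D_(basis3 R i) phi x)%:E +
    \int[leb3]_x ('D_(basis3 R i) w x * phi x)%:E)%E.
  rewrite -integralD//; apply: eq_integral => x _.
  by rewrite derive_mul// [phi x * _]mulrC EFinD.
have F1 := integrable_fin_num measurableT I1.
have F2 := integrable_fin_num measurableT I2.
rewrite -(fineK F1) -(fineK F2) -!EFinD -!EFinN => -[E].
by congr (_%:E); lra.
Qed.

Lemma H1_gradientD u v (g h : 'I_3 -> R3 R -> R) :
  H1_gradient u g -> H1_gradient v h ->
  H1_gradient (u \+ v) (fun i => g i \+ h i).
Proof.
move=> [Lu gu] [Lv hv]; split; first exact: L2D.
move=> i; have [Lg wg] := gu i; have [Lh wh] := hv i; split; first exact: L2D.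
move=> phi tphi; have [sphi _] := tphi.
have [r r0 spphi] := test_function_suppb tphi.
have cphi := smooth3_continuous sphi.
have cdphi := smooth3_continuous (smooth3_derive i sphi).
have sdphi := suppb_derive i spphi.
have I1 := L2_mul_integrable r0 Lu cdphi sdphi.
have I2 := L2_mul_integrable r0 Lv cdphi sdphi.
have I3 := L2_mul_integrable r0 Lg cphi spphi.
have I4 := L2_mul_integrable r0 Lh cphi spphi.
under eq_integral => x _ do rewrite /= mulrDl EFinD.
rewrite integralD//.
under [in RHS]eq_integral => x _ do rewrite /= mulrDl EFinD.
rewrite integralD// wg// wh//.
have F4 := integrable_fin_num measurableT I4.
by rewrite fin_num_oppeD.
Qed.

(* Completing the square: the cross term [2 xi u g d] is absorbed by
   [(1 - xi^2) g^2]; when [xi^2 = 1] the quotient is the junk value [0] and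
   [d = 0]. *)
Lemma cutoff_gradient_le (K xi g u d : R) : 0 <= xi <= 1 -> 0 <= K ->
  d ^+ 2 <= K * (1 - xi ^+ 2) ->
  (xi * g + d * u) ^+ 2 <= g ^+ 2 + d ^+ 2 / (1 - xi ^+ 2) * u ^+ 2.
Proof.
move=> /andP[xi0 xi1] K0 dK.
have : xi ^+ 2 <= 1 by rewrite expr_le1.
rewrite le_eqVlt => /predU1P[xiE|xi_lt].
  have d0 : d = 0.
    by apply/eqP; rewrite -sqrf_eq0 eq_le sqr_ge0 andbT (le_trans dK)// xiE subrr mulr0.
  by rewrite d0 mul0r addr0 expr0n /= !mul0r addr0 exprMn xiE mul1r.
have s0 : 0 < 1 - xi ^+ 2 by rewrite subr_gt0.
rewrite -subr_ge0.
have -> : g ^+ 2 + d ^+ 2 / (1 - xi ^+ 2) * u ^+ 2 - (xi * g + d * u) ^+ 2 =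
    ((1 - xi ^+ 2) * g - xi * d * u) ^+ 2 / (1 - xi ^+ 2).
  by field; rewrite gt_eqF.
by rewrite divr_ge0 ?sqr_ge0// ltW.
Qed.

(** [cutoff_gradient_le] is applied to each component, and the quotients [d i ^+ 2 / (1 - xi ^+ 2)]
    are bounded only after summation; the constant thus stays [K] instead of [3 * K]. *)
Lemma cutoff_energy_le (K xi u : R) (g d : 'I_3 -> R) : 0 <= xi <= 1 -> 0 <= K ->
  \sum_(i < 3) d i ^+ 2 <= K * (1 - xi ^+ 2) ->
  \sum_(i < 3) (xi * g i + d i * u) ^+ 2 <= \sum_(i < 3) g i ^+ 2 + K * u ^+ 2.
Proof.
move=> xi01 K0 dK.
have di i : d i ^+ 2 <= K * (1 - xi ^+ 2).
  apply: le_trans dK; rewrite (bigD1 i)//= lerDl.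
  by apply: sumr_ge0 => j _; exact: sqr_ge0.
apply: (@le_trans _ _ (\sum_(i < 3) (g i ^+ 2 + d i ^+ 2 / (1 - xi ^+ 2) * u ^+ 2))).
  by apply: ler_sum => i _; exact: cutoff_gradient_le (di i).
rewrite big_split/= lerD2l -mulr_suml ler_wpM2r ?sqr_ge0// -mulr_suml.
case/andP: xi01 => xi0 xi1.
have : xi ^+ 2 <= 1 by rewrite expr_le1.
rewrite le_eqVlt => /predU1P[->|xi_lt]; first by rewrite subrr invr0 mulr0.
by rewrite ler_pdivrMr// subr_gt0.
Qed.

End weak_gradient.

(** * Measures with density *)

Section weighted_measure.
Context d (T : measurableType d) (R : realType).
Variables (mu : {measure set T -> \bar R}) (f : T -> R).
Hypotheses (mf : measurable_fun setT f) (f0 : forall x, 0 <= f x).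
Local Open Scope ereal_scope.

Definition wmeas (A : set T) : \bar R := \int[mu]_(x in A) (f x)%:E.

Let wmeas0 : wmeas set0 = 0.
Proof. exact: integral_set0. Qed.

Let wmeas_ge0 A : 0 <= wmeas A.
Proof. by apply: integral_ge0 => x _; rewrite lee_fin. Qed.

Let wmeas_sigma_additive : semi_sigma_additive wmeas.
Proof.
move=> F mF tF mUF; rewrite /wmeas ge0_integral_bigcup//; last first.
- by move=> x _; rewrite lee_fin.
- by apply/measurable_EFinP; exact: measurable_funTS.
apply: is_cvg_ereal_nneg_natsum_cond => n _ _.
by apply: integral_ge0 => x _; rewrite lee_fin.
Qed.

HB.instance Definition _ := isMeasure.Build _ _ _ wmeas
  wmeas0 wmeas_ge0 wmeas_sigma_additive.

Definition weighted : {measure set T -> \bar R} := wmeas.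

Lemma weightedE A : weighted A = \int[mu]_(x in A) (f x)%:E.
Proof. by []. Qed.

End weighted_measure.

Section integral_density.
Context d (T : measurableType d) (R : realType).
Variables (mu nu : {measure set T -> \bar R}) (f : T -> R).
Hypotheses (mf : measurable_fun setT f) (f0 : forall x, 0 <= f x).
Hypothesis nuE : forall A, measurable A -> nu A = (\int[mu]_(x in A) (f x)%:E)%E.
Local Open Scope ereal_scope.
Import HBNNSimple.

Let integral_density_indic E : measurable E ->
  \int[nu]_x (\1_E x)%:E = \int[mu]_x ((\1_E x)%:E * (f x)%:E).
Proof.
move=> mE; rewrite integral_indic// setIT nuE// integral_mkcond.
apply: eq_integral => x _; rewrite patchE indicE.
by case: ifPn => _; rewrite ?mul1e ?mul0e.
Qed.

Let integral_density_nnsfun (h : {nnsfun T >-> R}) :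
  \int[nu]_x (h x)%:E = \int[mu]_x ((h x)%:E * (f x)%:E).
Proof.
under [LHS]eq_integral do rewrite fimfunE -fsumEFin//.
rewrite [LHS]ge0_integral_fsum//; last 2 first.
  - by move=> r; exact/measurable_EFinP/measurableT_comp.
  - by move=> n x _; rewrite EFinM nnfun_muleindic_ge0.
under [RHS]eq_integral.
  move=> x xD; rewrite fimfunE -fsumEFin// ge0_mule_fsuml; last first.
    by move=> r; rewrite EFinM nnfun_muleindic_ge0.
  over.
rewrite [RHS]ge0_integral_fsum//; last 2 first.
  - move=> r; apply: emeasurable_funM; last exact/measurable_EFinP.
    by apply/measurable_EFinP; do 2 apply/measurableT_comp => //.
  - by move=> n x _; apply: mule_ge0; [rewrite EFinM nnfun_muleindic_ge0|rewrite lee_fin].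
apply: eq_fsbigr => r _.
have [r0|r0] := leP 0%R r; last first.
  have E0 : h @^-1` [set r] = set0.
    by apply/seteqP; split => // x /= hxr; move: r0; rewrite -hxr ltNge fun_ge0.
  rewrite E0 [LHS]integral0_eq; last by move=> x _; rewrite indic0 mulr0.
  by rewrite [RHS]integral0_eq// => x _; rewrite indic0 mulr0 mul0e.
under eq_integral do rewrite EFinM.
rewrite ge0_integralZl//; last by apply/measurable_EFinP; exact: measurable_indic.
under [RHS]eq_integral do rewrite EFinM -muleA.
rewrite [RHS]ge0_integralZl//.
- by rewrite integral_density_indic.
- apply: emeasurable_funM; apply/measurable_EFinP => //; exact: measurable_indic.
- by move=> x _; rewrite mule_ge0// lee_fin.
Qed.

(** Change of density by the usual ladder: indicators, simple functions, monotone convergence.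
    Through it an integral against a probability with density becomes a Lebesgue integral. *)
Lemma ge0_integral_density (h : T -> \bar R) : measurable_fun setT h ->
  (forall x, 0 <= h x) -> \int[nu]_x h x = \int[mu]_x (h x * (f x)%:E).
Proof.
move=> mh h0; pose h_ := nnsfun_approx measurableT mh.
transitivity (limn (fun n => \int[nu]_x (h_ n x)%:E)).
  rewrite -monotone_convergence//=.
  - apply: eq_integral => x /[!inE] xD; apply/esym/cvg_lim => //=.
    exact: cvg_nnsfun_approx.
  - by move=> n; apply: measurableT_comp => //; exact: measurable_funTS.
  - by move=> n x _; rewrite lee_fin.
  - by move=> x _ a b ab; rewrite lee_fin//; exact/lefP/nd_nnsfun_approx.
rewrite (_ : \int[mu]_x _ =
    limn (fun n => \int[mu]_x ((h_ n x)%:E * (f x)%:E))).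
  by congr (limn _); apply/funext => n; exact: integral_density_nnsfun.
rewrite -monotone_convergence//=.
- apply: eq_integral => x _; apply/esym/cvg_lim => //.
  by apply: cvgeZr => //; exact: cvg_nnsfun_approx.
- move=> n; apply: emeasurable_funM; last exact/measurable_EFinP.
  by apply: measurableT_comp => //; exact: measurable_funTS.
- by move=> n x _; rewrite mule_ge0// lee_fin.
- move=> x _ a b ab; rewrite lee_wpmul2r ?lee_fin//; exact/lefP/nd_nnsfun_approx.
Qed.

End integral_density.

(** * Redirecting mass in couplings *)

Section pushm.
Context d1 d2 (X : measurableType d1) (Y : measurableType d2) (R : realType).
Variables (m : {measure set X -> \bar R}) (phi : X -> Y) (mphi : measurable_fun setT phi).
(** The proof that [phi] is measurable is stored in the term, so that the pushforward can be used as
    a measure without further annotation. *)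
Definition pushm : {measure set Y -> \bar R}.
Proof. refine (pushforward m phi : {measure set Y -> \bar R}); exact: mphi. Defined.
Lemma pushmE A : pushm A = m (phi @^-1` A).
Proof. by []. Qed.
Lemma integral_pushm (h : Y -> \bar R) : measurable_fun setT h -> (forall y, 0 <= h y)%E ->
  (\int[pushm]_y h y = \int[m]_x h (phi x))%E.
Proof.
move=> mh h0; have := @ge0_integral_pushforward _ _ X Y R phi mphi m setT h measurableT mh.
rewrite preimage_setT => <- //.
Qed.
End pushm.

Section prob_of_measure.
Context d (T : measurableType d) (R : realType).
Variables (m : {measure set T -> \bar R}) (m1 : m setT = 1%E).

(** A copy of [m] under a fresh name, on which the probability structure is declared. *)
Let pm (A : set T) : \bar R := m A.

HB.instance Definition _ := isMeasure.Build _ _ _ pm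
  (measure0 m) (measure_ge0 m) (@measure_semi_sigma_additive _ _ _ m).
HB.instance Definition _ := Measure_isProbability.Build _ _ _ pm m1.

Lemma prob_of_measure : exists P : probability T R, forall A, P A = m A.
Proof. by exists pm. Qed.

End prob_of_measure.

Section measure_misc.
Context d (T : measurableType d) (R : realType).
Implicit Types m : {measure set T -> \bar R}.

Lemma ge0_integral_measureD m m1 m2 (h : T -> \bar R) :
  (forall A, measurable A -> m A = (m1 A + m2 A)%E) ->
  measurable_fun setT h -> (forall x, 0 <= h x)%E ->
  (\int[m]_x h x = \int[m1]_x h x + \int[m2]_x h x)%E.
Proof.
move=> mE mh h0; rewrite -ge0_integral_measure_add//.
by apply: eq_measure_integral => A mA _; rewrite mE// -measure_addE.
Qed.

(** A bound off a null set with a surcharge on [E]. For the lost potential [E] is the region of the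
    cleared balls; for the redirected cost [k1 = 0]. *)
Lemma integral_le_cst_indic m (S E : set T) (h : T -> \bar R) (k0 k1 : R) :
  0 <= k0 -> 0 <= k1 -> measurable S -> measurable E -> m (~` S) = 0%E ->
  measurable_fun setT h -> (forall x, 0 <= h x)%E ->
  (forall x, S x -> (h x <= (k0 + k1 * \1_E x)%:E)%E) ->
  (\int[m]_x h x <= k0%:E * m setT + k1%:E * m E)%E.
Proof.
move=> k00 k10 mS mE mS0 mh h0 hk.
rewrite (@ge0_negligible_integral _ _ _ _ _ (~` S))//; last exact: measurableC.
rewrite setTD setCK.
have -> : (k0%:E * m setT + k1%:E * m E =
    \int[m]_x (k0%:E + k1%:E * (\1_E x)%:E))%E.
  rewrite ge0_integralD//; last 2 first.
  - by move=> x _; rewrite mule_ge0// lee_fin.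
  - by apply: emeasurable_funM => //; apply/measurable_EFinP.
  rewrite integral_cst// ge0_integralZl//; last by apply/measurable_EFinP.
  by rewrite integral_indic// setIT.
apply: (@le_trans _ _ (\int[m]_(x in S) (k0%:E + k1%:E * (\1_E x)%:E))%E).
  apply: ge0_le_integral => //.
  - exact: measurable_funTS.
  - apply: emeasurable_funD => //; apply: emeasurable_funM => //.
    exact/measurable_EFinP/measurable_funTS/measurable_indic.
apply: ge0_subset_integral => //.
- apply: emeasurable_funD => //; apply: emeasurable_funM => //.
  exact/measurable_EFinP/measurable_indic.
- by move=> x _; rewrite -EFinM -EFinD lee_fin addr_ge0 ?mulr_ge0.
Qed.

End measure_misc.

Section redirect.
Context d (T : measurableType d) (R : realType).
Variables (nu1 nu2 : probability T R) (S1 S2 B : set T) (p : T -> R).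
Hypotheses (mS1 : measurable S1) (mS2 : measurable S2) (mB : measurable B).
Hypotheses (nuS1 : nu1 (~` S1) = 0%E) (nuS2 : nu2 (~` S2) = 0%E).
Hypotheses (mp : measurable_fun setT p) (p01 : forall x, 0 <= p x <= 1).
Variables (h : T * T -> \bar R) (k : R).
Hypotheses (mh : measurable_fun setT h) (h0 : forall z, (0 <= h z)%E) (k0 : 0 <= k).
Hypotheses (hS1 : forall y z, S1 y -> ~ B z -> (h (y, z) <= k%:E)%E).
Hypotheses (hS2 : forall y z, S2 y -> B z -> (h (y, z) <= k%:E)%E).
Local Open Scope ereal_scope.

Let mp1 : measurable_fun setT (fun z : T * T => p z.1).
Proof. exact: measurableT_comp. Qed.

(* The first coordinate is kept with probability [p] and otherwise resampled
   from [nu1] or [nu2], according to whether the second coordinate is outside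
   or inside [B]. *)
Lemma redirect_fst (P : probability (T * T)%type R) :
  exists (Q : probability (T * T)%type R) (c1 c2 : R),
  [/\ (0 <= c1)%R /\ (0 <= c2)%R,
      forall A, measurable A -> Q (fst @^-1` A) =
        \int[P]_(z in fst @^-1` A) (p z.1)%:E + c1%:E * nu1 A + c2%:E * nu2 A,
      forall A, measurable A -> Q (snd @^-1` A) = P (snd @^-1` A) &
      \int[Q]_z h z <= \int[P]_z h z + k%:E].
Proof.
have p0 z : (0 <= p z)%R by case/andP: (p01 z).
have q0 z : (0 <= 1 - p z)%R by rewrite subr_ge0; case/andP: (p01 z).
(* Density of the mass released from the first coordinate while the second one lies in [E]. *)
pose q (E : set T) (z : T * T) : R := ((1 - p z.1) * \1_E z.2)%R.
have mq E : measurable E -> measurable_fun setT (q E).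
  move=> mE; apply: measurable_funM; first exact: measurable_funB.
  by apply: measurableT_comp => //; exact: measurable_indic.
have qE0 E z : (0 <= q E z)%R by rewrite mulr_ge0.
have mBC : measurable (~` B) by exact: measurableC.
pose wp : {measure set (T * T) -> \bar R} := weighted P mp1 (fun z => p0 z.1).
pose w1 : {measure set (T * T) -> \bar R} := weighted P (mq _ mBC) (qE0 (~` B)).
pose w2 : {measure set (T * T) -> \bar R} := weighted P (mq _ mB) (qE0 B).
(* [s1] and [s2] record where the second coordinate of the released mass sits. The new plan is the
   kept part plus the products of [nu1] with [s1] and of [nu2] with [s2]; in [\x^] the second factor
   may be a bare measure. *)
pose s1 := pushm w1 (@measurable_snd _ _ T T).
pose s2 := pushm w2 (@measurable_snd _ _ T T).
pose m1 : {measure set (T * T) -> \bar R} := (nu1 \x^ s1)%E.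
pose m2 : {measure set (T * T) -> \bar R} := (nu2 \x^ s2)%E.
pose m12 : {measure set (T * T) -> \bar R} := measure_add m1 m2.
pose m : {measure set (T * T) -> \bar R} := measure_add wp m12.
have mE A : m A = wp A + (m1 A + m2 A).
  by rewrite -(measure_addE m1 m2) -(measure_addE wp m12).
have msnd A : measurable A -> measurable (snd @^-1` A : set (T * T)).
  by move=> mA; rewrite -[X in measurable X]setTI; exact: measurable_snd.
have fstE A : fst @^-1` A = A `*` setT :> set (T * T).
  by apply/seteqP; split => [z Az|z []].
have sndE A : snd @^-1` A = setT `*` A :> set (T * T).
  by apply/seteqP; split => [z Az|z []].
have s1T : s1 setT = w1 setT by rewrite pushmE preimage_setT.
have s2T : s2 setT = w2 setT by rewrite pushmE preimage_setT.
(* Kept and released parts recompose [P]. This gives both the total mass 1 and the unchanged second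
   marginal. *)
have wT (A : set (T * T)) : measurable A -> wp A + (w1 A + w2 A) = P A.
  move=> mA; rewrite /wp /w1 /w2 !weightedE.
  have hq E z : A z -> 0 <= (q E z)%:E by move=> _; rewrite lee_fin; exact: (qE0 E z).
  have hm E : measurable E -> measurable_fun A (fun z => (q E z)%:E).
    by move=> mE'; apply/measurable_EFinP; apply: measurable_funTS; exact: (mq E).
  rewrite -(ge0_integralD P mA (hq (~` B)) (hm _ mBC) (hq B) (hm _ mB)).
  have hp z : A z -> 0 <= (p z.1)%:E by move=> _; rewrite lee_fin; exact: (p0 z.1).
  have hmp : measurable_fun A (fun z => (p z.1)%:E).
    exact/measurable_EFinP/measurable_funTS.
  have hqq z : A z -> 0 <= (q (~` B) z)%:E + (q B z)%:E.
    by move=> Az; rewrite adde_ge0 ?hq.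
  rewrite -(ge0_integralD P mA hp hmp hqq (emeasurable_funD (hm _ mBC) (hm _ mB))).
  rewrite -[RHS]mul1e -[RHS]integral_cst//; apply: eq_integral => z _.
  rewrite -!EFinD; congr (_%:E); rewrite /q -mulrDr !indicE in_setC.
  by case: (z.2 \in B); rewrite /= ?addr0 ?add0r mulr1 addrC subrK.
have mT : m setT = 1.
  rewrite mE.
  have -> : m1 setT = w1 setT.
    by rewrite -s1T -setXTT [LHS]product_measure2E// [X in X * _]probability_setT mul1e.
  have -> : m2 setT = w2 setT.
    by rewrite -s2T -setXTT [LHS]product_measure2E// [X in X * _]probability_setT mul1e.
  by rewrite [LHS]wT// probability_setT.
have wfin : forall w : {measure set (T * T) -> \bar R},
    w setT <= 1 -> w setT = (fine (w setT))%:E.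
  move=> w w1'; rewrite fineK// fin_numE; apply/andP; split.
    by rewrite gt_eqF// (lt_le_trans _ (measure_ge0 _ _))// ltNy0.
  by rewrite lt_eqF// (le_lt_trans w1')// ltry.
have w1le : w1 setT <= 1.
  by rewrite -(@probability_setT _ _ _ P) -(wT setT)// addeCA leeDl// adde_ge0.
have w2le : w2 setT <= 1.
  by rewrite -(@probability_setT _ _ _ P) -(wT setT)// addeA leeDr// adde_ge0.
have w12le : w1 setT + w2 setT <= 1.
  by rewrite -(@probability_setT _ _ _ P) -(wT setT)// leeDr.
have [Q QE] := prob_of_measure mT.
exists Q, (fine (w1 setT)), (fine (w2 setT)); split.
- by split; rewrite fine_ge0.
- move=> A mA; rewrite QE mE -!wfin//.
  have -> : m1 (fst @^-1` A) = w1 setT * nu1 A.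
    by rewrite [in LHS]fstE [LHS]product_measure2E// [X in _ * X]s1T muleC.
  have -> : m2 (fst @^-1` A) = w2 setT * nu2 A.
    by rewrite [in LHS]fstE [LHS]product_measure2E// [X in _ * X]s2T muleC.
  by rewrite addeA.
- move=> A mA; rewrite QE mE -(wT _ (msnd _ mA)).
  have -> : m1 (snd @^-1` A) = w1 (snd @^-1` A).
    by rewrite [in LHS]sndE [LHS]product_measure2E// [X in X * _]probability_setT mul1e.
  have -> : m2 (snd @^-1` A) = w2 (snd @^-1` A).
    by rewrite [in LHS]sndE [LHS]product_measure2E// [X in X * _]probability_setT mul1e.
  by [].
have wple : \int[wp]_z h z <= \int[P]_z h z.
  pose w12 : {measure set (T * T) -> \bar R} := measure_add w1 w2.
  rewrite (@ge0_integral_measureD _ _ _ P wp w12)//.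
    by rewrite leeDl// integral_ge0.
  by move=> A mA; rewrite -(wT _ mA) -(measure_addE w1 w2).
(* A product with marginals carried by [S] and [E] is carried by [S] times [E], where [h] is at most
   [k]. *)
have redir (nu : probability T R) (s : {measure set T -> \bar R}) (S E : set T) :
    measurable S -> measurable E -> nu (~` S) = 0 -> s (~` E) = 0 ->
    (forall y z, S y -> E z -> h (y, z) <= k%:E) ->
    \int[(nu \x^ s)%E]_z h z <= k%:E * s setT.
  move=> mS mE' nuS sE hSE.
  pose ns : {measure set (T * T) -> \bar R} := (nu \x^ s)%E.
  have N0 : ns (~` (S `*` E)) = 0.
    have mSc : measurable (~` S `*` [set: T]) by apply: measurableX => //; exact: measurableC.
    have mEc : measurable ([set: T] `*` ~` E) by apply: measurableX => //; exact: measurableC.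
    have Z1 : ns (~` S `*` setT) = 0.
      rewrite [LHS]product_measure2E//; last exact: measurableC.
      by rewrite [X in X * _]nuS mul0e.
    have Z2 : ns (setT `*` ~` E) = 0.
      rewrite [LHS]product_measure2E//; last exact: measurableC.
      by rewrite [X in _ * X]sE mule0.
    have ZU : ns ((~` S `*` setT) `|` (setT `*` ~` E)) = 0 by rewrite (measureU0 mSc mEc Z2).
    apply: (subset_measure0 _ (measurableU _ _ mSc mEc) _ ZU).
    - by apply: measurableC; exact: measurableX.
    - by move=> -[y z] /= /not_andP[nSy|nEz]; [left|right].
  have hk yz : (S `*` E) yz -> h yz <= (k + 0 * \1_set0 yz)%:E.
    by case: yz => y z [/= Sy Ez]; rewrite mul0r addr0; exact: hSE.
  have := integral_le_cst_indic k0 (lexx 0) (measurableX mS mE') measurable0 N0 mh h0 hk.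
  rewrite mul0e adde0 => /le_trans; apply.
  have -> : ns setT = nu setT * s setT by rewrite -setXTT; exact: product_measure2E.
  by rewrite probability_setT mul1e.
have s1E : s1 (~` ~` B) = 0.
  rewrite setCK pushmE weightedE; apply: integral0_eq => z Bz.
  by rewrite /q indicE in_setC mem_set// mulr0.
have s2E : s2 (~` B) = 0.
  rewrite pushmE weightedE; apply: integral0_eq => z Bz.
  by rewrite /q indicE memNset// mulr0.
have H1 := redir nu1 s1 S1 (~` B) mS1 mBC nuS1 s1E hS1.
have H2 := redir nu2 s2 S2 B mS2 mB nuS2 s2E hS2.
have -> : \int[Q]_z h z = \int[m]_z h z.
  by apply: eq_measure_integral => A _ _; rewrite QE.
rewrite (@ge0_integral_measureD _ _ _ m wp m12)//; last first.
  by move=> A mA; rewrite -(measure_addE wp m12).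
rewrite (@ge0_integral_measureD _ _ _ m12 m1 m2)//; last first.
  by move=> A mA; rewrite -(measure_addE m1 m2).
apply: leeD => //; apply: le_trans (leeD H1 H2) _.
rewrite s1T s2T -ge0_muleDr//.
by rewrite -[leRHS]mule1 lee_wpmul2l.
Qed.

End redirect.

Section redirect_coupling.
Context d (T : measurableType d) (R : realType).
Variables (nu1 nu2 : probability T R) (S1 S2 B : set T) (p : T -> R).
Hypotheses (mS1 : measurable S1) (mS2 : measurable S2) (mB : measurable B).
Hypotheses (nuS1 : nu1 (~` S1) = 0%E) (nuS2 : nu2 (~` S2) = 0%E).
Hypotheses (mp : measurable_fun setT p) (p01 : forall x, 0 <= p x <= 1).
Variables (h : T * T -> \bar R) (k : R).
Hypotheses (mh : measurable_fun setT h) (h0 : forall z, (0 <= h z)%E) (k0 : 0 <= k).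
Hypotheses (hS1 : forall y z, S1 y -> ~ B z -> (h (y, z) <= k%:E)%E).
Hypotheses (hS2 : forall y z, S2 y -> B z -> (h (y, z) <= k%:E)%E).
Hypothesis hC : forall x y, h (x, y) = h (y, x).
Local Open Scope ereal_scope.

Let msnd A : measurable A -> measurable (snd @^-1` A : set (T * T)).
Proof. by move=> mA; rewrite -[X in measurable X]setTI; exact: measurable_snd. Qed.

Let integral_fst (mu : probability T R) (P : {measure set (T * T) -> \bar R}) :
  (forall A, measurable A -> P (fst @^-1` A) = mu A) ->
  forall A, measurable A ->
  \int[P]_(z in fst @^-1` A) (p z.1)%:E = \int[mu]_(x in A) (p x)%:E.
Proof.
move=> Pmu A mA.
have mpA : measurable_fun A (EFin \o p) by exact/measurable_EFinP/measurable_funTS.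
have pA : {in A, forall y, 0 <= (EFin \o p) y}.
  by move=> y _ /=; rewrite lee_fin; case/andP: (p01 y).
have E := ge0_integral_pushforward (@measurable_fst _ _ T T) P mA mpA pA.
rewrite -[LHS]E.
by apply: eq_measure_integral => A' mA' _; rewrite -Pmu.
Qed.

Let swap_measurable : measurable_fun setT (fun z : T * T => (z.2, z.1)).
Proof. by apply: measurable_fun_pair; [exact: measurable_snd|exact: measurable_fst]. Qed.

(** The two coordinates are redirected one after the other, at cost [k] each. The second pass looks
    at the first particle in its new position, so that two redirected particles are kept apart as
    well. The passes may release different masses; averaging the plan with its swap equalizes the
    marginals, and leaves the cost unchanged because [h] is symmetric. *)
Lemma redirect_coupling (mu : probability T R) (P : probability (T * T)%type R) :
  (forall A, measurable A -> P (fst @^-1` A) = mu A /\ P (snd @^-1` A) = mu A) ->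
  exists (Q : probability (T * T)%type R) (c1 c2 : R),
  [/\ (0 <= c1)%R /\ (0 <= c2)%R,
      forall A, measurable A ->
        Q (fst @^-1` A) = \int[mu]_(x in A) (p x)%:E + c1%:E * nu1 A + c2%:E * nu2 A /\
        Q (snd @^-1` A) = \int[mu]_(x in A) (p x)%:E + c1%:E * nu1 A + c2%:E * nu2 A &
      \int[Q]_z h z <= \int[P]_z h z + (2 * k)%:E].
Proof.
move=> Pmu.
have [Q1 [c1 [c2 [[c10 c20] Q1fst Q1snd Q1h]]]] :=
  redirect_fst mS1 mS2 mB nuS1 nuS2 mp p01 mh h0 k0 hS1 hS2 P.
pose sw (Q : probability (T * T)%type R) := pushm Q swap_measurable.
have swT Q : sw Q setT = 1 by rewrite pushmE preimage_setT; exact: (@probability_setT _ _ _ Q).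
have swh Q : \int[sw Q]_z h z = \int[Q]_z h z.
  by rewrite integral_pushm//; apply: eq_integral => -[x y] _ /=; rewrite hC.
have [Q1' Q1'E] := prob_of_measure (swT Q1).
have [Q2 [c1' [c2' [[c1'0 c2'0] Q2fst Q2snd Q2h]]]] :=
  redirect_fst mS1 mS2 mB nuS1 nuS2 mp p01 mh h0 k0 hS1 hS2 Q1'.
have Q1'h : \int[Q1']_z h z = \int[Q1]_z h z.
  by rewrite -swh; apply: eq_measure_integral => A _ _; rewrite Q1'E.
have Q1'fst A : measurable A -> Q1' (fst @^-1` A) = mu A.
  by move=> mA; rewrite Q1'E pushmE -(Pmu A mA).2 -(Q1snd A mA).
have Q1'snd A : measurable A -> Q1' (snd @^-1` A) = Q1 (fst @^-1` A).
  by move=> mA; rewrite Q1'E pushmE.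
have half0 : (0 <= 2^-1 :> R)%R by [].
pose half : {nonneg R} := NngNum half0.
pose ms : {measure set (T * T) -> \bar R} := measure_add Q2 (sw Q2).
pose m : {measure set (T * T) -> \bar R} := mscale half ms.
have mE A : m A = (2^-1)%:E * (Q2 A + sw Q2 A).
  by rewrite -(measure_addE Q2 (sw Q2)).
have mT : m setT = 1.
  by rewrite mE swT probability_setT -EFinD -EFinM; congr (_%:E); lra.
have [Q QE] := prob_of_measure mT.
have halfE (x y z : \bar R) (a b a' b' : R) : x \is a fin_num -> y \is a fin_num -> z \is a fin_num ->
    (2^-1)%:E * ((x + a%:E * y + b%:E * z) + (x + a'%:E * y + b'%:E * z)) =
    x + ((a + a') / 2)%:E * y + ((b + b') / 2)%:E * z.
  move=> /fineK <- /fineK <- /fineK <-; rewrite -!EFinM -!EFinD.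
  by congr (_%:E); lra.
exists Q, ((c1 + c1') / 2)%R, ((c2 + c2') / 2)%R; split.
- by split; apply: divr_ge0 => //; exact: addr_ge0.
- move=> A mA.
  have Pf : forall A, measurable A -> P (fst @^-1` A) = mu A by move=> ? /Pmu [].
  have intfin : \int[mu]_(x in A) (p x)%:E \is a fin_num.
    have mpA : measurable_fun A (fun x => (p x)%:E).
      exact/measurable_EFinP/measurable_funTS.
    have i0 : 0 <= \int[mu]_(x in A) (p x)%:E.
      by apply: integral_ge0 => x _; rewrite lee_fin; case/andP: (p01 x).
    rewrite ge0_fin_numE//; apply: (@le_lt_trans _ _ (\int[mu]_(x in A) cst 1 x)).
      apply: ge0_le_integral => //.
      - by move=> x _; rewrite lee_fin; case/andP: (p01 x).
      - by move=> x _; rewrite lee_fin; case/andP: (p01 x).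
    by rewrite integral_cst// mul1e -ge0_fin_numE//; exact: (fin_num_measure mu _ mA).
  have Q2f := Q2fst A mA; rewrite (integral_fst Q1'fst mA) in Q2f.
  have Q1f := Q1fst A mA; rewrite (integral_fst Pf mA) in Q1f.
  have Q2s := Q2snd A mA; rewrite (Q1'snd A mA) Q1f in Q2s.
  have n1 : nu1 A \is a fin_num by exact: fin_num_measure.
  have n2 : nu2 A \is a fin_num by exact: fin_num_measure.
  have sf : sw Q2 (fst @^-1` A) = Q2 (snd @^-1` A) by [].
  have ss : sw Q2 (snd @^-1` A) = Q2 (fst @^-1` A) by [].
  by split; rewrite QE mE ?sf ?ss Q2f Q2s halfE// [(c1 + _)%R]addrC [(c2 + _)%R]addrC.
have -> : \int[Q]_z h z = \int[m]_z h z.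
  by apply: eq_measure_integral => A _ _; rewrite QE.
rewrite [X in X <= _]ge0_integral_mscale//.
rewrite (@ge0_integral_measureD _ _ _ ms Q2 (sw Q2))//; last first.
  by move=> A mA; rewrite -(measure_addE Q2 (sw Q2)).
rewrite swh; have halfK (x : \bar R) : 0 <= x -> (2^-1)%:E * (x + x) = x.
  case: x => [r _| _|//]; first by rewrite -EFinD -EFinM; congr (_%:E); lra.
  by rewrite addye// gt0_muley// lte_fin.
rewrite [X in X <= _]halfK ?integral_ge0//.
apply: le_trans Q2h _; rewrite Q1'h.
have -> : (2 * k)%:E = k%:E + k%:E by rewrite -EFinD; congr (_%:E); lra.
by rewrite addeA leeD2r.
Qed.

End redirect_coupling.

(** * Coulomb potential and radial cutoffs *)

Section coulomb_bounds.
Context {R : realType}.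
Implicit Types (x y z : R3 R) (i j : 'I_3).

Lemma dist2C x y : dist2 x y = dist2 y x.
Proof. by apply: eq_bigr => i _; ring. Qed.

(** The triangle inequality for squared distances, lossy by a factor 2; most numerical constants of
    the surgery come from this factor. *)
Lemma dist2_quasi x y z : dist2 x y <= 2 * (dist2 x z + dist2 y z).
Proof.
rewrite /dist2 -big_split/= mulr_sumr; apply: ler_sum => i _.
have := sqr_ge0 (coord3 x i + coord3 y i - 2 * coord3 z i); nra.
Qed.

Lemma dist2_eq0 x y : dist2 x y = 0 -> x = y.
Proof.
move=> /eqP; rewrite psumr_eq0 => [/allP h|i _]; last exact: sqr_ge0.
have e i : coord3 y i = coord3 x i.
  by have := h i (mem_index_enum _); rewrite /= sqrf_eq0 subr_eq0 => /eqP.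
case: x y h e => -[a b] c [[a' b'] c'] _ e.
by have := e 0; have := e 1; have := e (@Ordinal 3 2 isT); rewrite /coord3 /= => -> -> ->.
Qed.

Lemma dist2xx x : dist2 x x = 0.
Proof. by rewrite /dist2 big1// => i _; rewrite subrr expr0n. Qed.

Lemma enormE x y : enorm (x - y) = Num.sqrt (dist2 y x).
Proof. by rewrite -enorm_dist2 sqrtr_sqr ger0_norm// sqrtr_ge0. Qed.

Lemma coulomb_ge0 x y : (0 <= coulomb x y)%E.
Proof. by rewrite /coulomb inve_ge0 lee_fin sqrtr_ge0. Qed.

Lemma coulombC x y : coulomb x y = coulomb y x.
Proof. by rewrite /coulomb !enormE dist2C. Qed.

Lemma coulomb_le (t : R) x y : 0 < t -> t ^+ 2 <= dist2 y x ->
  (coulomb x y <= (t^-1)%:E)%E.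
Proof.
move=> t0 td; have tn : t <= enorm (x - y).
  by rewrite enormE -[leLHS]ger0_norm ?(ltW t0)// -sqrtr_sqr ler_wsqrtr.
have n0 := lt_le_trans t0 tn.
by rewrite /coulomb inver gt_eqF// lee_fin lef_pV2.
Qed.

Lemma coulomb_ge (t : R) x y : 0 < t -> dist2 y x <= t ^+ 2 ->
  ((t^-1)%:E <= coulomb x y)%E.
Proof.
move=> t0 td; have tn : enorm (x - y) <= t.
  by rewrite enormE -[leRHS]ger0_norm ?(ltW t0)// -sqrtr_sqr ler_wsqrtr.
rewrite /coulomb inver; case: eqP => [_|/eqP n0]; first exact: leey.
by rewrite lee_fin lef_pV2// posrE lt0r n0 sqrtr_ge0.
Qed.

(** For [y > 0], [y <= coulomb] means [dist2 <= y^-2], also on the diagonal, where the inverse is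
    [+oo]. Superlevel sets are therefore preimages of half-lines under a continuous function. *)
Lemma measurable_coulomb :
  measurable_fun setT (fun z : R3 R * R3 R => coulomb z.1 z.2).
Proof.
have md : measurable_fun setT (fun z : R3 R * R3 R => dist2 z.2 z.1).
  apply: measurable_sum => i; apply: measurable_funX.
  have mc : measurable_fun setT (fun x : R3 R => coord3 x i).
    by apply: continuous_measurable3; exact: coord3_continuous.
  by apply: measurable_funB; apply: (measurableT_comp mc).
apply: (measurability _ (ErealGenCInfty.measurableE R)).
move=> _ [_ [y ->] <-]; rewrite setTI.
have [y0|y0] := leP y 0.
  rewrite (_ : _ @^-1` _ = setT)//; apply/seteqP; split => // z _ /=.
  by rewrite in_itv/= andbT (le_trans _ (coulomb_ge0 _ _))// lee_fin.
rewrite (_ : _ @^-1` _ = (fun z : R3 R * R3 R => dist2 z.2 z.1) @^-1` `]-oo, y^-1 ^+ 2]).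
  by rewrite -[X in measurable X]setTI; apply: md => //; exact: measurable_itv.
have y1 : 0 < y^-1 by rewrite invr_gt0.
apply/seteqP; split => z /=; rewrite !in_itv/= ?andbT => h; last first.
  by have := coulomb_ge y1 h; rewrite invrK.
rewrite leNgt; apply/negP => h2.
have s2 : y^-1 < enorm (z.1 - z.2).
  rewrite enormE -[ltLHS]ger0_norm ?(ltW y1)// -sqrtr_sqr ltr_sqrt//.
  by apply: le_lt_trans h2; exact: sqr_ge0.
have s0 := lt_trans y1 s2.
move: h; rewrite /coulomb inver gt_eqF// lee_fin leNgt => /negP; apply.
by rewrite invf_plt.
Qed.

Lemma measurable_coulombr y : measurable_fun setT (fun x : R3 R => coulomb x y).
Proof.
apply: (measurableT_comp measurable_coulomb (g := fun x : R3 R => (x, y))).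
exact: measurable_fun_pair.
Qed.

End coulomb_bounds.

(** * Radial cutoffs, their profiles and normalized bumps *)

Section radial_cutoff.
Context {R : realType}.
Variables (F : R -> R) (K : R).
Hypotheses (sF : smooth1 F) (F01 : forall t, 0 <= F t <= 1).
Hypotheses (dFK : forall t, derive1 F t ^+ 2 <= K * (1 - F t)) (K0 : 0 < K).
Hypotheses (dF2 : forall t, 2 <= t -> derive1 F t = 0).
Implicit Types (x Y : R3 R) (a : R).

Definition radial a Y (x : R3 R) : R := F (a * dist2 Y x).

Lemma smooth3_radial a Y : smooth3 (radial a Y).
Proof.
move=> n; apply: (@Ck_comp _ n F (fun x => a * dist2 Y x)); first exact: sF.
by apply: CkM; [exact: Ck_cst|exact: smooth3_dist2].
Qed.

Lemma derive_radial a Y i x : 'D_(basis3 R i) (radial a Y) x =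
  derive1 F (a * dist2 Y x) * (a * (2 * (coord3 x i - coord3 Y i))).
Proof.
have d1 : is_derive x (basis3 R i) (fun x : R3 R => a * dist2 Y x)
    (a * (2 * (coord3 x i - coord3 Y i))).
  exact: (is_deriveZ a (is_derive_dist2 Y i x)).
have d2 : is_derive x (basis3 R i) (radial a Y)
    (derive1 F (a * dist2 Y x) * (a * (2 * (coord3 x i - coord3 Y i)))).
  apply: is_derive_comp1 => //; last exact: smooth1_is_derive.
  have s : smooth3 (fun x : R3 R => a * dist2 Y x).
    by move=> n; apply: CkM; [exact: Ck_cst|exact: smooth3_dist2].
  exact: (smooth3_continuous s).
exact: (derive_val (is_derive := d2)).
Qed.

Lemma derive_radial_eq0 a Y i x : derive1 F (a * dist2 Y x) = 0 ->
  'D_(basis3 R i) (radial a Y) x = 0.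
Proof. by rewrite derive_radial => ->; rewrite mul0r. Qed.

(** With [t = a * dist2 Y x] the squared gradient is [4 * a * t * F'(t)^2]. Since [F'] vanishes for
    [t >= 2], the factor [t] may be replaced by 2. *)
Lemma radial_gradient_le a Y x : 0 < a ->
  \sum_(i < 3) ('D_(basis3 R i) (radial a Y) x) ^+ 2 <=
  8 * a * K * (1 - radial a Y x).
Proof.
move=> a0; set t := a * dist2 Y x.
have -> : \sum_(i < 3) ('D_(basis3 R i) (radial a Y) x) ^+ 2 =
    4 * a * t * derive1 F t ^+ 2.
  transitivity (\sum_(i < 3) 4 * a ^+ 2 * derive1 F t ^+ 2 * (coord3 x i - coord3 Y i) ^+ 2).
    by apply: eq_bigr => i _; rewrite derive_radial -/t; ring.
  by rewrite -mulr_sumr -/(dist2 Y x) /t; ring.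
have [t2|t2] := leP 2 t.
  rewrite dF2// expr0n mulr0 !mulr_ge0 ?(ltW K0) ?(ltW a0)//.
  by rewrite subr_ge0; case/andP: (F01 t).
apply: (@le_trans _ _ (4 * a * 2 * derive1 F t ^+ 2)).
  by rewrite ler_wpM2r ?sqr_ge0// ler_wpM2l ?(ltW t2)// mulr_ge0 ?ltW.
have -> : 8 * a * K * (1 - radial a Y x) = 4 * a * 2 * (K * (1 - F t)).
  by rewrite /radial -/t; ring.
by rewrite ler_wpM2l// !mulr_ge0 ?ltW.
Qed.

Lemma radial_gradient_sqr_le a Y x : 0 < a ->
  \sum_(i < 3) ('D_(basis3 R i) (radial a Y) x) ^+ 2 <=
  8 * a * K * (1 - radial a Y x ^+ 2).
Proof.
move=> a0; apply: le_trans (radial_gradient_le Y x a0) _.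
rewrite ler_wpM2l ?mulr_ge0 ?(ltW K0) ?(ltW a0)// lerD2l lerN2.
by have /andP[? ?] := F01 (a * dist2 Y x); rewrite expr2 ler_piMr.
Qed.

End radial_cutoff.

(** The variable stands for squared distance over squared scale, the transition taking place between
    1 and 2. The inequality controls the derivative only where the profile approaches 1. *)
Definition cutoff_profile (R : realType) (K : R) (F : R -> R) : Prop :=
  [/\ smooth1 F, forall t, 0 <= F t <= 1,
      forall t, derive1 F t ^+ 2 <= K * (1 - F t),
      forall t, t <= 1 -> derive1 F t = 0 &
      forall t, 2 <= t -> derive1 F t = 0].

Section profiles.
Context {R : realType}.

Lemma smooth1_affine (c e : R) (w : R -> R) : smooth1 w ->
  smooth1 (fun t => w (c + e * t)) /\
  forall t, derive1 (fun t => w (c + e * t)) t = derive1 w (c + e * t) * e.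
Proof.
move=> sw.
have sl : smooth1 (fun t : R => c + e * t).
  move=> n; apply: (@Ck1D R n (cst c) (fun t => e * t)); first exact: Ck1_cst.
  by apply: (@Ck1M R n (cst e) idfun); [exact: Ck1_cst|exact: Ck1_id].
split; first by move=> n; apply: (@Ck1_comp R n w (fun t => c + e * t)).
move=> t.
have dl : is_derive t (1 : R) (fun t : R => c + e * t) e.
  have d1 : is_derive t (1 : R) (cst c + e \*: idfun) (0 + e *: 1).
    exact: (is_deriveD (is_derive_cst c t 1) (is_deriveZ e (is_derive_id t 1))).
  by apply: is_derive_eq d1 _; rewrite add0r /GRing.scale/= mulr1.
have dw := smooth1_is_derive (c + e * t) sw.
have d := @is_derive1_comp R w (fun t => c + e * t) t _ _ dw dl.
by rewrite derive1E; exact: (derive_val (is_derive := d)).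
Qed.

Lemma cutoff_profiles : exists (eta zeta : R -> R) (K : R),
  [/\ 0 < K, cutoff_profile K eta /\ cutoff_profile K zeta,
      forall t, t <= 1 -> eta t = 1 /\ zeta t = 0 &
      forall t, 2 <= t -> eta t = 0 /\ zeta t = 1].
Proof.
have [w [K [K0 sw w0 w1 w01]]] := @smooth_step R.
(* Both profiles come from one step, [eta] by reflection and [zeta] by translation; neither
   operation changes the squared derivative bound. *)
exists (fun t => w (2 + (-1) * t)), (fun t => w (- 1 + 1 * t)), K.
have [se dse] := smooth1_affine 2 (-1) sw; have [sz dsz] := smooth1_affine (-1) 1 sw.
split=> //.
- split; split => //= t.
  + by case: (w01 (2 + (-1) * t)).
  + by rewrite dse mulrN1 sqrrN; case: (w01 (2 + (-1) * t)).
  + by move=> t1; rewrite dse (w1 _ _).2 ?mul0r//; lra.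
  + by move=> t1; rewrite dse (w0 _ _).2 ?mul0r//; lra.
  + by case: (w01 (-1 + 1 * t)).
  + by rewrite dsz mulr1; case: (w01 (-1 + 1 * t)).
  + by move=> t1; rewrite dsz (w0 _ _).2 ?mul0r//; lra.
  + by move=> t1; rewrite dsz (w1 _ _).2 ?mul0r//; lra.
- by move=> t t1; split; [apply: (w1 _ _).1; lra|apply: (w0 _ _).1; lra].
- by move=> t t1; split; [apply: (w0 _ _).1; lra|apply: (w1 _ _).1; lra].
Qed.

Implicit Types (x Y : R3 R) (i j : 'I_3).

Lemma suppb_compact (r : R) (f : R3 R -> R) : suppb r f ->
  compact (closure [set x | f x != 0]).
Proof.
move=> sf.
have cK : compact (box (0 : R3 R) r).
  by apply: compact_setX; [apply: compact_setX|]; exact: segment_compact.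
have clK : closed (box (0 : R3 R) r) by apply: compact_closed => //; exact: norm_hausdorff.
apply: (@subclosed_compact _ _ _ _ cK); first exact: closed_closure.
rewrite [X in _ `<=` X](closure_id _).1//; apply: closureS => x /= fx.
apply: contrapT => nb; move/eqP: fx; apply; exact: suppb_boxN sf nb.
Qed.

Lemma sqr_coord_le_dist2 Y x i : (coord3 x i - coord3 Y i) ^+ 2 <= dist2 Y x.
Proof.
rewrite /dist2 (bigD1 i)//= lerDl.
by apply: sumr_ge0 => j _; exact: sqr_ge0.
Qed.

Lemma ball_suppb (s : R) Y (f : R3 R -> R) : 0 < s ->
  (forall x, s ^+ 2 <= dist2 Y x -> f x = 0) ->
  exists2 r : R, 0 < r & suppb r f.
Proof.
move=> s0 f0; exists (\sum_(j < 3) `|coord3 Y j| + s).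
  by rewrite ltr_wpDl// sumr_ge0.
move=> x i rx; apply: f0; apply: le_trans (sqr_coord_le_dist2 Y x i).
have Yi : `|coord3 Y i| <= \sum_(j < 3) `|coord3 Y j|.
  by rewrite (bigD1 i)//= lerDl sumr_ge0.
rewrite -[leRHS]real_normK ?num_real//; apply: lerXn2r; rewrite ?nnegrE ?(ltW s0)//.
have := ler_distD (coord3 Y i) (coord3 x i) 0; rewrite !subr0; lra.
Qed.

Lemma dist2_le_box (s : R) Y x : 0 < s ->
  box Y (s / 3) x -> dist2 Y x <= s ^+ 2 / 3.
Proof.
move=> s0 /boxP h; rewrite /dist2.
have -> : s ^+ 2 / 3 = \sum_(i < 3) (s / 3) ^+ 2.
  by rewrite sumr_const card_ord -mulr_natr; field.
apply: ler_sum => i _; rewrite -[leLHS]real_normK ?num_real//.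
by apply: lerXn2r (h i); rewrite nnegrE ?divr_ge0// ltW.
Qed.

Lemma box_dist2 (s : R) Y x : 0 < s -> dist2 Y x < s ^+ 2 -> box Y s x.
Proof.
move=> s0 h; apply/boxP => i; rewrite leNgt; apply/negP => sx.
have := le_lt_trans (sqr_coord_le_dist2 Y x i) h; rewrite ltNge => /negP; apply.
by rewrite -[leRHS]real_normK ?num_real//; apply: lerXn2r (ltW sx); rewrite nnegrE ?(ltW s0).
Qed.

(** A radial cutoff divided by its L2 norm. The cutoff is 1 on the cube of half-side [s / 3] and its
    gradient vanishes off that of half-side [s]. The gradient bound [8 * a * K = 16 * K / s^2] times
    the volume ratio [3^3] gives [432 * K / s^2]. *)
Lemma smooth_bump : exists A : R, 0 < A /\ forall (Y : R3 R) (s : R), 0 < s ->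
  exists w : R3 R -> R,
  [/\ test_function w, forall x, 0 <= w x,
      forall x, s ^+ 2 <= dist2 Y x -> w x = 0 /\ forall i, 'D_(basis3 R i) w x = 0,
      (\int[@leb3 R]_x (w x ^+ 2)%:E = 1)%E &
      (\int[@leb3 R]_x (\sum_(i < 3) ('D_(basis3 R i) w x) ^+ 2)%:E <= (A / s ^+ 2)%:E)%E].
Proof.
have [eta [zeta [K [K0 [[se e01 deK de1 de2] _] e1 e2]]]] := cutoff_profiles.
exists (432 * K); split; first by rewrite (pmulr_rgt0 K (ltr0Sn R 431)).
move=> Y s s0.
(* So that the profile, which dies at 2, vanishes for [dist2 >= s^2] and equals 1 for
   [dist2 <= s^2 / 2]. *)
pose a := 2 / s ^+ 2.
have ss0 : 0 < s ^+ 2 by rewrite exprn_gt0.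
have a0 : 0 < a by rewrite divr_gt0.
pose w0 := radial eta a Y.
have sw0 : smooth3 w0 by exact: smooth3_radial.
have w00 x : s ^+ 2 <= dist2 Y x -> w0 x = 0 /\ forall i, 'D_(basis3 R i) w0 x = 0.
  move=> h; have t2 : 2 <= a * dist2 Y x by rewrite /a mulrAC ler_pdivlMr// ler_wpM2l.
  split; first by case: (e2 _ t2).
  by move=> i; apply: derive_radial_eq0 => //; exact: de2.
have [r r0 sp0] := ball_suppb s0 (fun x h => (w00 x h).1).
have cw0 := smooth3_continuous sw0.
have iw0 : (@leb3 R).-integrable setT (fun x => (w0 x ^+ 2)%:E).
  apply: (L2_sqr_integrable (u := w0)); exact: (L2_suppb r0 cw0 sp0).
have [m mE] : exists m : R, (\int[@leb3 R]_x (w0 x ^+ 2)%:E)%E = m%:E.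
  exists (fine (\int[@leb3 R]_x (w0 x ^+ 2)%:E)%E).
  by rewrite fineK//; exact: integrable_fin_num.
have boxge (s' C : R) : 0 < s' -> 0 <= C ->
    (\int[@leb3 R]_(x in box Y s') (cst C%:E) x = (C * (2 * s') ^+ 3)%:E)%E.
  move=> s'0 C0; rewrite integral_cst; last exact: measurable_box.
  by rewrite [X in (_ * X)%E]leb3_box ?(ltW s'0)// -EFinM.
have m_ge : (2 * (s / 3)) ^+ 3 <= m.
  rewrite -lee_fin -mE -[X in X%:E]mul1r -boxge ?divr_gt0//.
  apply: (@le_trans _ _ (\int[@leb3 R]_(x in box Y (s / 3)) (w0 x ^+ 2)%:E)%E).
    apply: ge0_le_integral => //.
    - exact: measurable_box.
    - apply/measurable_EFinP; apply: measurable_funTS; apply: measurable_funX.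
      exact: continuous_measurable3.
    - move=> x bx; rewrite lee_fin.
      suff -> : w0 x = 1 by rewrite expr1n.
      apply: (e1 (a * dist2 Y x) _).1.
      rewrite /a mulrAC ler_pdivrMr// mul1r.
      have := dist2_le_box s0 bx; lra.
  apply: ge0_subset_integral => //; first exact: measurable_box.
  - by apply/measurable_EFinP; apply: measurable_funX; exact: continuous_measurable3.
  - by move=> x _; rewrite lee_fin sqr_ge0.
have m0 : 0 < m by apply: lt_le_trans m_ge; rewrite exprn_gt0// mulr_gt0// divr_gt0.
pose l := (Num.sqrt m)^-1.
have l2 : l ^+ 2 = m^-1 by rewrite exprVn sqr_sqrtr// ltW.
pose w x := l * w0 x.
have sw : smooth3 w by move=> n; apply: CkM; [exact: Ck_cst|exact: sw0].
have dw i x : 'D_(basis3 R i) w x = l * 'D_(basis3 R i) w0 x.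
  have d0 := smooth3_is_derive i x sw0.
  exact: (derive_val (is_derive := is_deriveZ l d0)).
exists w; split.
- split=> //; apply: (@suppb_compact r) => x i rx.
  by rewrite /w (sp0 x i rx) mulr0.
- by move=> x; rewrite mulr_ge0 ?invr_ge0 ?sqrtr_ge0//; case/andP: (e01 (a * dist2 Y x)).
- move=> x h; have [h1 h2] := w00 x h; split; first by rewrite /w h1 mulr0.
  by move=> i; rewrite dw h2 mulr0.
- under eq_integral => x _ do rewrite exprMn EFinM.
  by rewrite integralZl// mE l2 -EFinM mulVf// gt_eqF.
- pose g x := \sum_(i < 3) ('D_(basis3 R i) w0 x) ^+ 2.
  have g0 x : 0 <= g x by apply: sumr_ge0 => i _; exact: sqr_ge0.
  have mg : measurable_fun setT g.
    apply: measurable_sum => i; apply: measurable_funX; apply: continuous_measurable3.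
    by apply: smooth3_continuous; exact: smooth3_derive.
  have -> : (\int[@leb3 R]_x (\sum_(i < 3) ('D_(basis3 R i) w x) ^+ 2)%:E =
      (m^-1)%:E * \int[@leb3 R]_x (g x)%:E)%E.
    rewrite -ge0_integralZl//; last 3 first.
    + exact/measurable_EFinP.
    + by move=> x _; rewrite lee_fin.
    + by rewrite lee_fin invr_ge0 ltW.
    apply: eq_integral => x _; rewrite -EFinM -l2 /g mulr_sumr; congr (_%:E).
    by apply: eq_bigr => i _; rewrite dw exprMn.
  have C0 : 0 <= 8 * a * K by apply: mulr_ge0 (ltW K0); apply: mulr_ge0 (ltW a0).
  have gint : (\int[@leb3 R]_x (g x)%:E <= (8 * a * K * (2 * s) ^+ 3)%:E)%E.
    rewrite -boxge//.
    apply: (@le_trans _ _ (\int[@leb3 R]_(x in box Y s) (g x)%:E)%E).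
      rewrite [leRHS]integral_mkcond; apply: ge0_le_integral => //.
      + by move=> x _; rewrite lee_fin.
      + exact/measurable_EFinP.
      + apply/(measurable_restrictT _ _).1; first exact: measurable_box.
        exact/measurable_EFinP/measurable_funTS.
      + move=> x _; rewrite patchE; case: ifPn => // /negP; rewrite inE => nb.
        rewrite /g big1// => i _; have [|_ ->] := w00 x; last by rewrite expr0n.
        by rewrite leNgt; apply/negP => h; apply: nb; exact: box_dist2.
    apply: ge0_le_integral => //.
    + exact: measurable_box.
    + by move=> x _; rewrite lee_fin.
    + exact/measurable_EFinP/measurable_funTS.
    + move=> x _; rewrite lee_fin.
      apply: le_trans (radial_gradient_le se e01 deK K0 de2 Y x a0) _.
      rewrite ler_piMr// ?lerBlDr ?lerDl//; last by case/andP: (e01 (a * dist2 Y x)).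
  have : ((m^-1)%:E * \int[@leb3 R]_x (g x)%:E <=
      (m^-1)%:E * (8 * a * K * (2 * s) ^+ 3)%:E)%E.
    by rewrite lee_wpmul2l// lee_fin invr_ge0 ltW.
  move=> /le_trans; apply; rewrite -EFinM lee_fin ler_pdivrMl//.
  apply: (@le_trans _ _ ((2 * (s / 3)) ^+ 3 * (432 * K / s ^+ 2))); last first.
    have h432 := divr_ge0 (mulr_ge0 (ltW (ltr0Sn R 431)) (ltW K0)) (ltW ss0).
    exact: ler_wpM2r h432 _ _ m_ge.
  rewrite le_eqVlt; apply/orP; left; apply/eqP; rewrite /a; field.
  by rewrite gt_eqF.
Qed.

End profiles.

(** * Effect of the surgery on kinetic and potential energy *)

Section good_cutoff.
Context {R : realType}.
Implicit Types (xi : R3 R -> R) (x : R3 R) (i j : 'I_3).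

(** The energy inequality itself is recorded, for arbitrary values of the function and its gradient:
    in this form it passes to products. *)
Definition good_cutoff (K : R) xi : Prop :=
  [/\ smooth3 xi, forall x, 0 <= xi x <= 1,
      exists C : R, forall i x, `|'D_(basis3 R i) xi x| <= C &
      forall x (u : R) (g : 'I_3 -> R),
        \sum_(i < 3) (xi x * g i + 'D_(basis3 R i) xi x * u) ^+ 2 <=
        \sum_(i < 3) g i ^+ 2 + K * u ^+ 2].

Lemma good_cutoffI (K : R) xi : 0 <= K -> smooth3 xi -> (forall x, 0 <= xi x <= 1) ->
  (forall x, \sum_(i < 3) ('D_(basis3 R i) xi x) ^+ 2 <= K * (1 - xi x ^+ 2)) ->
  good_cutoff K xi.
Proof.
move=> K0 sxi xi01 dxi; split=> //; last by move=> x u g; exact: cutoff_energy_le.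
exists (K + 1) => i x.
have : ('D_(basis3 R i) xi x) ^+ 2 <= K.
  apply: (@le_trans _ _ (\sum_(i < 3) ('D_(basis3 R i) xi x) ^+ 2)).
    by rewrite (bigD1 i)//= lerDl; apply: sumr_ge0 => j _; exact: sqr_ge0.
  by apply: le_trans (dxi x) _; rewrite ler_piMr// lerBlDr lerDl sqr_ge0.
rewrite -real_normK ?num_real// => h.
rewrite leNgt; apply/negP => h2; have := normr_ge0 ('D_(basis3 R i) xi x); nra.
Qed.

(** The inequality for [xi1] is applied to [xi2 * u] and its gradient, then the one for [xi2] to
    [u]; constants add because [xi2] is at most 1. *)
Lemma good_cutoffM (K1 K2 : R) xi1 xi2 : 0 <= K1 -> good_cutoff K1 xi1 -> good_cutoff K2 xi2 ->
  good_cutoff (K1 + K2) (xi1 \* xi2).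
Proof.
move=> K10 [s1 x1 [C1 d1] e1] [s2 x2 [C2 d2] e2]; split.
- by move=> n; exact: CkM.
- move=> x; have /andP[? ?] := x1 x; have /andP[? ?] := x2 x.
  by rewrite mulr_ge0//= mulr_ile1.
- exists (C1 + C2) => i x; rewrite derive_mul//.
  have /andP[? ?] := x1 x; have /andP[? ?] := x2 x.
  rewrite addrC; apply: le_trans (ler_normD _ _) _; apply: lerD.
    apply: le_trans (d1 i x); rewrite normrM ger0_norm// ler_piMl//.
  by apply: le_trans (d2 i x); rewrite normrM ger0_norm// ler_piMl.
- move=> x u g.
  have /andP[? ?] := x2 x.
  have := e1 x (xi2 x * u) (fun i => xi2 x * g i + 'D_(basis3 R i) xi2 x * u).
  have := e2 x u g.
  have -> : \sum_(i < 3) ((xi1 \* xi2) x * g i + 'D_(basis3 R i) (xi1 \* xi2) x * u) ^+ 2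
    = \sum_(i < 3) (xi1 x * (xi2 x * g i + 'D_(basis3 R i) xi2 x * u) +
         'D_(basis3 R i) xi1 x * (xi2 x * u)) ^+ 2.
    by apply: eq_bigr => i _; rewrite derive_mul//=; congr (_ ^+ 2); ring.
  move=> h2 h1; apply: le_trans h1 _; rewrite mulrDl addrCA.
  have h3 : K1 * (xi2 x * u) ^+ 2 <= K1 * u ^+ 2.
    by rewrite ler_wpM2l// exprMn ler_piMl ?sqr_ge0// expr_le1.
  by rewrite addrC lerD.
Qed.

End good_cutoff.

Section kinetic_surgery.
Context {R : realType}.
Implicit Types (x : R3 R) (i j : 'I_3).

Lemma kinetic_ge0 (rho : probability (R3 R) R) : (0 <= kinetic rho)%E.
Proof.
apply: le_ereal_inf_tmp => _ [f [g [_ _ ->]]].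
by apply: integral_ge0 => x _; rewrite lee_fin; apply: sumr_ge0 => i _; exact: sqr_ge0.
Qed.

(** At every point at most one of [xi], [w1], [w2] is active, so the square root of the new density
    is [xi * sqrt f + sqrt c1 * w1 + sqrt c2 * w2] and its squared gradient has no mixed terms. The
    term [K] is the integral of [K * f], as [mu] has mass 1. *)
Lemma kinetic_surgery_le (mu mu' nu1 nu2 : probability (R3 R) R) (f : R3 R -> R)
  (g : 'I_3 -> R3 R -> R) (xi w1 w2 : R3 R -> R) (K a c1 c2 : R) (D1 D2 : set (R3 R)) :
  density mu f -> H1_gradient (fun x => Num.sqrt (f x)) g ->
  0 <= K -> good_cutoff K xi -> 0 <= c1 -> 0 <= c2 ->
  test_function w1 -> test_function w2 -> (forall x, 0 <= w1 x) -> (forall x, 0 <= w2 x) ->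
  (forall x, ~ D1 x -> w1 x = 0 /\ forall i, 'D_(basis3 R i) w1 x = 0) ->
  (forall x, ~ D2 x -> w2 x = 0 /\ forall i, 'D_(basis3 R i) w2 x = 0) ->
  (forall x, D1 x \/ D2 x -> xi x = 0 /\ forall i, 'D_(basis3 R i) xi x = 0) ->
  (forall x, ~ (D1 x /\ D2 x)) ->
  (forall A, measurable A -> nu1 A = (\int[@leb3 R]_(x in A) (w1 x ^+ 2)%:E)%E) ->
  (forall A, measurable A -> nu2 A = (\int[@leb3 R]_(x in A) (w2 x ^+ 2)%:E)%E) ->
  (\int[@leb3 R]_x (\sum_(i < 3) ('D_(basis3 R i) w1 x) ^+ 2)%:E <= a%:E)%E ->
  (\int[@leb3 R]_x (\sum_(i < 3) ('D_(basis3 R i) w2 x) ^+ 2)%:E <= a%:E)%E ->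
  (forall A, measurable A -> mu' A =
     (\int[mu]_(x in A) (xi x ^+ 2)%:E + c1%:E * nu1 A + c2%:E * nu2 A)%E) ->
  (kinetic mu' <= \int[@leb3 R]_x (\sum_(i < 3) g i x ^+ 2)%:E + (K + (c1 + c2) * a)%:E)%E.
Proof.
move=> [mf f0 muE] Hu K0 [sxi xi01 [C dxiC] exi] c10 c20 tw1 tw2 w10 w20 D1w D2w Dxi D12
  nu1E nu2E a1 a2 mu'E.
have [[sw1 _] [sw2 _]] := (tw1, tw2).
have mxi : measurable_fun setT xi.
  by apply: continuous_measurable3; exact: smooth3_continuous.
have mw1 : measurable_fun setT w1.
  by apply: continuous_measurable3; exact: smooth3_continuous.
have mw2 : measurable_fun setT w2.
  by apply: continuous_measurable3; exact: smooth3_continuous.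
pose r1 := Num.sqrt c1; pose r2 := Num.sqrt c2.
have r1E : r1 ^+ 2 = c1 by rewrite sqr_sqrtr.
have r2E : r2 ^+ 2 = c2 by rewrite sqr_sqrtr.
have [r10 r20] : 0 <= r1 /\ 0 <= r2 by rewrite !sqrtr_ge0.
pose u x := Num.sqrt (f x).
pose f' x := xi x ^+ 2 * f x + c1 * w1 x ^+ 2 + c2 * w2 x ^+ 2.
have scale_test r w : test_function w -> test_function (fun x => r * w x).
  by move=> tw; apply: (@test_functionM R (fun=> r) w) => // n; exact: Ck_cst.
have dscale r w i x : smooth3 w ->
    'D_(basis3 R i) (fun x => r * w x) x = r * 'D_(basis3 R i) w x.
  move=> sw; have d0 := smooth3_is_derive i x sw.
  exact: (derive_val (is_derive := is_deriveZ r d0)).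
have Hv1 := H1_gradient_test (scale_test r1 _ tw1).
have Hv2 := H1_gradient_test (scale_test r2 _ tw2).
have xi1 x : `|xi x| <= Num.max C 1.
  by have /andP[? ?] := xi01 x; rewrite ger0_norm// le_max orbC; apply/orP; left.
have dxi1 i x : `|'D_(basis3 R i) xi x| <= Num.max C 1.
  by rewrite le_max dxiC.
have Hxi := H1_gradient_mul sxi xi1 dxi1 Hu.
have Hv := H1_gradientD (H1_gradientD Hxi Hv1) Hv2.
set G := (fun i => _) in Hv.
have cases x : [\/ D1 x /\ ~ D2 x, D2 x /\ ~ D1 x | ~ D1 x /\ ~ D2 x].
  have [d1|d1] := pselect (D1 x); have [d2|d2] := pselect (D2 x).
  - by case: (D12 x).
  - by apply: Or31.
  - by apply: Or32.
  - by apply: Or33.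
have sqrtf' : (fun x => Num.sqrt (f' x)) =
    ((xi \* u) \+ (fun x => r1 * w1 x)) \+ (fun x => r2 * w2 x).
  apply/funext => x; rewrite /= /f'.
  have [[d1 d2]|[d2 d1]|[d1 d2]] := cases x.
  - rewrite (Dxi x (or_introl d1)).1 (D2w x d2).1 !mul0r expr0n/= !mulr0 mul0r !addr0 !add0r.
    by rewrite -r1E -exprMn sqrtr_sqr ger0_norm// mulr_ge0.
  - rewrite (Dxi x (or_intror d2)).1 (D1w x d1).1 !mul0r expr0n/= !mulr0 mul0r !add0r.
    by rewrite -r2E -exprMn sqrtr_sqr ger0_norm// mulr_ge0.
  - rewrite (D2w x d2).1 (D1w x d1).1 !expr0n/= !mulr0 !addr0.
    by rewrite sqrtrM ?sqr_ge0// sqrtr_sqr ger0_norm//; case/andP: (xi01 x).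
have dens' : density mu' f'.
  split.
  - apply: measurable_funD; first apply: measurable_funD.
    + by apply: measurable_funM => //; exact: measurable_funX.
    + by apply: measurable_funM => //; exact: measurable_funX.
    + by apply: measurable_funM => //; exact: measurable_funX.
  - by move=> x; rewrite !addr_ge0// mulr_ge0// sqr_ge0.
  - move=> A mA; rewrite mu'E// nu1E// nu2E//.
    have xi20 x : (0 <= (xi x ^+ 2)%:E)%E by rewrite lee_fin sqr_ge0.
    have -> : (\int[mu]_(x in A) (xi x ^+ 2)%:E =
        \int[@leb3 R]_(x in A) (xi x ^+ 2 * f x)%:E)%E.
      rewrite integral_mkcond [RHS]integral_mkcond.
      have mh : measurable_fun setT ((fun x => (xi x ^+ 2)%:E) \_ A).
        apply/(measurable_restrictT _ _).1 => //.
        by apply/measurable_EFinP; apply: measurable_funTS; exact: measurable_funX.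
      have h0 x : (0 <= ((fun x => (xi x ^+ 2)%:E) \_ A) x)%E.
        by rewrite patchE; case: ifPn.
      rewrite (ge0_integral_density mf f0 muE mh h0).
      apply: eq_integral => x _; rewrite !patchE; case: ifPn => _; rewrite ?mul0e//.
    have m1 : measurable_fun A (fun x => (xi x ^+ 2 * f x)%:E).
      apply/measurable_EFinP; apply: measurable_funTS; apply: measurable_funM => //.
      exact: measurable_funX.
    have m2 : measurable_fun A (fun x => (w1 x ^+ 2)%:E).
      by apply/measurable_EFinP; apply: measurable_funTS; exact: measurable_funX.
    have m3 : measurable_fun A (fun x => (w2 x ^+ 2)%:E).
      by apply/measurable_EFinP; apply: measurable_funTS; exact: measurable_funX.
    rewrite -ge0_integralZl//; last by move=> x _; rewrite lee_fin sqr_ge0.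
    rewrite -ge0_integralZl//; last by move=> x _; rewrite lee_fin sqr_ge0.
    have p1 x : A x -> (0 <= (xi x ^+ 2 * f x)%:E)%E.
      by move=> _; rewrite lee_fin mulr_ge0// sqr_ge0.
    have p2 x : A x -> (0 <= c1%:E * (w1 x ^+ 2)%:E)%E.
      by move=> _; rewrite mule_ge0// lee_fin sqr_ge0.
    have p3 x : A x -> (0 <= c2%:E * (w2 x ^+ 2)%:E)%E.
      by move=> _; rewrite mule_ge0// lee_fin sqr_ge0.
    have m2' : measurable_fun A (fun x => c1%:E * (w1 x ^+ 2)%:E)%E.
      exact: emeasurable_funM.
    have m3' : measurable_fun A (fun x => c2%:E * (w2 x ^+ 2)%:E)%E.
      exact: emeasurable_funM.
    rewrite -(ge0_integralD _ mA p1 m1 p2 m2').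
    have p12 x : A x -> (0 <= (xi x ^+ 2 * f x)%:E + c1%:E * (w1 x ^+ 2)%:E)%E.
      by move=> Ax; rewrite adde_ge0 ?p1 ?p2.
    by rewrite -(ge0_integralD _ mA p12 (emeasurable_funD m1 m2') p3 m3').
have GE x : \sum_(i < 3) G i x ^+ 2 <= \sum_(i < 3) g i x ^+ 2 + K * f x +
    c1 * \sum_(i < 3) ('D_(basis3 R i) w1 x) ^+ 2 +
    c2 * \sum_(i < 3) ('D_(basis3 R i) w2 x) ^+ 2.
  have s0 (h : 'I_3 -> R) : 0 <= \sum_(i < 3) h i ^+ 2.
    by apply: sumr_ge0 => i _; exact: sqr_ge0.
  have Kf : 0 <= K * f x by rewrite mulr_ge0.
  have uE : u x ^+ 2 = f x by rewrite sqr_sqrtr.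
  have GiE i : G i x = xi x * g i x + 'D_(basis3 R i) xi x * u x +
      r1 * 'D_(basis3 R i) w1 x + r2 * 'D_(basis3 R i) w2 x.
    by rewrite /G /= !dscale.
  have [[d1 d2]|[d2 d1]|[d1 d2]] := cases x.
  - have -> : \sum_(i < 3) G i x ^+ 2 = c1 * \sum_(i < 3) ('D_(basis3 R i) w1 x) ^+ 2.
      rewrite mulr_sumr; apply: eq_bigr => i _; rewrite GiE (Dxi x (or_introl d1)).1.
      by rewrite (Dxi x (or_introl d1)).2 (D2w x d2).2 !mul0r mulr0 !add0r addr0 exprMn r1E.
    have := s0 (g ^~ x); have := mulr_ge0 c20 (s0 (fun i => 'D_(basis3 R i) w2 x)); lra.
  - have -> : \sum_(i < 3) G i x ^+ 2 = c2 * \sum_(i < 3) ('D_(basis3 R i) w2 x) ^+ 2.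
      rewrite mulr_sumr; apply: eq_bigr => i _; rewrite GiE (Dxi x (or_intror d2)).1.
      by rewrite (Dxi x (or_intror d2)).2 (D1w x d1).2 !mul0r mulr0 !add0r exprMn r2E.
    have := s0 (g ^~ x); have := mulr_ge0 c10 (s0 (fun i => 'D_(basis3 R i) w1 x)); lra.
  - have -> : \sum_(i < 3) G i x ^+ 2 =
        \sum_(i < 3) (xi x * g i x + 'D_(basis3 R i) xi x * u x) ^+ 2.
      by apply: eq_bigr => i _; rewrite GiE (D1w x d1).2 (D2w x d2).2 !mulr0 !addr0.
    have := exi x (u x) (g ^~ x); rewrite uE.
    have := mulr_ge0 c20 (s0 (fun i => 'D_(basis3 R i) w2 x)).
    have := mulr_ge0 c10 (s0 (fun i => 'D_(basis3 R i) w1 x)); lra.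
apply: (@le_trans _ _ (\int[@leb3 R]_x (\sum_(i < 3) G i x ^+ 2)%:E)%E).
  apply: ereal_inf_lbound; exists f', G; split=> //.
  by rewrite sqrtf'.
have mdw w : smooth3 w ->
    measurable_fun setT (fun x => (\sum_(i < 3) ('D_(basis3 R i) w x) ^+ 2)%:E).
  move=> sw; apply/measurable_EFinP; apply: measurable_sum => i; apply: measurable_funX.
  by apply: continuous_measurable3; apply: smooth3_continuous; exact: smooth3_derive.
have mg (h : 'I_3 -> R3 R -> R) : (forall i, measurable_fun setT (h i)) ->
    measurable_fun setT (fun x => (\sum_(i < 3) h i x ^+ 2)%:E).
  by move=> mh; apply/measurable_EFinP; apply: measurable_sum => i; exact: measurable_funX.
have sum0 (h : 'I_3 -> R3 R -> R) x : (0 <= (\sum_(i < 3) h i x ^+ 2)%:E)%E.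
  by rewrite lee_fin; apply: sumr_ge0 => i _; exact: sqr_ge0.
have mgg := mg g (fun i => (Hu.2 i).1.1).
have mK : measurable_fun setT (fun x => K%:E * (f x)%:E)%E.
  by apply: emeasurable_funM => //; exact/measurable_EFinP.
have mc1 : measurable_fun setT (fun x => c1%:E * (\sum_(i < 3) ('D_(basis3 R i) w1 x) ^+ 2)%:E)%E.
  by apply: emeasurable_funM => //; exact: mdw.
have mc2 : measurable_fun setT (fun x => c2%:E * (\sum_(i < 3) ('D_(basis3 R i) w2 x) ^+ 2)%:E)%E.
  by apply: emeasurable_funM => //; exact: mdw.
have pg x : setT x -> (0 <= (\sum_(i < 3) g i x ^+ 2)%:E)%E by move=> _; exact: sum0.
have pK x : setT x -> (0 <= K%:E * (f x)%:E)%E by move=> _; rewrite mule_ge0 ?lee_fin.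
have pc1 x : setT x -> (0 <= c1%:E * (\sum_(i < 3) ('D_(basis3 R i) w1 x) ^+ 2)%:E)%E.
  by move=> _; rewrite mule_ge0// (sum0 (fun i => 'D_(basis3 R i) w1)).
have pc2 x : setT x -> (0 <= c2%:E * (\sum_(i < 3) ('D_(basis3 R i) w2 x) ^+ 2)%:E)%E.
  by move=> _; rewrite mule_ge0// (sum0 (fun i => 'D_(basis3 R i) w2)).
have p2 x : setT x -> (0 <= (\sum_(i < 3) g i x ^+ 2)%:E + K%:E * (f x)%:E)%E.
  by move=> Tx; rewrite adde_ge0 ?pg ?pK.
have p3 x : setT x -> (0 <= (\sum_(i < 3) g i x ^+ 2)%:E + K%:E * (f x)%:E +
    c1%:E * (\sum_(i < 3) ('D_(basis3 R i) w1 x) ^+ 2)%:E)%E.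
  by move=> Tx; rewrite adde_ge0 ?p2 ?pc1.
apply: (@le_trans _ _ (\int[@leb3 R]_x ((\sum_(i < 3) g i x ^+ 2)%:E + K%:E * (f x)%:E +
    c1%:E * (\sum_(i < 3) ('D_(basis3 R i) w1 x) ^+ 2)%:E +
    c2%:E * (\sum_(i < 3) ('D_(basis3 R i) w2 x) ^+ 2)%:E))%E).
  have pG x : setT x -> (0 <= (\sum_(i < 3) G i x ^+ 2)%:E)%E by move=> _; exact: (sum0 G x).
  have mG : measurable_fun setT (fun x => (\sum_(i < 3) G i x ^+ 2)%:E).
    by apply: (mg G) => i; exact: (Hv.2 i).1.1.
  apply: (ge0_le_integral _ measurableT pG mG
    (emeasurable_funD (emeasurable_funD (emeasurable_funD mgg mK) mc1) mc2)) => x _.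
  by rewrite -!EFinM -!EFinD lee_fin; exact: GE.
rewrite (ge0_integralD _ measurableT p3 (emeasurable_funD (emeasurable_funD mgg mK) mc1) pc2 mc2).
rewrite (ge0_integralD _ measurableT p2 (emeasurable_funD mgg mK) pc1 mc1).
rewrite (ge0_integralD _ measurableT pg mgg pK mK).
have -> : (\int[@leb3 R]_x (K%:E * (f x)%:E) = K%:E)%E.
  have pf x : setT x -> (0 <= (f x)%:E)%E by move=> _; rewrite lee_fin.
  have mfE : measurable_fun setT (fun x => (f x)%:E) by exact/measurable_EFinP.
  rewrite (ge0_integralZl _ measurableT mfE pf); last by rewrite lee_fin.
  by rewrite -muE// [X in (_ * X)%E]probability_setT mule1.
have le1 (c : R) w : 0 <= c -> smooth3 w ->
    (\int[@leb3 R]_x (\sum_(i < 3) ('D_(basis3 R i) w x) ^+ 2)%:E <= a%:E)%E ->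
    (\int[@leb3 R]_x (c%:E * (\sum_(i < 3) ('D_(basis3 R i) w x) ^+ 2)%:E) <= (c * a)%:E)%E.
  move=> c0 sw ha; have pw x : setT x -> (0 <= (\sum_(i < 3) ('D_(basis3 R i) w x) ^+ 2)%:E)%E.
    by move=> _; exact: (sum0 (fun i => 'D_(basis3 R i) w)).
  rewrite (ge0_integralZl _ measurableT (mdw w sw) pw); last by rewrite lee_fin.
  by rewrite EFinM lee_wpmul2l.
have -> : (K + (c1 + c2) * a)%:E = (K%:E + (c1 * a)%:E + (c2 * a)%:E)%E.
  by rewrite -!EFinD; congr (_%:E); ring.
have assoc4 (x y z t : \bar R) : (x + (y + z + t) = x + y + z + t)%E by rewrite !addeA.
rewrite assoc4; apply: leeD; last exact: (le1 c2 w2 c20 sw2 a2).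
by apply: leeD; last exact: (le1 c1 w1 c10 sw1 a1).
Qed.

End kinetic_surgery.

Section pigeonhole.
Context d (T : measurableType d) (R : realType) (mu : probability T R).

Lemma small_disjoint_set (E : nat -> set T) (N : nat) : (0 < N)%N ->
  (forall j, measurable (E j)) -> trivIset setT E ->
  exists j, (j < N)%N /\ (mu (E j) <= (N%:R^-1)%:E)%E.
Proof.
move=> N0 mE tE; apply: contrapT => nex.
have big j : (j < N)%N -> (N%:R^-1 < fine (mu (E j)))%R.
  move=> jN; rewrite -lte_fin fineK ?fin_num_measure//.
  by rewrite ltNge; apply/negP => h; apply: nex; exists j.
have : (\sum_(j < N) mu (E j) <= 1)%E.
  rewrite -(measure_bigsetU mu mE tE).
  by apply: probability_le1; exact: bigsetU_measurable.
have -> : (\sum_(j < N) mu (E j) = (\sum_(j < N) fine (mu (E j)))%:E)%E.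
  by rewrite -sumEFin; apply: eq_bigr => j _; rewrite fineK ?fin_num_measure.
rewrite lee_fin leNgt => /negP; apply.
have -> : 1 = \sum_(j < N) (N%:R^-1 : R).
  by rewrite sumr_const card_ord -[RHS]mulr_natr mulVf// pnatr_eq0 -lt0n.
apply: ltr_sum => [|j _]; last exact: big.
by apply/hasP; exists (Ordinal N0); rewrite ?mem_index_enum.
Qed.

End pigeonhole.

(** Infinite values are sorted out once. If [U'] is [+oo], the new energy is [-oo], which absorbs
    everything in a sum. Otherwise [U] is finite, hence so is [C], because the old energy is
    bounded; all quantities are then real. The bound on [C'] is conditional because a nearly optimal
    plan exists only for finite cost. *)
Lemma energy_compare (R : realType) (e2 eb e a1 a2 g l t : R) (T U C T' U' C' : \bar R) :
  0 < e2 -> 0 < eb -> 0 < e -> (0 <= T)%E -> (T < +oo)%E -> (0 <= C)%E -> (0 <= U)%E ->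
  (0 <= T')%E -> (0 <= C')%E -> (0 <= U')%E ->
  (e2%:E * T + eb%:E * C - e%:E * U <= t%:E)%E ->
  (T' <= T + a1%:E)%E -> (C < +oo -> C' <= C + a2%:E)%E -> (U + g%:E <= U' + l%:E)%E ->
  (e2%:E * T' + eb%:E * C' - e%:E * U' <= (t + e2 * a1 + eb * a2 + e * (l - g))%:E)%E.
Proof.
move=> e20 eb0 e0 T0 Too C0 U0 T'0 C'0 U'0 Ht HT HC HU.
case: U' U'0 HU => [U'| |//] U'0 HU; last first.
  by rewrite gt0_muley ?lte_fin//= addeNy leNye.
case: U U0 Ht HU => [U| |//] U0 Ht HU; last by move: HU; rewrite addye// -EFinD leye_eq.
case: T T0 Too Ht HT => [T| |//] T0 {}Too Ht HT; last by [].
case: C C0 Ht HC => [C| |//] C0 Ht HC; last first.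
  by move: Ht; rewrite gt0_muley ?lte_fin// -!EFinM addey// addye// leye_eq.
move: (HC (ltry C)) => {}HC.
case: T' T'0 HT => [T'| |//] T'0; last by rewrite -EFinD leye_eq.
case: C' C'0 HC => [C'| |//] C'0; last by rewrite -EFinD leye_eq.
move: Ht HU; rewrite -!EFinM -!EFinD !lee_fin => h1 h4 h3 h2.
have : e2 * T' <= e2 * (T + a1) by rewrite ler_wpM2l// ltW.
have : eb * C' <= eb * (C + a2) by rewrite ler_wpM2l// ltW.
have : e * (U + g) <= e * (U' + l) by rewrite ler_wpM2l// ltW.
lra.
Qed.

(** * The cutoff away from the nuclei and the change of potential *)

Section far_cutoff.
Context {R : realType} (M : nat) (X : 'I_M -> R3 R) (eta : R -> R) (K : R).
Hypotheses (K0 : 0 < K) (peta : cutoff_profile K eta).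
Hypotheses (eta1 : forall t, t <= 1 -> eta t = 1) (eta2 : forall t, 2 <= t -> eta t = 0).
Implicit Types (x : R3 R) (k l : 'I_M).

(** Nuclei at mutual distance at least [4 * r]. The factor 16 leaves room for the repeated use of
    [dist2_quasi], notably where the redirected electrons are shown to be at distance at least
    [r]. *)
Definition well_separated (r : R) := forall k l, k != l -> 16 * r ^+ 2 <= dist2 (X k) (X l).

Definition far_cutoff (r : R) x := \sum_(k < M) radial eta (r ^- 2) (X k) x.

Variable (r : R).
Hypotheses (r0 : 0 < r) (sep : well_separated r) (M0 : (0 < M)%N).

Let r20 : 0 < r ^+ 2. Proof. exact: exprn_gt0. Qed.

(** At most one nucleus is within [dist2 < 2 * r^2] of a point, so pointwise [far_cutoff] and its
    derivatives reduce to a single radial cutoff and inherit its bounds. *)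
Lemma far_center x : exists k, forall l, l != k -> 2 * r ^+ 2 <= dist2 (X l) x.
Proof.
have [[k kx]|nex] := pselect (exists k, dist2 (X k) x < 2 * r ^+ 2).
  exists k => l lk; have := sep lk; have := dist2_quasi (X l) (X k) x.
  have := dist2_ge0 (X l) x; nra.
exists (Ordinal M0) => l _; rewrite leNgt; apply/negP => lx.
by apply: nex; exists l.
Qed.

Let radial_out k x : 2 * r ^+ 2 <= dist2 (X k) x ->
  radial eta (r ^- 2) (X k) x = 0 /\
  forall i, 'D_(basis3 R i) (radial eta (r ^- 2) (X k)) x = 0.
Proof.
case: peta => se _ _ _ d2 h.
have h2 : 2 <= r ^- 2 * dist2 (X k) x by rewrite mulrC ler_pdivlMr.
by split; [exact: eta2|move=> i; apply: derive_radial_eq0 => //; exact: d2].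
Qed.

Lemma derive_far_cutoff i x : 'D_(basis3 R i) (far_cutoff r) x =
  \sum_(k < M) 'D_(basis3 R i) (radial eta (r ^- 2) (X k)) x.
Proof.
case: peta => se _ _ _ _.
have dk k : is_derive x (basis3 R i) (radial eta (r ^- 2) (X k))
    ('D_(basis3 R i) (radial eta (r ^- 2) (X k)) x).
  by apply: smooth3_is_derive; exact: smooth3_radial.
have -> : far_cutoff r = \sum_(k < M) radial eta (r ^- 2) (X k).
  by apply/funext => y; rewrite fct_sumE.
by have d := is_derive_sum dk; exact: (derive_val (is_derive := d)).
Qed.

Let far_collapse x : exists k, far_cutoff r x = radial eta (r ^- 2) (X k) x /\
  forall i, 'D_(basis3 R i) (far_cutoff r) x = 'D_(basis3 R i) (radial eta (r ^- 2) (X k)) x.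
Proof.
have [k kx] := far_center x; exists k; split.
  by rewrite /far_cutoff (bigD1 k)//= big1 ?addr0// => l /kx /radial_out[].
by move=> i; rewrite derive_far_cutoff (bigD1 k)//= big1 ?addr0// => l /kx /radial_out[].
Qed.

Lemma smooth3_far_cutoff : smooth3 (far_cutoff r).
Proof. by case: peta => se _ _ _ _; apply: smooth3_sum => k; exact: smooth3_radial. Qed.

Lemma far_cutoff01 x : 0 <= far_cutoff r x <= 1.
Proof. by have [k [-> _]] := far_collapse x; case: peta => _ + _ _ _; apply. Qed.

Lemma good_far_cutoff : good_cutoff (8 * r ^- 2 * K) (far_cutoff r).
Proof.
have rV0 : 0 < r ^- 2 by rewrite invr_gt0.
apply: good_cutoffI.
- by rewrite !mulr_ge0 ?(ltW K0) ?(ltW rV0).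
- exact: smooth3_far_cutoff.
- exact: far_cutoff01.
- move=> x; have [k [-> dk]] := far_collapse x.
  case: peta => se e01 de _ d2.
  have := radial_gradient_sqr_le se e01 de K0 d2 (X k) x rV0.
  by under eq_bigr do rewrite -dk.
Qed.

Lemma far_cutoff_eq0 x : (forall k, 2 * r ^+ 2 <= dist2 (X k) x) -> far_cutoff r x = 0.
Proof. by move=> h; rewrite /far_cutoff big1// => k _; have [] := radial_out (h k). Qed.

Lemma far_cutoff_eq1 k x : dist2 (X k) x <= r ^+ 2 -> far_cutoff r x = 1.
Proof.
move=> kx; rewrite /far_cutoff (bigD1 k)//= big1 ?addr0.
  by apply: eta1; rewrite mulrC ler_pdivrMr// mul1r.
move=> l lk; apply: (radial_out _).1.
have := ltW r20; have := sep lk; have := dist2_quasi (X l) (X k) x; lra.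
Qed.

End far_cutoff.

Section potential_surgery.
Context d (T : measurableType d) (R : realType).
Variables (mu mu' nu1 nu2 : probability T R) (p : T -> R) (c1 c2 : R).
Hypotheses (mp : measurable_fun setT p) (p01 : forall x, 0 <= p x <= 1).
Hypotheses (c10 : 0 <= c1) (c20 : 0 <= c2).
Hypothesis mu'E : forall A, measurable A -> mu' A =
  (\int[mu]_(x in A) (p x)%:E + c1%:E * nu1 A + c2%:E * nu2 A)%E.
Variable h : T -> \bar R.
Hypotheses (mh : measurable_fun setT h) (h0 : forall x, (0 <= h x)%E).
Local Open Scope ereal_scope.

(** [mu] splits into the kept part [p mu] and the removed part [(1 - p) mu]. The kept part occurs on
    both sides, the removed one lives where [p] differs from 1, and the bumps contribute at least
    [c1 * g1 + c2 * g2]. Writing gain and loss on opposite sides avoids subtracting infinities. *)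
Lemma potential_surgery_le (k0 k1 m g1 g2 : R) (E S1 S2 : set T) :
  (0 <= k0)%R -> (0 <= k1)%R -> (0 <= g1)%R -> (0 <= g2)%R ->
  measurable E -> measurable S1 -> measurable S2 ->
  nu1 S1 = 1 -> nu2 S2 = 1 -> mu E <= m%:E ->
  (forall x, p x <> 1%R -> h x <= (k0 + k1 * \1_E x)%:E) ->
  (forall x, S1 x -> g1%:E <= h x) -> (forall x, S2 x -> g2%:E <= h x) ->
  \int[mu]_x h x + (c1 * g1 + c2 * g2)%:E <= \int[mu']_x h x + (k0 + k1 * m)%:E.
Proof.
move=> k00 k10 g10 g20 mE mS1 mS2 nuS1 nuS2 muE hk hg1 hg2.
have p0 x : (0 <= p x)%R by case/andP: (p01 x).
have q0 x : (0 <= 1 - p x)%R by rewrite subr_ge0; case/andP: (p01 x).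
have mq : measurable_fun setT (fun x => 1 - p x)%R by exact: measurable_funB.
pose wp : {measure set T -> \bar R} := weighted mu mp p0.
pose wq : {measure set T -> \bar R} := weighted mu mq q0.
have muwE A : measurable A -> mu A = wp A + wq A.
  move=> mA; rewrite /wp /wq !weightedE.
  have hp x : A x -> 0 <= (p x)%:E by move=> _; rewrite lee_fin; exact: (p0 x).
  have hq x : A x -> 0 <= (1 - p x)%:E by move=> _; rewrite lee_fin; exact: (q0 x).
  have mpA : measurable_fun A (fun x => (p x)%:E) by exact/measurable_EFinP/measurable_funTS.
  have mqA : measurable_fun A (fun x => (1 - p x)%:E) by exact/measurable_EFinP/measurable_funTS.
  rewrite -(ge0_integralD mu mA hp mpA hq mqA) -[LHS]mul1e -(integral_cst _ mA).
  by apply: eq_integral => x _; rewrite -EFinD addrC subrK.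
pose n1 : {nonneg R} := NngNum c10; pose n2 : {nonneg R} := NngNum c20.
pose m1 : {measure set T -> \bar R} := mscale n1 nu1.
pose m2 : {measure set T -> \bar R} := mscale n2 nu2.
pose m12 : {measure set T -> \bar R} := measure_add m1 m2.
have mu'wE A : measurable A -> mu' A = wp A + m12 A.
  move=> mA; rewrite mu'E// -addeA; congr (_ + _).
  by rewrite -(measure_addE m1 m2).
rewrite (ge0_integral_measureD muwE mh h0) (ge0_integral_measureD mu'wE mh h0).
have m12E A : measurable A -> m12 A = m1 A + m2 A by move=> _; rewrite -(measure_addE m1 m2).
rewrite (ge0_integral_measureD m12E mh h0).
have gain (c g : R) (nu : probability T R) (S : set T) (c0 : (0 <= c)%R) :
    (0 <= g)%R -> measurable S -> nu S = 1 -> (forall x, S x -> g%:E <= h x) ->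
    (c * g)%:E <= \int[mscale (NngNum c0) nu]_x h x.
  move=> g0 mS nuS hS; rewrite ge0_integral_mscale//= EFinM lee_wpmul2l ?lee_fin//.
  rewrite -[g%:E]mule1 -nuS -integral_cst//.
  apply: (@le_trans _ _ (\int[nu]_(x in S) h x)).
    apply: ge0_le_integral => //.
    exact: measurable_funTS.
  exact: ge0_subset_integral.
have G1 := gain c1 g1 nu1 S1 c10 g10 mS1 nuS1 hg1.
have G2 := gain c2 g2 nu2 S2 c20 g20 mS2 nuS2 hg2.
have L : \int[wq]_x h x <= (k0 + k1 * m)%:E.
  pose S := [set x | p x != 1%R].
  have mS : measurable S.
    rewrite (_ : S = p @^-1` (~` [set 1%R])); last first.
      by apply/seteqP; split => x /eqP.
    rewrite -[X in measurable X]setTI; apply: mp => //.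
    by apply: measurableC.
  have wqS : wq (~` S) = 0.
    rewrite /wq weightedE; apply: integral0_eq => x /= /negP; rewrite negbK => /eqP ->.
    by rewrite subrr.
  have hS x : S x -> h x <= (k0 + k1 * \1_E x)%:E by move=> /eqP; exact: hk.
  have wqle A : measurable A -> wq A <= mu A by move=> mA; rewrite muwE// leeDr.
  have LB := integral_le_cst_indic k00 k10 mS mE wqS mh h0 hS.
  apply: (le_trans LB).
  rewrite EFinD EFinM leeD ?lee_wpmul2l ?lee_fin//.
    rewrite -[leRHS]mule1 lee_wpmul2l ?lee_fin//.
    by apply: le_trans (wqle _ measurableT) _; rewrite probability_setT.
  exact: le_trans (wqle _ mE) muE.
have comb (W Q A B G G' L' : \bar R) : G <= A -> G' <= B -> Q <= L' ->
    W + Q + (G + G') <= W + (A + B) + L'.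
  by move=> GA GB QL; rewrite -!addeA leeD2l// addeC addeA leeD// leeD.
by rewrite EFinD; exact: comb.
Qed.

End potential_surgery.

(** * Surgery on a probability measure *)

Section clear_ball.
Context {R : realType}.
Implicit Types (a x Y : R3 R).

Lemma measurable_dist2_lt Y (c : R) : measurable [set x | dist2 Y x < c].
Proof.
have md : measurable_fun setT (dist2 Y).
  by apply: continuous_measurable3; apply: smooth3_continuous; exact: smooth3_dist2.
rewrite (_ : [set x | _] = dist2 Y @^-1` `]-oo, c[).
  by rewrite -[X in measurable X]setTI; apply: md => //; exact: measurable_itv.
by apply/seteqP; split => x /=; rewrite in_itv.
Qed.

Lemma dist2_shift a (c c' : R) :
  dist2 (a + c *: basis3 R 0) (a + c' *: basis3 R 0) = (c - c') ^+ 2.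
Proof.
rewrite /dist2 (bigD1 (0 : 'I_3))//= big1 ?addr0.
  by rewrite !coord3D !coord3Z !coord3_basis eqxx !mulr1; ring.
by move=> i /negPf i0; rewrite !coord3D !coord3Z !coord3_basis i0 !mulr0 subrr expr0n.
Qed.

Lemma dist2_shift0 a (c : R) : dist2 a (a + c *: basis3 R 0) = c ^+ 2.
Proof. by have := dist2_shift a 0 c; rewrite scale0r addr0 sub0r sqrrN. Qed.

(** Candidate centres are [4 * s] apart on a ray, at distances from [4 * s * N] to [8 * s * N] of
    [a], so that the balls are disjoint and one has mass at most [1 / N]. The factor 12 comes from
    [dist2_quasi]: [2 * 64 + 16 = 12^2]. *)
Lemma clear_ball (mu : probability (R3 R) R) a (s : R) (N : nat) : 0 < s -> (0 < N)%N ->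
  exists Y, [/\ forall x, dist2 Y x < 2 * s ^+ 2 -> (2 * s * N%:R) ^+ 2 <= dist2 a x,
    forall x, dist2 Y x < 2 * s ^+ 2 -> dist2 a x <= (12 * s * N%:R) ^+ 2 &
    (mu [set x | (dist2 Y x < 2 * s ^+ 2)%R] <= (N%:R^-1)%:E)%E].
Proof.
move=> s0 N0; pose Y (j : nat) := a + (4 * s * (N + j)%:R) *: basis3 R 0.
pose E j := [set x | dist2 (Y j) x < 2 * s ^+ 2].
have s20 : 0 < s ^+ 2 by exact: exprn_gt0.
have tE : trivIset setT E.
  apply/trivIsetP => j k _ _ jk; apply/seteqP; split => // x [jx' kx'].
  have jx : dist2 (Y j) x < 2 * s ^+ 2 := jx'.
  have kx : dist2 (Y k) x < 2 * s ^+ 2 := kx'.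
  have := dist2_quasi (Y j) (Y k) x; rewrite dist2_shift.
  have -> : (4 * s * (N + j)%:R - 4 * s * (N + k)%:R) ^+ 2 =
      16 * s ^+ 2 * (j%:R - k%:R) ^+ 2 :> R by rewrite !natrD; ring.
  have jk1 : 1 <= (j%:R - k%:R) ^+ 2 :> R.
    have jkZ : (j%:Z - k%:Z) != 0 by rewrite subr_eq0 eqz_nat.
    have -> : (j%:R - k%:R) ^+ 2 = ((j%:Z - k%:Z) ^+ 2)%:~R :> R.
      by rewrite rmorphXn/= rmorphB/= -!pmulrn.
    by rewrite -[1]/(1%:~R) ler_int -gtz0_ge1 exprn_even_gt0//=.
  have : 16 * s ^+ 2 <= 16 * s ^+ 2 * (j%:R - k%:R) ^+ 2 by rewrite ler_peMr// mulr_ge0 ?(ltW s20).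
  lra.
have [j [jN muj]] := small_disjoint_set mu N0 (fun j => measurable_dist2_lt (Y j) _) tE.
have aY : dist2 a (Y j) = 16 * s ^+ 2 * (N + j)%:R ^+ 2 by rewrite dist2_shift0; ring.
have n1 : 1 <= (N + j)%:R :> R by rewrite ler1n addn_gt0 N0.
have nN : N%:R <= (N + j)%:R :> R by rewrite ler_nat leq_addr.
have n2N : (N + j)%:R <= 2 * N%:R :> R by rewrite -natrM ler_nat mul2n -addnn leq_add2l ltnW.
have N1 : 1 <= N%:R :> R by rewrite ler1n.
set n : R := (N + j)%:R in aY n1 nN n2N; set NN : R := N%:R in nN n2N N1 *.
have nn : NN ^+ 2 <= n ^+ 2 by nra.
have nn2 : n ^+ 2 <= 4 * NN ^+ 2 by nra.
have nn1 : 1 <= n ^+ 2 by nra.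
have e1 : s ^+ 2 * NN ^+ 2 <= s ^+ 2 * n ^+ 2 by rewrite ler_pM2l.
have e2 : s ^+ 2 * n ^+ 2 <= s ^+ 2 * (4 * NN ^+ 2) by rewrite ler_pM2l.
have e3 : s ^+ 2 <= s ^+ 2 * n ^+ 2 by rewrite ler_peMr// ltW.
exists (Y j); split=> // x jx.
- have := dist2_quasi a (Y j) x; rewrite aY.
  have -> : (2 * s * NN) ^+ 2 = 4 * (s ^+ 2 * NN ^+ 2) by ring.
  lra.
- have := dist2_quasi a x (Y j); rewrite aY (dist2C x).
  have -> : (12 * s * NN) ^+ 2 = 144 * (s ^+ 2 * NN ^+ 2) by ring.
  lra.
Qed.

Lemma bump_probability (w : R3 R -> R) : measurable_fun setT w ->
  (\int[@leb3 R]_x (w x ^+ 2)%:E = 1)%E ->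
  exists nu : probability (R3 R) R, forall A, measurable A ->
    nu A = (\int[@leb3 R]_(x in A) (w x ^+ 2)%:E)%E.
Proof.
move=> mw w1.
have mw2 : measurable_fun setT (fun x => w x ^+ 2) by exact: measurable_funX.
have [nu nuE] := @prob_of_measure _ _ _ (weighted (@leb3 R) mw2 (fun x => sqr_ge0 (w x))) w1.
by exists nu => A _; rewrite nuE.
Qed.

(** The new measure is built from a redirected plan, so some plan is needed even when the cost is
    infinite. *)
Lemma coupling_exists (mu : probability (R3 R) R) :
  exists P : probability (R3 R * R3 R)%type R, coupling mu P.
Proof.
have T1 : (mu \x mu)%E setT = 1%E.
  have muT : mu setT = 1%E by exact: probability_setT.
  transitivity (mu setT * mu setT)%E; last by rewrite muT mul1e.
  by rewrite -setXTT; exact: product_measure1E.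
have [P PE] := @prob_of_measure _ _ _ (mu \x mu)%E T1.
exists P => A mA; rewrite !PE.
have -> : fst @^-1` A = A `*` setT :> set (R3 R * R3 R) by apply/seteqP; split => [z|z []].
have -> : snd @^-1` A = setT `*` A :> set (R3 R * R3 R) by apply/seteqP; split => [z|z []].
split.
  transitivity (mu A * mu setT)%E; first exact: product_measure1E.
  by rewrite probability_setT mule1.
transitivity (mu setT * mu A)%E; first exact: product_measure1E.
by rewrite probability_setT mul1e.
Qed.

Lemma ot_cost_ge0 (mu : probability (R3 R) R) : (0 <= ot_cost mu)%E.
Proof.
apply: le_ereal_inf_tmp => _ [P _ <-].
by apply: integral_ge0 => z _; exact: coulomb_ge0.
Qed.

Lemma ot_cost_adherent (mu : probability (R3 R) R) (e : R) : 0 < e ->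
  exists P, coupling mu P /\
    (ot_cost mu < +oo -> \int[P]_z coulomb z.1 z.2 <= ot_cost mu + e%:E)%E.
Proof.
move=> e0; have [oo|noo] := pselect (ot_cost mu < +oo)%E; last first.
  by have [P cP] := coupling_exists mu; exists P; split.
have fin : ot_cost mu \is a fin_num by rewrite ge0_fin_numE// ot_cost_ge0.
have [_ [P cP <-] lt] := lb_ereal_inf_adherent e0 fin.
by exists P; split=> // _; exact: ltW.
Qed.

Lemma kinetic_adherent (mu : probability (R3 R) R) (e : R) : 0 < e ->
  (kinetic mu < +oo)%E -> exists (f : R3 R -> R) (g : 'I_3 -> R3 R -> R),
  [/\ density mu f, H1_gradient (fun x => Num.sqrt (f x)) g &
    (\int[@leb3 R]_x (\sum_(i < 3) g i x ^+ 2)%:E <= kinetic mu + e%:E)%E].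
Proof.
move=> e0 oo.
have fin : kinetic mu \is a fin_num by rewrite ge0_fin_numE// kinetic_ge0.
have [t [f [g [df Hg tE]]] lt] := lb_ereal_inf_adherent e0 fin.
by exists f, g; split=> //; rewrite -tE; exact: ltW.
Qed.

Lemma nuclear_ge0 (M : nat) (X : 'I_M -> R3 R) (Z : 'I_M -> R) (mu : probability (R3 R) R) :
  (forall k, 0 < Z k) -> (0 <= nuclear X Z mu)%E.
Proof.
move=> Z0; apply: sume_ge0 => k _; rewrite mule_ge0 ?lee_fin ?(ltW (Z0 k))//.
by apply: integral_ge0 => x _; exact: coulomb_ge0.
Qed.

End clear_ball.

(** * The combined surgery near two nuclei *)

Section surgery.
Context {R : realType}.
Implicit Types (x : R3 R).

Definition near_nuclei (M : nat) (X : 'I_M -> R3 R) (r : R) : set (R3 R) :=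
  [set x | exists k, dist2 (X k) x < 2 * r ^+ 2].

Lemma measurable_near_nuclei (M : nat) (X : 'I_M -> R3 R) r :
  measurable (near_nuclei X r).
Proof.
rewrite (_ : near_nuclei X r = \bigcup_(k in [set: 'I_M]) [set x | dist2 (X k) x < 2 * r ^+ 2]).
  by apply: fin_bigcup_measurable => // k _; exact: measurable_dist2_lt.
by apply/seteqP; split => [x [k kx]|x [k _ kx]]; exists k.
Qed.

(** Powers of [eps] cancel, and the right side minus the left is [(1 - c) * A / delta^2 + z0 * (c -
    q) / (12 * delta * N)]. *)
Lemma surgery_bound (eps delta r K A c q z0 SZ t tau b N : R) :
  0 < eps -> 0 < delta -> 0 < r -> 0 < N -> 0 < b -> 0 < A -> 0 <= c <= 1 -> q <= c ->
  0 < z0 ->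
  t + eps ^+ 2 * (tau / (eps ^+ 2 + eps * b) +
       (8 * r ^- 2 * K + (8 * (delta * eps) ^- 2 * K + 8 * (delta * eps) ^- 2 * K) +
         c * (A / (delta * eps) ^+ 2))) +
    (eps * b) * (tau / (eps ^+ 2 + eps * b) + 2 * r^-1) +
    eps * (SZ * (r^-1 + (2 * (delta * eps) * N)^-1 * (2 * N^-1)) -
      z0 * (c * (12 * (delta * eps) * N)^-1)) <=
  t + tau + eps ^+ 2 * (8 * K * r ^- 2) + eps * b * (2 * r^-1) + eps * (SZ * r^-1) +
    (16 * K + A) / delta ^+ 2 + SZ / (delta * N ^+ 2) - z0 * q / (12 * delta * N).
Proof.
move=> e0 d0 r0 N0 b0 A0 /andP[c0 c1] qc z00.
have D0 : eps ^+ 2 + eps * b != 0.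
  by rewrite gt_eqF// addr_gt0// ?exprn_gt0// mulr_gt0.
have [en dn rn Nn] : [/\ eps != 0, delta != 0, r != 0 & N != 0] by rewrite !gt_eqF.
rewrite -subr_ge0.
set lhs := (X in _ <= X - _); set rhs := (X in _ <= _ - X).
have -> : lhs - rhs = (1 - c) * A / delta ^+ 2 + z0 * (c - q) / (12 * delta * N).
  by rewrite /lhs /rhs; field; rewrite en dn rn Nn D0.
apply: addr_ge0.
  by rewrite divr_ge0 ?sqr_ge0// mulr_ge0 ?subr_ge0// ltW.
by rewrite divr_ge0 ?mulr_ge0 ?subr_ge0 ?(ltW z00) ?(ltW d0) ?(ltW N0).
Qed.

End surgery.

Section surgery_thm.
Context {R : realType}.
Implicit Types (x : R3 R).

(** Each term has its source: [tau] from nearly optimal choices, the terms in [r] from the far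
    cutoff, the redirected repulsion and the attraction lost away from the nuclei, [C / delta^2]
    from holes and bumps, the next one from the cleared mass, the last from the attraction gained.
    The condition on [r] keeps the cleared balls within [r] of their nuclei. [q] may be negative. *)
Theorem surgery : exists C Kf : R, [/\ 0 < C, 0 < Kf &
  forall (M : nat) (X : 'I_M -> R3 R) (Z : 'I_M -> R) (b : R) (i1 i2 : 'I_M)
    (r eps delta t tau z0 q : R) (N : nat) (mu : probability (R3 R) R),
  i1 != i2 -> 0 < b -> (forall k, 0 < Z k) -> 0 < z0 -> z0 <= Z i1 -> z0 <= Z i2 ->
  0 < r -> 0 < eps -> 0 < delta -> 0 < tau -> (0 < N)%N -> well_separated X r ->
  12 * (delta * eps) * N%:R <= r -> (Geps b X Z eps mu <= t%:E)%E ->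
  (mu (near_nuclei X r) <= (1 - q)%:E)%E ->
  exists mu' : probability (R3 R) R, mu' (near_nuclei X r) = 1%E /\
    (Geps b X Z eps mu' <= (t + tau + eps ^+ 2 * (Kf * r ^- 2) + eps * b * (2 * r^-1) +
      eps * ((\sum_(k < M) Z k) * r^-1) + C / delta ^+ 2 +
      (\sum_(k < M) Z k) / (delta * N%:R ^+ 2) - z0 * q / (12 * delta * N%:R))%:E)%E].
Proof.
have [eta [zeta [K [K0 [peta pzeta] ez1 ez2]]]] := @cutoff_profiles R.
have eta1 t : t <= 1 -> eta t = 1 by case/ez1.
have eta2 t : 2 <= t -> eta t = 0 by case/ez2.
have zeta1 t : t <= 1 -> zeta t = 0 by case/ez1.
have zeta2 t : 2 <= t -> zeta t = 1 by case/ez2.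
have [A [A0 bumpA]] := @smooth_bump R.
exists (16 * K + A), (8 * K); split; [by rewrite addr_gt0// mulr_gt0|by rewrite mulr_gt0|].
move=> M X Z b i1 i2 r eps delta t tau z0 q N mu i12 b0 Z0 z00 zi1 zi2 r0 eps0 delta0 tau0
  N0 sep sNr Gmu muq.
have M0 : (0 < M)%N by case: (i1) => ? /(leq_ltn_trans (leq0n _)).
pose s := delta * eps.
have s0 : 0 < s by rewrite mulr_gt0.
have s20 : 0 < s ^+ 2 by rewrite exprn_gt0.
have r20 : 0 < r ^+ 2 by rewrite exprn_gt0.
have rV0 : 0 < r^-1 by rewrite invr_gt0.
have NR0 : 0 < N%:R :> R by rewrite ltr0n.
have twoN0 : 0 < 2 * s * N%:R by rewrite !mulr_gt0.
have twelve0 : 0 < 12 * s * N%:R by rewrite !mulr_gt0.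
have twelve_le : (12 * s * N%:R) ^+ 2 <= r ^+ 2.
  by apply: lerXn2r sNr; rewrite nnegrE ltW.
have [Y1 [Y1lo Y1hi muY1]] := clear_ball mu (X i1) s0 N0.
have [Y2 [Y2lo Y2hi muY2]] := clear_ball mu (X i2) s0 N0.
have [w1 [tw1 w10 w1S w1I w1D]] := bumpA Y1 s s0.
have [w2 [tw2 w20 w2S w2I w2D]] := bumpA Y2 s s0.
have mw (w : R3 R -> R) : test_function w -> measurable_fun setT w.
  by case=> sw _; apply: continuous_measurable3; exact: smooth3_continuous.
have [nu1 nu1E] := bump_probability (mw _ tw1) w1I.
have [nu2 nu2E] := bump_probability (mw _ tw2) w2I.
pose S1 := [set x | dist2 Y1 x < s ^+ 2]; pose S2 := [set x | dist2 Y2 x < s ^+ 2].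
have mS1 : measurable S1 by exact: measurable_dist2_lt.
have mS2 : measurable S2 by exact: measurable_dist2_lt.
have nuSC (Y : R3 R) (w : R3 R -> R) (nu : probability (R3 R) R) :
    (forall x, s ^+ 2 <= dist2 Y x -> w x = 0 /\ forall i, 'D_(basis3 R i) w x = 0) ->
    (forall B, measurable B -> nu B = (\int[@leb3 R]_(x in B) (w x ^+ 2)%:E)%E) ->
    nu (~` [set x | dist2 Y x < s ^+ 2]) = 0%E.
  move=> wS nuE; rewrite nuE; last by apply: measurableC; exact: measurable_dist2_lt.
  apply: integral0_eq => x /= /negP; rewrite -leNgt => /wS[-> _].
  by rewrite expr0n.
have nu1SC : nu1 (~` S1) = 0%E by exact: nuSC w1S nu1E.
have nu2SC : nu2 (~` S2) = 0%E by exact: nuSC w2S nu2E.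
have full (nu : probability (R3 R) R) S : measurable S -> nu (~` S) = 0%E -> nu S = 1%E.
  move=> mS nS; have := probability_setC nu (measurableC mS).
  by rewrite setCK nS sube0.
have nu1S := full _ _ mS1 nu1SC; have nu2S := full _ _ mS2 nu2SC.
have S1E x : S1 x -> dist2 Y1 x < 2 * s ^+ 2.
  by move=> h; apply: lt_le_trans h _; rewrite ler_peMl ?(ltW s20)// ler1n.
have S2E x : S2 x -> dist2 Y2 x < 2 * s ^+ 2.
  by move=> h; apply: lt_le_trans h _; rewrite ler_peMl ?(ltW s20)// ler1n.
have Xr1 x : dist2 Y1 x < 2 * s ^+ 2 -> dist2 (X i1) x <= r ^+ 2.
  by move=> /Y1hi /le_trans; apply.
have Xr2 x : dist2 Y2 x < 2 * s ^+ 2 -> dist2 (X i2) x <= r ^+ 2.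
  by move=> /Y2hi /le_trans; apply.
have sep12 := sep _ _ i12.
pose xf := far_cutoff X eta r.
pose z1 := radial zeta (s ^- 2) Y1; pose z2 := radial zeta (s ^- 2) Y2.
(* The holes [z1] and [z2] vanish for [dist2 <= s^2], where the bumps live, and equal 1 for
   [dist2 >= 2 * s^2], outside the sets whose mass [clear_ball] bounds. *)
pose xi := xf \* (z1 \* z2).
have sV0 : 0 < s ^- 2 by rewrite invr_gt0.
have [sz z01 dz dz1 dz2] := pzeta.
have gz Y : good_cutoff (8 * s ^- 2 * K) (radial zeta (s ^- 2) Y).
  apply: good_cutoffI.
  - by rewrite !mulr_ge0 ?(ltW K0) ?(ltW sV0).
  - exact: smooth3_radial.
  - by move=> x; exact: z01.
  - by move=> x; exact: radial_gradient_sqr_le.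
have gf : good_cutoff (8 * r ^- 2 * K) xf by exact: good_far_cutoff.
have Kz0 : 0 <= 8 * s ^- 2 * K by rewrite !mulr_ge0 ?(ltW K0) ?(ltW sV0).
have Kf0 : 0 <= 8 * r ^- 2 * K by rewrite !mulr_ge0 ?(ltW K0) ?invr_ge0 ?(ltW r20).
pose KK := 8 * r ^- 2 * K + (8 * s ^- 2 * K + 8 * s ^- 2 * K).
have gxi : good_cutoff KK xi by exact: (good_cutoffM Kf0 gf (good_cutoffM Kz0 (gz Y1) (gz Y2))).
have KK0 : 0 <= KK by rewrite !addr_ge0.
have [sxi xi01 _ _] := gxi.
have sz12 : smooth3 (z1 \* z2) by move=> n; apply: CkM; exact: smooth3_radial.
have sxf : smooth3 xf by case: gf.
have z1_0 x : S1 x -> z1 x = 0 /\ forall i, 'D_(basis3 R i) z1 x = 0.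
  move=> h; have h1 : s ^- 2 * dist2 Y1 x <= 1.
    by rewrite mulrC ler_pdivrMr// mul1r ltW.
  by split; [exact: zeta1|move=> i; apply: derive_radial_eq0 => //; exact: dz1].
have z2_0 x : S2 x -> z2 x = 0 /\ forall i, 'D_(basis3 R i) z2 x = 0.
  move=> h; have h1 : s ^- 2 * dist2 Y2 x <= 1.
    by rewrite mulrC ler_pdivrMr// mul1r ltW.
  by split; [exact: zeta1|move=> i; apply: derive_radial_eq0 => //; exact: dz1].
have xi_0 x : S1 x \/ S2 x -> xi x = 0 /\ forall i, 'D_(basis3 R i) xi x = 0.
  have sz1 : smooth3 z1 by exact: smooth3_radial.
  have sz2 : smooth3 z2 by exact: smooth3_radial.
  case=> [/z1_0[e1 e2]|/z2_0[e1 e2]]; split.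
  - by rewrite /xi /= e1 mul0r mulr0.
  - by move=> i; rewrite /xi derive_mul//= derive_mul// e1 e2; rewrite !(mul0r, mulr0, addr0).
  - by rewrite /xi /= e1 !mulr0.
  - by move=> i; rewrite /xi derive_mul//= derive_mul// e1 e2; rewrite !(mul0r, mulr0, addr0).
have S12 x : ~ (S1 x /\ S2 x).
  move=> [/S1E/Xr1 h1 /S2E/Xr2 h2]; have := dist2_quasi (X i1) (X i2) x; lra.
pose p x := xi x ^+ 2.
have mxi : measurable_fun setT xi.
  by apply: continuous_measurable3; exact: smooth3_continuous.
have mp : measurable_fun setT p by exact: measurable_funX.
have p01 x : 0 <= p x <= 1.
  by have /andP[x0 x1] := xi01 x; rewrite sqr_ge0/= expr_le1.
(* An electron goes to [X i1] if the other one is outside [B], to [X i2] otherwise. Either way the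
   other one has squared distance at least [4 * r^2] from that nucleus: for [X i2] because
   [16 * r^2 / 2 - 4 * r^2 = 4 * r^2]. The bump being within [r], [dist2_quasi] leaves at least
   [2 * r^2 - r^2]. *)
pose B := [set x | dist2 (X i1) x < 4 * r ^+ 2].
have mB : measurable B by exact: measurable_dist2_lt.
have hS1 y x : S1 y -> ~ B x -> (coulomb y x <= (r^-1)%:E)%E.
  move=> /S1E/Xr1 h1 /negP; rewrite -leNgt => h2; apply: coulomb_le => //.
  by have := dist2_quasi (X i1) x y; lra.
have hS2 y x : S2 y -> B x -> (coulomb y x <= (r^-1)%:E)%E.
  move=> /S2E/Xr2 h1 Bx; have h2 : dist2 (X i1) x < 4 * r ^+ 2 := Bx.
  apply: coulomb_le => //.
  by have := dist2_quasi (X i2) x y; have := dist2_quasi (X i1) (X i2) x; lra.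
(* The slack [tau'] enters the kinetic energy with factor [eps^2] and the transport cost with
   [eps * b], adding up to [tau]. *)
have E0 : 0 < eps ^+ 2 + eps * b by rewrite addr_gt0 ?exprn_gt0// mulr_gt0.
pose tau' := tau / (eps ^+ 2 + eps * b).
have tau'0 : 0 < tau' by rewrite divr_gt0.
have [P [cP Pcost]] := ot_cost_adherent mu tau'0.
have [Q [c1 [c2 [[c10 c20] Qmarg Qcost]]]] :=
  redirect_coupling mS1 mS2 mB nu1SC nu2SC mp p01 measurable_coulomb
    (fun z => coulomb_ge0 z.1 z.2) (ltW rV0) hS1 hS2 (fun x y => coulombC x y) cP.
(* The new measure is read off the new plan as its first marginal; by [Qmarg] the second one agrees
   with it. *)
have [mu' mu'E0] : exists mu' : probability (R3 R) R, forall D, mu' D = Q (fst @^-1` D).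
  have [|mu' h] := @prob_of_measure _ _ _ (pushm Q (@measurable_fst _ _ (R3 R) (R3 R))).
    by rewrite pushmE preimage_setT; exact: (@probability_setT _ _ _ Q).
  by exists mu' => D; rewrite h pushmE.
have mu'E D : measurable D ->
    mu' D = (\int[mu]_(x in D) (xi x ^+ 2)%:E + c1%:E * nu1 D + c2%:E * nu2 D)%E.
  by move=> mD; rewrite mu'E0 (Qmarg _ mD).1.
have cQ : coupling mu' Q.
  by move=> D mD; rewrite mu'E0 (Qmarg _ mD).1 (Qmarg _ mD).2.
have xi_far x : ~ near_nuclei X r x -> xi x = 0.
  move=> nn; rewrite /xi /= /xf (far_cutoff_eq0 peta eta2 r0) ?mul0r// => k.
  by rewrite leNgt; apply/negP => h; apply: nn; exists k.
have mNr := measurable_near_nuclei X r.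
have mNrC : measurable (~` near_nuclei X r) by exact: measurableC.
have S1N : S1 `<=` near_nuclei X r.
  by move=> x /S1E/Xr1 h; exists i1; apply: le_lt_trans h _; rewrite ltr_pMl// ltr1n.
have S2N : S2 `<=` near_nuclei X r.
  by move=> x /S2E/Xr2 h; exists i2; apply: le_lt_trans h _; rewrite ltr_pMl// ltr1n.
have nuN (nu : probability (R3 R) R) S : measurable S -> S `<=` near_nuclei X r ->
    nu (~` S) = 0%E -> nu (~` near_nuclei X r) = 0%E.
  move=> mS SN nS; apply: (subset_measure0 mNrC (measurableC mS) _ nS).
  exact: subsetC.
exists mu'; split.
  apply: full => //; rewrite mu'E// (nuN nu1 S1)// (nuN nu2 S2)// !mule0 !adde0.
  by apply: integral0_eq => x /xi_far ->; rewrite expr0n.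
have mp2 D : measurable D -> measurable_fun D (fun x => (xi x ^+ 2)%:E).
  by move=> mD; apply/measurable_EFinP; apply: measurable_funTS.
have intp : (\int[mu]_x (xi x ^+ 2)%:E <= (1 - q)%:E)%E.
  apply: le_trans muq.
  have -> : mu (near_nuclei X r) = (\int[mu]_x (\1_(near_nuclei X r) x)%:E)%E.
    by rewrite integral_indic// setIT.
  have xi2 x : setT x -> (0 <= (xi x ^+ 2)%:E)%E by move=> _; rewrite lee_fin sqr_ge0.
  have mI : measurable_fun setT (fun x => (\1_(near_nuclei X r) x)%:E : \bar R).
    by apply/measurable_EFinP; exact: measurable_indic.
  apply: (ge0_le_integral _ measurableT xi2 (mp2 _ measurableT) mI) => x _.
  - rewrite lee_fin indicE; have [nx|nx] := pselect (near_nuclei X r x).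
      by rewrite mem_set//; case/andP: (p01 x).
    by rewrite memNset// xi_far// expr0n.
have int0 : (0 <= \int[mu]_x (xi x ^+ 2)%:E)%E.
  by apply: integral_ge0 => x _; rewrite lee_fin sqr_ge0.
(* Total mass 1 turns the upper bound on the kept mass into [q <= c1 + c2] for the moved mass. *)
have massE : (\int[mu]_x (xi x ^+ 2)%:E + (c1 + c2)%:E = 1)%E.
  have := mu'E setT measurableT.
  by rewrite !probability_setT !mule1 EFinD addeA => <-.
have [m0 m0E] : exists m0 : R, (\int[mu]_x (xi x ^+ 2)%:E = m0%:E)%E.
  exists (fine (\int[mu]_x (xi x ^+ 2)%:E)%E); rewrite fineK// ge0_fin_numE//.
  by apply: le_lt_trans intp _; exact: ltry.
move: intp int0 massE; rewrite m0E -EFinD !lee_fin => m0q m00 [m0c].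
have qc : q <= c1 + c2 by move: m0q m0c; clear; lra.
have c01 : 0 <= c1 + c2 <= 1 by rewrite addr_ge0//=; move: m00 m0c; clear; lra.
have kin_oo : (kinetic mu < +oo)%E.
  rewrite lt_neqAle leey andbT; apply/negP => /eqP koo.
  by move: Gmu; rewrite /Geps koo eqxx leye_eq.
have [f [g [df Hg gle]]] := kinetic_adherent tau'0 kin_oo.
have leEFinD (x y : \bar R) (a c : R) : (x <= y + a%:E -> x + c%:E <= y + (a + c)%:E)%E.
  by move=> h; rewrite EFinD addeA leeD2r.
have kin' : (kinetic mu' <= kinetic mu + (tau' + KK + (c1 + c2) * (A / s ^+ 2))%:E)%E.
  have D1w x : ~ S1 x -> w1 x = 0 /\ forall i, 'D_(basis3 R i) w1 x = 0.
    by move=> /negP; rewrite -leNgt => /w1S.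
  have D2w x : ~ S2 x -> w2 x = 0 /\ forall i, 'D_(basis3 R i) w2 x = 0.
    by move=> /negP; rewrite -leNgt => /w2S.
  have := kinetic_surgery_le df Hg KK0 gxi c10 c20 tw1 tw2 w10 w20 D1w D2w xi_0 S12
    nu1E nu2E w1D w2D mu'E.
  move=> /le_trans; apply.
  have -> : tau' + KK + (c1 + c2) * (A / s ^+ 2) = tau' + (KK + (c1 + c2) * (A / s ^+ 2)).
    by rewrite -(addrA tau' KK).
  exact: leEFinD.
have kin'_oo : (kinetic mu' < +oo)%E.
  apply: le_lt_trans kin' _; rewrite lte_add_pinfty// ltry//.
have ot' : (ot_cost mu < +oo -> ot_cost mu' <= ot_cost mu + (tau' + 2 * r^-1)%:E)%E.
  move=> /Pcost Ple; apply: (@le_trans _ _ (\int[Q]_z coulomb z.1 z.2)%E).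
    by apply: ereal_inf_lbound; exists Q.
  by apply: le_trans Qcost _; exact: leEFinD.
(* Close to the nuclei, [p] differs from 1 only inside these two sets, of total mass at most
   [2 / N]. *)
pose E := [set x | dist2 Y1 x < 2 * s ^+ 2] `|` [set x | dist2 Y2 x < 2 * s ^+ 2].
have mE : measurable E by apply: measurableU; exact: measurable_dist2_lt.
have muE : (mu E <= (2 * N%:R^-1)%:E)%E.
  apply: le_trans (measureU2 mu _ _) _; [exact: measurable_dist2_lt..|].
  have -> : (2 * N%:R^-1)%:E = (N%:R^-1%:E + N%:R^-1%:E)%E :> \bar R.
    by rewrite -EFinD; congr (_%:E); ring.
  exact: leeD.
pose k1 := (2 * s * N%:R)^-1.
have k10 : 0 < k1 by rewrite invr_gt0.
(* Only the attraction of each bump by its own nucleus is counted; for the other nuclei the lower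
   bound 0 is enough. *)
pose G1 k := if k == i1 then (12 * s * N%:R)^-1 else 0.
pose G2 k := if k == i2 then (12 * s * N%:R)^-1 else 0.
have G10 k : 0 <= G1 k by rewrite /G1; case: ifP => // _; rewrite invr_ge0 ltW.
have G20 k : 0 <= G2 k by rewrite /G2; case: ifP => // _; rewrite invr_ge0 ltW.
have pot k : (\int[mu]_x coulomb x (X k) + (c1 * G1 k + c2 * G2 k)%:E <=
    \int[mu']_x coulomb x (X k) + (r^-1 + k1 * (2 * N%:R^-1))%:E)%E.
  apply: (potential_surgery_le mp p01 c10 c20 mu'E (measurable_coulombr (X k))
    (fun x => coulomb_ge0 x (X k)) (ltW rV0) (ltW k10) (G10 k) (G20 k) mE mS1 mS2
    nu1S nu2S muE) => x.
  - move=> px.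
    have near_other l : dist2 (X l) x <= r ^+ 2 -> k != l -> (coulomb x (X k) <= (r^-1)%:E)%E.
      move=> lx kl; apply: coulomb_le => //.
      by move: (ltW r20) lx (sep _ _ kl) (dist2_quasi (X k) (X l) x); clear; lra.
    have rk : ((r^-1)%:E <= (r^-1 + k1 * 1)%:E)%E.
      by rewrite lee_fin mulr1 lerDl ltW.
    have k1k : (k1%:E <= (r^-1 + k1 * 1)%:E)%E.
      by rewrite lee_fin mulr1 lerDr ltW.
    have [Ex|nEx] := pselect (E x).
      rewrite indicE mem_set//.
      case: Ex => [h1|h2].
        have [->|ki] := eqVneq k i1.
          by apply: le_trans k1k; apply: coulomb_le => //; exact: Y1lo.
        by apply: le_trans rk; apply: near_other ki; exact: Xr1.
      have [->|ki] := eqVneq k i2.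
        by apply: le_trans k1k; apply: coulomb_le => //; exact: Y2lo.
      by apply: le_trans rk; apply: near_other ki; exact: Xr2.
    (* Outside [E] both holes are inactive, so a point closer than [r] to a nucleus would have
       [p x = 1]. *)
    rewrite indicE memNset// mulr0 addr0; apply: coulomb_le => //.
    rewrite leNgt; apply/negP => kx; apply: px.
    have one (Y : R3 R) : ~ dist2 Y x < 2 * s ^+ 2 -> radial zeta (s ^- 2) Y x = 1.
      move=> /negP; rewrite -leNgt => h.
      by apply: zeta2; rewrite mulrC ler_pdivlMr.
    rewrite /p /xi /= /xf (far_cutoff_eq1 peta eta1 eta2 r0 sep (ltW kx)).
    rewrite /z1 /z2 !one ?mulr1 ?expr1n// => h; apply: nEx; [by right|by left].
  - move=> h; rewrite /G1; case: eqP => [->|_]; last exact: coulomb_ge0.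
    by apply: coulomb_ge => //; apply: Y1hi; exact: S1E.
  - move=> h; rewrite /G2; case: eqP => [->|_]; last exact: coulomb_ge0.
    by apply: coulomb_ge => //; apply: Y2hi; exact: S2E.
pose SZ := \sum_(k < M) Z k.
pose g0 := z0 * ((c1 + c2) * (12 * s * N%:R)^-1).
have sumG : g0 <= \sum_(k < M) Z k * (c1 * G1 k + c2 * G2 k).
  rewrite (bigD1 i1)//= (bigD1 i2)/=; last by rewrite eq_sym.
  rewrite /G1 /G2 !eqxx (negPf i12) eq_sym (negPf i12) !mulr0 addr0 add0r.
  have v0 : 0 <= (12 * s * N%:R)^-1 by rewrite invr_ge0 ltW.
  have : 0 <= \sum_(k < M | (k != i1) && (k != i2)) Z k *
     (c1 * (if k == i1 then (12 * s * N%:R)^-1 else 0) +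
      c2 * (if k == i2 then (12 * s * N%:R)^-1 else 0)).
    apply: sumr_ge0 => k _; rewrite mulr_ge0 ?(ltW (Z0 k))// addr_ge0// mulr_ge0//.
      exact: (G10 k).
    exact: (G20 k).
  have : z0 * (c1 * (12 * s * N%:R)^-1) <= Z i1 * (c1 * (12 * s * N%:R)^-1).
    by rewrite ler_wpM2r// mulr_ge0.
  have : z0 * (c2 * (12 * s * N%:R)^-1) <= Z i2 * (c2 * (12 * s * N%:R)^-1).
    by rewrite ler_wpM2r// mulr_ge0.
  rewrite /g0 (mulrDl c1) (mulrDr z0); clear; lra.
have nuc : (nuclear X Z mu + g0%:E <= nuclear X Z mu' +
    (SZ * (r^-1 + k1 * (2 * N%:R^-1)))%:E)%E.
  apply: (@le_trans _ _ (nuclear X Z mu + (\sum_(k < M) Z k * (c1 * G1 k + c2 * G2 k))%:E)%E).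
    by rewrite leeD2l// lee_fin.
  rewrite /nuclear mulr_suml -!sumEFin -!big_split/=; apply: lee_sum => k _.
  have UU : (0 <= \int[mu]_x coulomb x (X k))%E by apply: integral_ge0 => x _; exact: coulomb_ge0.
  have UU' : (0 <= \int[mu']_x coulomb x (X k))%E by apply: integral_ge0 => x _; exact: coulomb_ge0.
  rewrite !EFinM -!ge0_muleDr//.
  - by rewrite lee_wpmul2l ?lee_fin ?(ltW (Z0 k)).
  - by rewrite lee_fin addr_ge0 ?(ltW rV0)// mulr_ge0 ?(ltW k10)// mulr_ge0// invr_ge0 ltW.
  - by rewrite lee_fin addr_ge0// mulr_ge0.
have eb0 : 0 < eps * b by rewrite mulr_gt0.
have e20 : 0 < eps ^+ 2 by rewrite exprn_gt0.
move: Gmu; rewrite /Geps (lt_eqF kin_oo) (lt_eqF kin'_oo) => Gmu.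
have := energy_compare e20 eb0 eps0 (kinetic_ge0 mu) kin_oo (ot_cost_ge0 mu)
  (nuclear_ge0 X mu Z0) (kinetic_ge0 mu') (ot_cost_ge0 mu') (nuclear_ge0 X mu' Z0)
  Gmu kin' ot' nuc.
move=> /le_trans; apply; rewrite lee_fin.
have := @surgery_bound R eps delta r K A (c1 + c2) q z0 SZ t tau b N%:R
  eps0 delta0 r0 NR0 b0 A0 c01 qc z00.
by rewrite /KK /g0 /k1 /tau' !addrA.
Qed.

End surgery_thm.

(** * Concentration near the nuclei *)

Section recovery.
Context {R : realType}.
Implicit Types (x : R3 R).

(** The bound on the integral of [phi] holds for all small [eps], the energy bound for arbitrarily
    small ones; they therefore meet at some [eps < eta]. *)
Lemma recovery (b : R) (M : nat) (X : 'I_M -> R3 R) (Z : 'I_M -> R)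
    (rho : subprobability (R3 R) R) (t c eta : R) (phi : R3 R -> R) :
  (Gminus b X Z rho < t%:E)%E -> C0 phi -> (\int[rho]_x (phi x)%:E < c%:E)%E -> 0 < eta ->
  exists (eps : R) (mu : probability (R3 R) R), [/\ 0 < eps, eps < eta,
    (Geps b X Z eps mu <= t%:E)%E & (\int[mu]_x (phi x)%:E < c%:E)%E].
Proof.
move=> /ereal_inf_lt[_ [mu_ wmu <-]] ht Cphi hc eta0.
pose V := [set eps : R | [/\ 0 < eps, eps < eta & (\int[mu_ eps]_x (phi x)%:E < c%:E)%E]].
have FV : ((0 : R)^'+ : set_system R) V.
  have h3 : \forall eps \near (0 : R)^'+, (\int[mu_ eps]_x (phi x)%:E < c%:E)%E.
    have /= wphi := wmu phi Cphi.
    exact: (wphi _ (open_ereal_lt' hc)).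
  near=> eps; split; first by near: eps; exact: nbhs_right_gt.
    by near: eps; exact: nbhs_right_lt.
  by near: eps.
have : (ereal_inf [set Geps b X Z eps (mu_ eps) | eps in V] < t%:E)%E.
  apply: le_lt_trans ht; rewrite limf_einfE.
  by apply: ereal_sup_ubound; exists V.
move=> /ereal_inf_lt[_ [eps [e0 e1 e2] <-]] /ltW h.
by exists eps, (mu_ eps).
Unshelve. all: by end_near. Qed.

Lemma dist2_enorm_large (Y : R3 R) (c : R) : exists K : R, forall x, K < enorm x -> c <= dist2 Y x.
Proof.
exists (Num.sqrt (2 * (`|c| + dist2 0 Y))) => x Kx.
have s0 : 0 <= 2 * (`|c| + dist2 0 Y) by rewrite mulr_ge0// addr_ge0// dist2_ge0.
have : 2 * (`|c| + dist2 0 Y) <= dist2 0 x.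
  rewrite -(enorm_dist2 x 0) subr0 -(sqr_sqrtr s0) ler_pXn2r ?nnegrE ?sqrtr_ge0//.
  exact: ltW.
have := dist2_quasi 0 x Y; have := ler_norm c; rewrite (dist2C x Y); lra.
Qed.

(** Weak-star convergence says nothing directly about masses of sets; this function, the far cutoff
    at scale [2 * r], stands in for the indicator of a neighbourhood of the nuclei. *)
Lemma bump_at_nuclei (M : nat) (X : 'I_M -> R3 R) (r : R) : (0 < M)%N -> 0 < r ->
  well_separated X (2 * r) -> exists phi : R3 R -> R, [/\ C0 phi,
    forall x, 0 <= phi x <= 1, forall x, near_nuclei X r x -> phi x = 1 &
    forall x, ~ near_nuclei X (2 * r) x -> phi x = 0].
Proof.
move=> M0 r0 sep.
have [eta [zeta [K [K0 [peta _] ez1 ez2]]]] := @cutoff_profiles R.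
have eta1 t : t <= 1 -> eta t = 1 by case/ez1.
have eta2 t : 2 <= t -> eta t = 0 by case/ez2.
have r20 : 0 < 2 * r by rewrite mulr_gt0.
have out x : ~ near_nuclei X (2 * r) x -> far_cutoff X eta (2 * r) x = 0.
  move=> nx; apply: (far_cutoff_eq0 peta eta2 r20) => k; rewrite leNgt.
  by apply/negP => kx; apply: nx; exists k.
exists (far_cutoff X eta (2 * r)); split => //.
- split; first by apply: smooth3_continuous; exact: (smooth3_far_cutoff X peta).
  move=> e e0.
  (* One radius per nucleus; beyond the largest of them the cutoff vanishes. *)
  pose KK k := xget 0 [set K | forall x, K < enorm x -> 2 * (2 * r) ^+ 2 <= dist2 (X k) x].
  have KP k x : KK k < enorm x -> 2 * (2 * r) ^+ 2 <= dist2 (X k) x.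
    have [L hL] := dist2_enorm_large (X k) (2 * (2 * r) ^+ 2).
    rewrite /KK; case: xgetP => [_ -> //|/(_ L) /(_ hL)//]; exact.
  exists (\big[Num.max/0]_k KK k) => x hx.
  rewrite out ?normr0// => -[k]; rewrite ltNge => /negP; apply.
  by apply: KP; apply: le_lt_trans hx; exact: le_bigmax.
- by move=> x; exact: (far_cutoff01 peta eta2 r20 sep M0).
- move=> x [k kx]; apply: (far_cutoff_eq1 peta eta1 eta2 r20 sep (k := k)).
  by have := sqr_ge0 r; rewrite exprMn; lra.
Qed.

Lemma near_nuclei_le (M : nat) (X : 'I_M -> R3 R) (r r' : R) :
  0 <= r -> r <= r' -> near_nuclei X r `<=` near_nuclei X r'.
Proof.
move=> r0 rr x [k kx]; exists k; apply: lt_le_trans kx _.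
by rewrite ler_wpM2l// lerXn2r// nnegrE// (le_trans r0).
Qed.

Lemma well_separated_small (M : nat) (X : 'I_M -> R3 R) : injective X ->
  exists2 r0 : R, 0 < r0 & forall r, 0 < r -> r <= r0 -> well_separated X r.
Proof.
move=> injX.
pose m := \big[Num.min/1]_(p : 'I_M * 'I_M | p.1 != p.2) dist2 (X p.1) (X p.2).
have m0 : 0 < m.
  apply/bigmin_gtP; split => // -[k l]/= kl.
  rewrite lt_def dist2_ge0 andbT; apply/eqP => /dist2_eq0/injX; exact/eqP.
exists (Num.sqrt (m / 16)) => [|r r0 rr k l kl]; first by rewrite sqrtr_gt0 divr_gt0.
have h : r ^+ 2 <= m / 16.
  have m16 : 0 <= m / 16 by rewrite divr_ge0// ltW.
  by rewrite -(sqr_sqrtr m16) lerXn2r// nnegrE ?sqrtr_ge0// ltW.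
have mkl : m <= dist2 (X k) (X l) by exact: (bigmin_le_cond _ (j := (k, l))).
lra.
Qed.

(** Continuity from above: the neighbourhoods decrease to the set of nuclei. *)
Lemma near_nuclei_mass (M : nat) (X : 'I_M -> R3 R) (rho : subprobability (R3 R) R) (e : R) :
  0 < e -> exists2 r0 : R, 0 < r0 & forall r, 0 < r -> r <= r0 ->
    (rho (near_nuclei X r) < rho (range X) + e%:E)%E.
Proof.
move=> e0.
pose r_ n : R := n.+1%:R^-1.
have r_0 n : 0 < r_ n by rewrite invr_gt0 ltr0n.
have capE : \bigcap_n near_nuclei X (r_ n) = range X.
  apply/seteqP; split => [x nx|_ [k _ <-] n _]; last first.
    by exists k; rewrite dist2xx mulr_gt0// exprn_gt0.
  have [m0 [kx]] : exists m : R, 0 < m /\ ((exists k, dist2 (X k) x = 0) \/ forall k, m <= dist2 (X k) x).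
    have [[k kx]|nex] := pselect (exists k, dist2 (X k) x = 0); first by exists 1; split => //; left; exists k.
    exists (\big[Num.min/1]_k dist2 (X k) x); split; last by right=> k; exact: bigmin_le.
    apply/bigmin_gtP; split => // k _; rewrite lt_def dist2_ge0 andbT.
    by apply/eqP => kx; apply: nex; exists k.
  case=> [[k /dist2_eq0 <-]|far]; first by exists k.
  (* A point at squared distance at least [m0] from all nuclei leaves the neighbourhood of radius
     [r_ n], since [2 * r_^2 <= 2 * r_ < m0] when [r_ <= 1]. *)
  have [n] := ltr_add_invr (divr_gt0 kx (ltr0Sn R 1)); rewrite add0r => hn.
  have hn1 : r_ n <= 1 by rewrite /r_ invf_le1 ?ltr0n// ler1n.
  have [k] := nx n Logic.I; have := far k; have := r_0 n.
  have {}hn : r_ n < m0 / 2 by [].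
  move: hn hn1; move: (r_ n) => y; clear; nra.
have r_dec : {homo (fun n => near_nuclei X (r_ n)) : n m / (n <= m)%N >-> (m <= n)%O}.
  move=> n m nm; apply/subsetPset; apply: near_nuclei_le; first exact: ltW.
  by rewrite lef_pV2 ?posrE ?ltr0n// ler_nat.
have cv := nonincreasing_cvg_mu (mu := rho) (F := fun n => near_nuclei X (r_ n))
   _ (fun n => measurable_near_nuclei X (r_ n)) _ r_dec.
rewrite capE in cv.
have mX : measurable (range X).
  rewrite -capE; apply: bigcapT_measurable => n; exact: measurable_near_nuclei.
have fX : rho (range X) \is a fin_num by exact: (fin_num_measure rho _ mX).
have h : (rho (range X) < rho (range X) + e%:E)%E.
  by rewrite -(fineK fX) -EFinD lte_fin ltrDl.
have f0 : (rho (near_nuclei X (r_ 0%N)) < +oo)%E.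
  rewrite ltey_eq (fin_num_measure rho)//; exact: measurable_near_nuclei.
have [n _ /(_ n (leqnn n)) hn] := cv f0 mX _ (open_ereal_lt' h).
exists (r_ n) => // r r00 rn; apply: le_lt_trans hn.
apply: le_measure; rewrite ?inE; try exact: measurable_near_nuclei.
exact: near_nuclei_le (ltW r00) rn.
Qed.

End recovery.

Section concentration.
Context {R : realType}.
Implicit Types (x : R3 R).

Lemma measurable_point (Y : R3 R) : measurable [set Y].
Proof.
case: Y => -[a b] c.
rewrite (_ : [set _] = ([set a] `*` [set b]) `*` [set c]).
  by apply: measurableX; [apply: measurableX|]; exact: measurable_set1.
by apply/seteqP; split => [_ -> //|[[x y] z] [[/= -> ->] ->]].
Qed.

Lemma measurable_range_ord (M : nat) (X : 'I_M -> R3 R) : measurable (range X).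
Proof.
rewrite (_ : range X = \bigcup_(k in [set: 'I_M]) [set X k]).
  by apply: fin_bigcup_measurable => // k _; exact: measurable_point.
by apply/seteqP; split => [_ [k _ <-]|_ [k _ ->]]; exists k.
Qed.

Lemma integral_sandwich (m : {measure set (R3 R) -> \bar R}) (phi : R3 R -> R) (A B : set (R3 R)) :
  measurable_fun setT phi -> measurable A -> measurable B -> (forall x, 0 <= phi x <= 1) ->
  (forall x, A x -> phi x = 1) -> (forall x, ~ B x -> phi x = 0) ->
  (m A <= \int[m]_x (phi x)%:E <= m B)%E.
Proof.
move=> mphi mA mB p01 pA pB.
have mE (D : set (R3 R)) : measurable D -> measurable_fun setT (fun x => (\1_D x : R)%:E).
  by move=> mD; apply/measurable_EFinP; exact: measurable_indic.
have mpE : measurable_fun setT (fun x => (phi x)%:E) by exact/measurable_EFinP.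
have p0 x : setT x -> (0 <= (phi x)%:E)%E by rewrite lee_fin; case/andP: (p01 x).
have i0 (D : set (R3 R)) x : setT x -> (0 <= (\1_D x : R)%:E)%E by rewrite lee_fin.
rewrite -[X in (X <= _ <= _)%E](_ : (\int[m]_x (\1_A x)%:E)%E = _); last first.
  by rewrite integral_indic ?setIT.
rewrite -[X in (_ <= _ <= X)%E](_ : (\int[m]_x (\1_B x)%:E)%E = _); last first.
  by rewrite integral_indic ?setIT.
apply/andP; split; apply: ge0_le_integral => //; try exact: mE; try exact: i0.
- move=> x _; rewrite lee_fin indicE; have /andP[? ?] := p01 x.
  by case: (boolP (x \in A)) => // /set_mem /pA ->.
- move=> x _; rewrite lee_fin indicE; have /andP[? ?] := p01 x.
  by case: (boolP (x \in B)) => //= /negP xB; rewrite pB// => Bx; apply: xB; exact/mem_set.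
Qed.

(** Surgery applied to a member of a family converging to [rho]. The deficit [1 - rho (range X)]
    counts mass sitting away from the nuclei as well as mass lost at infinity. The slack [eta] is
    spent in three portions: half on the deficit, a quarter on [tau], a quarter on the terms of
    order [eps]. *)
Lemma concentration : exists2 C : R, 0 < C & forall (M : nat) (X : 'I_M -> R3 R) (Z : 'I_M -> R)
    (b : R) (i1 i2 : 'I_M) (z0 t delta eta : R) (N : nat) (rho : subprobability (R3 R) R),
  injective X -> i1 != i2 -> 0 < b -> (forall k, 0 < Z k) -> 0 < z0 -> z0 <= Z i1 -> z0 <= Z i2 ->
  0 < delta -> 0 < eta -> (0 < N)%N -> (Gminus b X Z rho < t%:E)%E ->
  exists (eps r : R) (mu : probability (R3 R) R),
    [/\ 0 < eps < eta, 0 < r < eta, mu (near_nuclei X r) = 1%E &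
     (Geps b X Z eps mu <= (t + eta + (C / delta ^+ 2 +
        (\sum_(k < M) Z k) / (delta * N%:R ^+ 2)) -
        z0 * (1 - fine (rho (range X))) / (12 * delta * N%:R))%:E)%E].
Proof.
have [C [Kf [C0_ Kf0 surg]]] := @surgery R.
exists C => // M X Z b i1 i2 z0 t delta eta N rho injX i12 b0 Z0 z00 zi1 zi2 d0 eta0 N0 Gt.
have M0 : (0 < M)%N by case: (i1) => ? /(leq_ltn_trans (leq0n _)).
have NR0 : 0 < N%:R :> R by rewrite ltr0n.
(* Lowering the deficit by [e'] costs [z0 * e' / (12 * delta * N) = eta / 2]. *)
pose e' := 6 * delta * N%:R * eta / z0.
have e'0 : 0 < e' by rewrite divr_gt0// !mulr_gt0.
have [r0 r00 sep] := well_separated_small injX.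
have [r1 r10 near1] := near_nuclei_mass X rho e'0.
have [r [rpos reta r2r0 r2r1]] : exists r, [/\ 0 < r, r < eta, 2 * r <= r0 & 2 * r <= r1].
  exists (Num.min (eta / 2) (Num.min (r0 / 2) (r1 / 2))); split.
  - by rewrite !lt_min !divr_gt0.
  - by rewrite gt_min; apply/orP; left; lra.
  - suff : Num.min (eta / 2) (Num.min (r0 / 2) (r1 / 2)) <= r0 / 2 by lra.
    by rewrite !ge_min lexx orbT.
  - suff : Num.min (eta / 2) (Num.min (r0 / 2) (r1 / 2)) <= r1 / 2 by lra.
    by rewrite !ge_min lexx !orbT.
have r2pos : 0 < 2 * r by rewrite mulr_gt0.
have [phi [Cphi phi01 phi1 phi0]] := bump_at_nuclei M0 rpos (sep _ r2pos r2r0).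
have mphi : measurable_fun setT phi by apply: continuous_measurable3; case: Cphi.
pose m0 := fine (rho (range X)).
have mX := measurable_range_ord X.
have fX : rho (range X) \is a fin_num by exact: (fin_num_measure rho _ mX).
have phic : (\int[rho]_x (phi x)%:E < (m0 + e')%:E)%E.
  have /andP[_ h] := integral_sandwich rho mphi (measurable_near_nuclei X r)
    (measurable_near_nuclei X (2 * r)) phi01 phi1 phi0.
  by apply: le_lt_trans h _; rewrite EFinD fineK//; exact: near1.
pose S := \sum_(k < M) Z k.
have S0 : 0 <= S by apply: sumr_ge0 => k _; exact: ltW.
(* Coefficient of [eps] in the remaining errors, [eps^2] being at most [eps] once [eps <= 1]. *)
pose L := Kf * r ^- 2 + b * (2 * r^-1) + S * r^-1.
have rV0 : 0 < r^-1 by rewrite invr_gt0.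
have L0 : 0 < L.
  by rewrite /L -addrA ltr_wpDr ?mulr_gt0 ?invr_gt0 ?exprn_gt0// addr_ge0 ?mulr_ge0// ltW.
have [e0 [e00 e0eta e01 e0L e0r]] : exists e0, [/\ 0 < e0, e0 <= eta, e0 <= 1,
    e0 * L <= eta / 4 & 12 * (delta * e0) * N%:R <= r].
  exists (Num.min (Num.min eta 1) (Num.min (eta / 4 / L) (r / (12 * delta * N%:R)))); split.
  - by rewrite !lt_min ltr01 eta0 !divr_gt0// !mulr_gt0.
  - by rewrite !ge_min lexx.
  - by rewrite !ge_min lexx !orbT.
  - by rewrite -ler_pdivlMr// !ge_min lexx !orbT.
  - rewrite mulrA mulrAC [X in X <= _]mulrC -ler_pdivlMr; last by rewrite !mulr_gt0.
    by rewrite !ge_min lexx !orbT.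
have [eps [mu [eps0 epse0 Gmu muphi]]] := recovery Gt Cphi phic e00.
(* The lower bound on the deficit passes from [rho] to [mu] through [phi]. The number [1 - m0 - e']
   is negative when [rho] already has almost full mass on the nuclei; surgery allows that. *)
have muq : (mu (near_nuclei X r) <= (1 - (1 - m0 - e'))%:E)%E.
  have /andP[h _] := integral_sandwich mu mphi (measurable_near_nuclei X r)
    (measurable_near_nuclei X (2 * r)) phi01 phi1 phi0.
  apply: le_trans h _; apply: le_trans (ltW muphi) _; rewrite lee_fin; lra.
have eta40 : 0 < eta / 4 by rewrite divr_gt0.
have epsr : 12 * (delta * eps) * N%:R <= r.
  apply: le_trans e0r; rewrite ler_pM2r// ler_pM2l// ler_pM2l//; exact: ltW.
have [mu' [mu'n Gmu']] := surg M X Z b i1 i2 r eps delta t (eta / 4) z0 (1 - m0 - e') N mu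
  i12 b0 Z0 z00 zi1 zi2 rpos eps0 d0 eta40 N0 (sep _ rpos (le_trans (ler_peMl (ltW rpos) (ler1n _ 2)) r2r0))
  epsr Gmu muq.
exists eps, r, mu'; split => //.
- by rewrite eps0 (lt_le_trans epse0).
- by rewrite rpos.
apply: le_trans Gmu' _; rewrite lee_fin -/S -/m0.
have e'E : z0 * e' / (12 * delta * N%:R) = eta / 2.
  by rewrite /e'; field; rewrite !gt_eqF.
have -> : z0 * (1 - m0 - e') / (12 * delta * N%:R) =
  z0 * (1 - m0) / (12 * delta * N%:R) - eta / 2 by rewrite -e'E; ring.
have h1 : eps ^+ 2 * (Kf * r ^- 2) <= eps * (Kf * r ^- 2).
  rewrite ler_wpM2r//; first by rewrite mulr_ge0 ?invr_ge0 ?exprn_ge0 ?(ltW Kf0) ?(ltW rpos).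
  by rewrite expr2 ler_piMr ?(ltW eps0)// (le_trans (ltW epse0)).
have h2 : eps * L <= eta / 4.
  by apply: le_trans e0L; rewrite ler_wpM2r ?(ltW L0) ?(ltW epse0).
have h3 : eps * L = eps * (Kf * r ^- 2) + eps * b * (2 * r^-1) + eps * (S * r^-1).
  by rewrite /L; ring.
move: h1 h2 h3.
move: (z0 * _ / _) (S / _) (C / _) (eps ^+ 2 * _) (eps * (Kf * _)) (eps * b * _) (eps * (S * _)).
by clear => *; lra.
Qed.

End concentration.

(** * Limits of concentrating measures *)

Section point_masses.
Context {R : realType} (M : nat) (X : 'I_M -> R3 R).
Implicit Types (x : R3 R) (mu : probability (R3 R) R).

Definition ball_at (r : R) k : set (R3 R) := [set x | dist2 (X k) x < 2 * r ^+ 2].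

Definition ball_mass mu r k := fine (mu (ball_at r k)).

Lemma ball_massE mu r k : mu (ball_at r k) = (ball_mass mu r k)%:E.
Proof. by rewrite fineK// (fin_num_measure mu)//; exact: measurable_dist2_lt. Qed.

Lemma ball_at_disjoint (r : R) k l x : well_separated X r ->
  ball_at r k x -> ball_at r l x -> k = l.
Proof.
move=> sep kx lx; apply/eqP; apply: contrapT => /negP kl.
have := dist2_quasi (X k) (X l) x; have := sep _ _ kl; have := sqr_ge0 r.
move: kx lx; rewrite /ball_at /=; lra.
Qed.

Lemma sum_ball_at (r : R) (c : 'I_M -> R) k x : well_separated X r -> ball_at r k x ->
  \sum_(l < M) c l * \1_(ball_at r l) x = c k.
Proof.
move=> sep kx; rewrite (bigD1 k)//= big1.
  by rewrite indicE mem_set// mulr1 addr0.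
move=> l lk; rewrite indicE memNset ?mulr0// => lx.
by move/eqP : lk; apply; exact: (ball_at_disjoint sep lx kx).
Qed.

(** [phi] is compared with the step function equal to [phi (X k)] on the ball at [X k]; they differ
    by at most [eta] on a set of full measure. Thus the vector of ball masses determines integrals
    up to the oscillation of [phi]. *)
Lemma integral_near_nuclei mu (phi : R3 R -> R) (r eta : R) :
  measurable_fun setT phi -> well_separated X r -> mu (near_nuclei X r) = 1%E -> 0 <= eta ->
  (forall k x, ball_at r k x -> `|phi x - phi (X k)| <= eta) ->
  exists v, (\int[mu]_x (phi x)%:E)%E = v%:E /\
    `|v - \sum_(k < M) ball_mass mu r k * phi (X k)| <= eta.
Proof.
move=> mphi sep mun eta0 hphi.
pose s x := \sum_(l < M) phi (X l) * \1_(ball_at r l) x.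
have mB k : measurable (ball_at r k) by exact: measurable_dist2_lt.
have isk k : mu.-integrable setT (fun x => (phi (X k) * \1_(ball_at r k) x)%:E).
  under eq_fun do rewrite EFinM.
  exact: (integrableZl measurableT (phi (X k)) (integrable_indic mu (mB k))).
have sE : (fun x => (s x)%:E) = (fun x => (\sum_(l < M) (phi (X l) * \1_(ball_at r l) x)%:E)%E).
  by apply/funext => x; rewrite sumEFin.
have is_ : mu.-integrable setT (fun x => (s x)%:E).
  by rewrite sE; apply: integrable_sum.
have intS : (\int[mu]_x (s x)%:E)%E = (\sum_(k < M) ball_mass mu r k * phi (X k))%:E.
  transitivity (\int[mu]_x (\sum_(l < M) (phi (X l) * \1_(ball_at r l) x)%:E))%E.
    by congr integral; rewrite sE.
  rewrite integral_sum// -sumEFin; apply: eq_bigr => k _.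
  under eq_integral do rewrite EFinM.
  rewrite integralZl//; last exact: (integrable_indic mu (mB k)).
  by rewrite integral_indic// setIT EFinM muleC -ball_massE.
have ms : measurable_fun setT s.
  by have /measurable_int/measurable_EFinP := is_.
have mdiff : measurable_fun setT (fun x => `|(phi x - s x)%:E|%E).
  by apply/measurableT_comp => //; apply/measurable_EFinP; exact: measurable_funB.
have diff_le : (\int[mu]_x `|(phi x - s x)%:E| <= eta%:E)%E.
  have nn0 : mu (~` near_nuclei X r) = 0%E.
    have mn := measurable_near_nuclei X r.
    by rewrite probability_setC// mun -EFinB subrr.
  have := @integral_le_cst_indic _ _ _ mu (near_nuclei X r) set0
    (fun x => `|(phi x - s x)%:E|%E) eta 0 eta0 (lexx 0) (measurable_near_nuclei X r) measurable0
    nn0 mdiff (fun x => abse_ge0 _).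
  rewrite measure0 mule0 adde0 (@probability_setT _ _ _ mu) mule1; apply.
  by move=> x [k kx]; rewrite mul0r addr0 lee_fin/= /s (sum_ball_at _ sep kx); exact: hphi.
have idiff : mu.-integrable setT (fun x => (phi x - s x)%:E).
  apply/integrableP; split; first by apply/measurable_EFinP; exact: measurable_funB.
  by apply: le_lt_trans diff_le _; rewrite ltry.
have phiE : (\int[mu]_x (phi x)%:E)%E =
    (\int[mu]_x (phi x - s x)%:E + \int[mu]_x (s x)%:E)%E.
  by rewrite -integralD//; apply: eq_integral => x _; rewrite -EFinD subrK.
have le1 := le_abse_integral mu measurableT (measurable_int _ idiff).
have fin1 : (\int[mu]_x (phi x - s x)%:E)%E \is a fin_num by exact: integrable_fin_num.
move: fin1 phiE le1; case: (\int[mu]_x (phi x - s x)%:E)%E => // w _ phiE le1.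
exists (w + \sum_(k < M) ball_mass mu r k * phi (X k)); split; first by rewrite phiE intS.
by rewrite addrK -lee_fin; exact: le_trans le1 diff_le.
Qed.

Lemma near_continuous (phi : R3 R -> R) (eta : R) : continuous phi -> 0 < eta ->
  exists2 r0 : R, 0 < r0 & forall r, 0 < r -> r <= r0 ->
    forall k x, ball_at r k x -> `|phi x - phi (X k)| <= eta.
Proof.
move=> cphi eta0.
have hk k : exists2 c : R, 0 < c & forall x, dist2 (X k) x < 2 * c ^+ 2 -> `|phi x - phi (X k)| <= eta.
  have : \forall x \near X k, `|phi (X k) - phi x| < eta.
    by have /cvgr_dist_lt := cphi (X k); apply.
  move=> /nbhs_ballP[c /= c0 hc].
  exists (c / 2); first by rewrite divr_gt0.
  move=> x hx; rewrite distrC; apply/ltW/hc.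
  have c2 i : `|coord3 x i - coord3 (X k) i| < c.
    have : (coord3 x i - coord3 (X k) i) ^+ 2 < c ^+ 2.
      apply: le_lt_trans (_ : _ <= dist2 (X k) x) _; last first.
        by apply: lt_le_trans hx _; rewrite expr_div_n; have := sqr_ge0 c; lra.
      by rewrite /dist2 (bigD1 i)//= lerDl; apply: sumr_ge0 => j _; exact: sqr_ge0.
    by rewrite -(real_normK (num_real (coord3 x i - coord3 (X k) i))) ltr_pXn2r ?nnegrE ?normr_ge0 ?(ltW c0).
  move: (c2 0) (c2 1) (c2 2%:R).
  case: (X k) => -[a1 a2] a3; case: x hx c2 => -[b1 b2] b3 _ _ /=.
  rewrite /coord3 /= => h1 h2 h3.
  by split; [split|]; rewrite /ball/= distrC.
have [c cP] : exists c : 'I_M -> R, forall k, 0 < c k /\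
    forall x, dist2 (X k) x < 2 * c k ^+ 2 -> `|phi x - phi (X k)| <= eta.
  have /(_ (fun k => let: ex_intro2 c c0 hc := hk k in ex_intro _ c (conj c0 hc))) [c cP] :=
    @choice _ _ (fun k c => 0 < c /\ forall x, dist2 (X k) x < 2 * c ^+ 2 -> `|phi x - phi (X k)| <= eta).
  by exists c.
exists (\big[Num.min/1]_k c k).
  by apply/bigmin_gtP; split => // k _; case: (cP k).
move=> r r0 rc k x kx; have [ck hck] := cP k; apply: hck.
apply: lt_le_trans kx _; rewrite ler_wpM2l// lerXn2r ?nnegrE ?(ltW r0) ?(ltW ck)//.
by apply: le_trans rc _; exact: bigmin_le.
Qed.

Lemma dirac_sum (alpha : 'I_M -> R) : (forall k, 0 <= alpha k) -> \sum_(k < M) alpha k = 1 ->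
  exists D : probability (R3 R) R, forall A, D A = (\sum_(k < M) (alpha k)%:E * \d_(X k) A)%E.
Proof.
move=> a0 a1.
(* [msum] sums a sequence indexed by natural numbers, hence the extension by the zero measure past
   [M]. *)
pose m_ (n : nat) : {measure set (R3 R) -> \bar R} :=
  if insub n is Some k then mscale (NngNum (a0 k)) (dirac (X k)) else mzero.
have mE A : msum m_ M A = (\sum_(k < M) (alpha k)%:E * \d_(X k) A)%E.
  by rewrite /msum; apply: eq_bigr => k _; rewrite /m_ valK.
have [|D DE] := prob_of_measure (m := msum m_ M).
  transitivity (\sum_(k < M) (alpha k)%:E * \d_(X k) [set: R3 R])%E; first exact: mE.
  rewrite -a1 -sumEFin; apply: eq_bigr => k _.
  by rewrite diracT mule1.
by exists D => A; rewrite DE; exact: mE.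
Qed.

End point_masses.

(** * Compactness of mass vectors and families indexed by [eps] *)

Section compactness.
Context {R : realType} (M : nat) (X : 'I_M -> R3 R).
Implicit Types (x : R3 R) (mu : probability (R3 R) R).

(** A cluster point in the compact cube, stated as infinitely many good indices, which replaces the
    extraction of a subsequence. *)
Lemma simplex_cluster (v : nat -> 'I_M -> R) : (forall n k, 0 <= v n k <= 1) ->
  exists alpha : 'I_M -> R, forall (m : nat) (e : R), 0 < e ->
    exists2 n, (m <= n)%N & forall k, `|v n k - alpha k| < e.
Proof.
move=> v01.
have cpt := @rV_compact R M (fun=> `[0, 1]%classic) (fun=> @segment_compact R 0 1).
pose u n : 'rV[R]_M := \row_k v n k.
have Fu : (u @ \oo) [set w : 'rV[R]_M | forall i, `[0, 1]%classic (w ord0 i)].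
  by exists 0%N => // n _ i /=; rewrite in_itv/= mxE; exact: v01.
have [a [_ cla]] := cpt (u @ \oo) _ Fu.
exists (fun k => a ord0 k) => m e e0.
have hF : (u @ \oo) [set u n | n in [set n | (m <= n)%N]].
  by exists m => // n mn; exists n.
have [_ [[n mn <-] hb]] := cla _ (ball a e) hF (nbhsx_ballx a e e0).
exists n => // k; have := hb.2 ord0 k; rewrite mxE /ball/= distrC; exact.
Qed.

(** The definition of the lower limit asks for a family over all [eps], whereas surgery yields a
    sequence. The gaps are filled with the limit [D] itself. Since [eps_] may repeat values, the
    measure at [eps_ n] is that of some index sharing this value. *)
Lemma interpolating_family (T : Type) (eps_ : nat -> R) (mu_ : nat -> T) (D : T) :
  (forall n, 0 < eps_ n < n.+1%:R^-1) -> exists rho_ : R -> T,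
  (forall m, exists2 e1, 0 < e1 & forall e, 0 < e -> e < e1 ->
     rho_ e = D \/ exists2 n, (m <= n)%N & rho_ e = mu_ n) /\
  (forall m e1, 0 < e1 -> exists n, [/\ (m <= n)%N, eps_ n < e1 & rho_ (eps_ n) = mu_ n]).
Proof.
move=> he.
pose rho_ e := if pselect (exists n, eps_ n = e) is left h then mu_ (projT1 (cid h)) else D.
(* Below the minimum of the first [m] values of [eps_] only indices from [m] on can occur. *)
pose emin m := \big[Num.min/1]_(j < m) eps_ j.
have emin0 m : 0 < emin m.
  by apply/bigmin_gtP; split => // j _; case/andP: (he j).
have eminP m n : eps_ n < emin m -> (m <= n)%N.
  move=> h; rewrite leqNgt; apply/negP => nm; move: h; rewrite ltNge => /negP; apply.
  exact: (bigmin_le _ (Ordinal nm)).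
exists rho_; split => [m|m e1 e10].
  exists (emin m) => // e e0 em; rewrite /rho_; case: pselect => [h|_]; last by left.
  right; exists (projT1 (cid h)) => //; apply: eminP.
  by rewrite (projT2 (cid h)).
have em0 : 0 < Num.min e1 (emin m) by rewrite lt_min e10 emin0.
have [N] := ltr_add_invr em0; rewrite add0r => hN.
have hNe : eps_ N < Num.min e1 (emin m).
  by case/andP: (he N) => _ /lt_trans; apply.
have [n [nE rn]] : exists n, eps_ n = eps_ N /\ rho_ (eps_ N) = mu_ n.
  rewrite /rho_; case: pselect => [h|]; last by case; exists N.
  by exists (projT1 (cid h)); split => //; exact: (projT2 (cid h)).
move: hNe; rewrite lt_min => /andP[h1 h2].
by exists n; rewrite nE; split => //; apply: eminP; rewrite nE.
Qed.

Lemma at_right0P (V : set R) : (0 : R)^'+ V <->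
  exists2 e1, 0 < e1 & forall e, 0 < e -> e < e1 -> V e.
Proof.
split => [/nbhs_ballP[e1 /= e10 he]|[e1 e10 he]].
  exists e1 => // e e0 ee1; apply: he => //.
  by rewrite /ball/= sub0r normrN gtr0_norm.
near=> e; apply: he; first by near: e; exact: nbhs_right_gt.
by near: e; exact: nbhs_right_lt.
Unshelve. all: by end_near. Qed.

Lemma limf_einf_le (f : R -> \bar R) (c : \bar R) :
  (forall e1, 0 < e1 -> exists e, [/\ 0 < e, e < e1 & (f e <= c)%E]) ->
  (limf_einf f (0 : R)^'+ <= c)%E.
Proof.
move=> h; rewrite limf_einfE; apply: ge_ereal_sup => _ [V /at_right0P[e1 e10 he] <-].
have [e [e0 ee1 fe]] := h _ e10; apply: le_trans fe.
by apply: ereal_inf_lbound; exists e => //; exact: he.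
Qed.

Lemma weak_star_cvg_mass (rho_ : R -> probability (R3 R) R) (D : probability (R3 R) R)
    (alpha : 'I_M -> R) :
  (forall (phi : R3 R -> R), continuous phi -> forall eta, 0 < eta -> exists2 e1, 0 < e1 &
    forall e, 0 < e -> e < e1 -> exists v, (\int[rho_ e]_x (phi x)%:E)%E = v%:E /\
      `|v - \sum_(k < M) alpha k * phi (X k)| <= eta) ->
  (forall (phi : R3 R -> R), continuous phi -> forall eta, 0 < eta ->
     exists v, (\int[D]_x (phi x)%:E)%E = v%:E /\
      `|v - \sum_(k < M) alpha k * phi (X k)| <= eta) ->
  weak_star_cvg rho_ D.
Proof.
move=> hrho hD phi [cphi _].
pose c := \sum_(k < M) alpha k * phi (X k).
(* Being within every positive [eta] of [c], the integral equals [c]. *)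
have DE : (\int[D]_x (phi x)%:E)%E = c%:E.
  have [w [wE _]] := hD phi cphi 1 ltr01.
  rewrite wE; congr EFin; apply/eqP; rewrite -subr_eq0 -normr_le0; apply/ler_addgt0Pr => e e0.
  have [w' [w'E h]] := hD phi cphi e e0; rewrite add0r.
  by move: w'E; rewrite wE => -[->].
rewrite DE; apply/fine_cvgP; split.
  apply/at_right0P; have [e1 e10 he] := hrho phi cphi 1 ltr01.
  by exists e1 => // e e0 ee1; have [w [-> _]] := he e e0 ee1.
apply/cvgrPdist_le => eta eta0; apply/at_right0P.
have [e1 e10 he] := hrho phi cphi eta eta0.
by exists e1 => // e e0 ee1; have [w [wE h]] := he e e0 ee1; rewrite /= wE distrC.
Qed.

End compactness.

Section compactness_thm.
Context {R : realType} (M : nat) (X : 'I_M -> R3 R).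
Implicit Types (x : R3 R) (mu : probability (R3 R) R).

Lemma ball_mass01 mu r k : 0 <= ball_mass X mu r k <= 1.
Proof.
rewrite -!lee_fin -ball_massE measure_ge0 probability_le1//.
exact: measurable_dist2_lt.
Qed.

(** [integral_near_nuclei] for the constant 1, whose oscillation is 0. *)
Lemma sum_ball_mass mu r : well_separated X r -> mu (near_nuclei X r) = 1%E ->
  \sum_(k < M) ball_mass X mu r k = 1.
Proof.
move=> sep mun.
have [|v [vE]] := @integral_near_nuclei _ _ X mu (cst 1) r 0 (measurable_cst _) sep mun (lexx 0).
  by move=> k x _; rewrite subrr normr0.
have i1 : (\int[mu]_x (cst 1 x : R)%:E)%E = 1%:E.
  rewrite -[LHS]/(\int[mu]_x (cst (1 : R)%:E x))%E integral_cst//.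
  by rewrite mul1e (@probability_setT _ _ _ mu).
move: vE; rewrite i1 => -[<-].
rewrite normr_le0 subr_eq0 => /eqP ->.
by apply: eq_bigr => k _; rewrite mulr1.
Qed.

Lemma weighted_sum_close (v w c : 'I_M -> R) (e : R) : (forall k, `|v k - w k| <= e) ->
  `|\sum_(k < M) v k * c k - \sum_(k < M) w k * c k| <= e * \sum_(k < M) `|c k|.
Proof.
move=> h; rewrite -sumrB mulr_sumr; apply: le_trans (ler_norm_sum _ _ _) _.
by apply: ler_sum => k _; rewrite -mulrBl normrM ler_wpM2r.
Qed.

Lemma natSinv_small (e : R) : 0 < e -> exists m, forall n, (m <= n)%N -> n.+1%:R^-1 < e.
Proof.
move=> e0; have [m] := ltr_add_invr e0; rewrite add0r => hm; exists m => n mn.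
by apply: le_lt_trans hm; rewrite lef_pV2 ?posrE ?ltr0n// ler_nat.
Qed.

(** Ball masses cluster at some [alpha], and the measures then converge along good indices to the
    sum of [alpha k] times the Dirac mass at [X k]. As [s_] is nonincreasing, replacing an index by
    a later one keeps the energy bounds. No lower bound on [s_] is imposed, which permits the choice
    [s_ n = - n]. *)
Theorem concentrating_limit (b : R) (Z : 'I_M -> R) (s_ : nat -> R) : (0 < M)%N -> injective X ->
  (forall n m, (n <= m)%N -> s_ m <= s_ n) ->
  (forall n, exists (eps r : R) mu, [/\ 0 < eps < n.+1%:R^-1, 0 < r < n.+1%:R^-1,
     mu (near_nuclei X r) = 1%E & (Geps b X Z eps mu <= (s_ n)%:E)%E]) ->
  exists rho : subprobability (R3 R) R, forall n, (Gminus b X Z rho <= (s_ n)%:E)%E.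
Proof.
move=> M0 injX s_dec data.
have [|d dP] := @choice _ _ (fun n (d : R * R * probability (R3 R) R) =>
    [/\ 0 < d.1.1 < n.+1%:R^-1, 0 < d.1.2 < n.+1%:R^-1,
     d.2 (near_nuclei X d.1.2) = 1%E & (Geps b X Z d.1.1 d.2 <= (s_ n)%:E)%E]).
  by move=> n; have [eps [r [mu h]]] := data n; exists (eps, r, mu).
have [alpha clalpha] := simplex_cluster (fun n k => ball_mass01 (d n).2 (d n).1.2 k).
have natS0 n : 0 < (n.+1%:R^-1 : R) by rewrite invr_gt0 ltr0n.
(* [p m >= m] is an index whose mass vector is within [1 / (m + 1)] of [alpha]. *)
have [|p pP] := @choice _ _ (fun m n => (m <= n)%N /\
    forall k, `|ball_mass X (d n).2 (d n).1.2 k - alpha k| < m.+1%:R^-1).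
  by move=> m; have [n mn h] := clalpha m _ (natS0 m); exists n.
pose eps_ m := (d (p m)).1.1; pose r_ m := (d (p m)).1.2; pose mu_ m := (d (p m)).2.
have pS m : (p m).+1%:R^-1 <= m.+1%:R^-1 :> R.
  by rewrite lef_pV2 ?posrE ?ltr0n// ler_nat; case: (pP m).
have eP m : 0 < eps_ m < m.+1%:R^-1.
  by have [/andP[h1 h2] _ _ _] := dP (p m); rewrite h1 (lt_le_trans h2).
have rP m : 0 < r_ m < m.+1%:R^-1.
  by have [_ /andP[h1 h2] _ _] := dP (p m); rewrite h1 (lt_le_trans h2).
have muP m : mu_ m (near_nuclei X (r_ m)) = 1%E by have [] := dP (p m).
have GP m : (Geps b X Z (eps_ m) (mu_ m) <= (s_ m)%:E)%E.
  have [_ _ _ /le_trans] := dP (p m); apply; rewrite lee_fin; apply: s_dec.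
  by case: (pP m).
have massP m k : `|ball_mass X (mu_ m) (r_ m) k - alpha k| < m.+1%:R^-1 by exact: (pP m).2.
have [r0 r00 sep] := well_separated_small injX.
have [m0 hm0] := natSinv_small r00.
have sepm m : (m0 <= m)%N -> well_separated X (r_ m).
  move=> /hm0 h; have /andP[h1 h2] := rP m; apply: sep => //; apply: ltW.
  exact: lt_trans h2 h.
have alpha0 k : 0 <= alpha k.
  apply/ler_addgt0Pr => e e0; have [m /(_ m (leqnn m)) hm] := natSinv_small e0.
  have := massP m k; have /andP[h _] := ball_mass01 (mu_ m) (r_ m) k.
  rewrite ltr_norml => /andP[_ h1]; move: h h1 hm.
  by move: (ball_mass _ _ _ _) (alpha k) (_^-1) => x y z; clear => *; lra.
have alpha1 : \sum_(k < M) alpha k = 1.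
  apply/eqP; rewrite -subr_eq0 -normr_le0; apply/ler_addgt0Pr => e e0; rewrite add0r.
  have e'0 : 0 < e / M%:R by rewrite divr_gt0// ltr0n.
  have [m hm] := natSinv_small e'0.
  pose n := maxn m m0.
  have := @weighted_sum_close alpha (ball_mass X (mu_ n) (r_ n)) (fun=> 1) (e / M%:R).
  have h k : `|alpha k - ball_mass X (mu_ n) (r_ n) k| <= e / M%:R.
    rewrite distrC; apply/ltW/(lt_trans (massP n k)); apply: hm; exact: leq_maxl.
  move=> /(_ h); under eq_bigr do rewrite mulr1.
  under [X in _ - X]eq_bigr do rewrite mulr1.
  rewrite sum_ball_mass ?muP//; last by apply: sepm; exact: leq_maxr.
  move=> /le_trans; apply.
  by rewrite normr1 sumr_const card_ord -mulr_natr mul1r divfK// pnatr_eq0 -lt0n.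
have [D DE] := dirac_sum X alpha0 alpha1.
have [rho_ [rho1 rho2]] := interpolating_family mu_ D eP.
exists (D : subprobability (R3 R) R) => n.
apply: (@le_trans _ _ (limf_einf (fun eps => Geps b X Z eps (rho_ eps)) (0 : R)^'+)); last first.
  apply: limf_einf_le => e1 /(rho2 n)[n' [nn' ne e]].
  exists (eps_ n'); split => //; first by case/andP: (eP n').
  by rewrite e; apply: le_trans (GP n') _; rewrite lee_fin; exact: s_dec.
apply: ereal_inf_lbound; exists rho_ => //.
have hD (phi : R3 R -> R) : continuous phi -> forall eta, 0 < eta ->
     exists v, (\int[D]_x (phi x)%:E)%E = v%:E /\
      `|v - \sum_(k < M) alpha k * phi (X k)| <= eta.
  move=> cphi eta eta0.
  have [r1 r10 h1] := near_continuous X cphi eta0.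
  pose r := Num.min r0 r1.
  have rpos : 0 < r by rewrite lt_min r00.
  have sr : well_separated X r by apply: sep => //; rewrite ge_min lexx.
  have dX k : ball_at X r k (X k) by rewrite /ball_at/= dist2xx mulr_gt0// exprn_gt0.
  have Dn : D (near_nuclei X r) = 1%E.
    rewrite DE -alpha1 -sumEFin; apply: eq_bigr => k _.
    by rewrite diracE mem_set ?mule1//; exists k; exact: dX.
  have DB k : ball_mass X D r k = alpha k.
    rewrite /ball_mass DE (bigD1 k)//= big1.
      by rewrite diracE mem_set ?mule1 ?adde0//; exact: dX.
    move=> l lk; rewrite diracE memNset ?mule0// => kl.
    by move/eqP: lk; apply; exact: (ball_at_disjoint sr (dX l) kl).
  have := @integral_near_nuclei _ _ X D phi r eta (continuous_measurable3 cphi) sr Dn (ltW eta0).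
  case=> [|v [vE]]; first by apply: h1 => //; rewrite ge_min lexx orbT.
  by under eq_bigr do rewrite DB; exists v.
apply: (weak_star_cvg_mass _ hD) => phi cphi eta eta0.
have eta20 : 0 < eta / 2 by rewrite divr_gt0.
have [r1 r10 h1] := near_continuous X cphi eta20.
pose c := \sum_(k < M) `|phi (X k)|.
have c0 : 0 <= c by apply: sumr_ge0.
(* Half of [eta] pays for the oscillation of [phi], half for the distance of the masses to [alpha];
   the [+ 1] guards against [c = 0]. *)
have c10 : 0 < eta / 2 / (c + 1) by rewrite divr_gt0// ltr_wpDl.
have [m1 hm1] := natSinv_small r10.
have [m2 hm2] := natSinv_small c10.
have [e1 e10 he1] := rho1 (maxn m0 (maxn m1 m2)).
exists e1 => // e e0 ee1; have [->|[m]] := he1 e e0 ee1; first exact: hD.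
rewrite !geq_max => /and3P[mm0 mm1 mm2] ->.
have /andP[rm0 rm] := rP m.
have [|v [vE hv]] := @integral_near_nuclei _ _ X (mu_ m) phi (r_ m) (eta / 2)
    (continuous_measurable3 cphi) (sepm m mm0) (muP m) (ltW eta20).
  by apply: h1 => //; apply/ltW/(lt_trans rm)/hm1.
exists v; split => //.
have := @weighted_sum_close (ball_mass X (mu_ m) (r_ m)) alpha (fun k => phi (X k)) (eta / 2 / (c + 1)).
have hk k : `|ball_mass X (mu_ m) (r_ m) k - alpha k| <= eta / 2 / (c + 1).
  by apply/ltW/(lt_trans (massP m k))/hm2.
move=> /(_ hk); rewrite -/c => h2.
have h3 : eta / 2 / (c + 1) * c <= eta / 2.
  by rewrite mulrAC ler_pdivrMr ?ltr_wpDl// ler_wpM2l ?(ltW eta20)// lerDl.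
apply: le_trans (ler_distD (\sum_(k < M) ball_mass X (mu_ m) (r_ m) k * phi (X k)) _ _) _.
by rewrite [leRHS](splitr eta) lerD// (le_trans h2).
Qed.

End compactness_thm.

(** * Minimizers *)

Section gamma_limit.
Context {R : realType} (M : nat) (X : 'I_M -> R3 R) (Z : 'I_M -> R) (b : R)
  (G : subprobability (R3 R) R -> R).
Hypotheses (M2 : (2 <= M)%N) (b0 : 0 < b) (injX : injective X) (Z0 : forall k, 0 < Z k)
  (GE : forall rho, (G rho)%:E = Gminus b X Z rho).

Let M0 : (0 < M)%N. Proof. exact: ltnW. Qed.

Lemma range_mass_le1 (rho : subprobability (R3 R) R) : fine (rho (range X)) <= 1.
Proof.
have mX := measurable_range_ord X.
rewrite -lee_fin fineK ?(fin_num_measure rho)//.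
apply: le_trans (@sprobability_setT _ _ _ rho).
by apply: le_measure; rewrite ?inE.
Qed.

(** The first two nuclei serve as targets, which is where [2 <= M] enters, and [z0] is the smaller
    of their charges. *)
Lemma concentration_estimate : exists C S z0 : R, [/\ 0 < C, 0 <= S, 0 < z0 &
  forall (rho : subprobability (R3 R) R) (delta eta : R) (N : nat),
    0 < delta -> 0 < eta -> (0 < N)%N ->
    exists (eps r : R) (mu : probability (R3 R) R),
    [/\ 0 < eps < eta, 0 < r < eta, mu (near_nuclei X r) = 1%E &
     (Geps b X Z eps mu <= (G rho + eta + (C / delta ^+ 2 + S / (delta * N%:R ^+ 2)) -
        z0 * (1 - fine (rho (range X))) / (12 * delta * N%:R))%:E)%E]].
Proof.
pose i1 := Ordinal M0; pose i2 := Ordinal M2.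
have [C C0 conc] := @concentration R.
exists C, (\sum_(k < M) Z k), (Num.min (Z i1) (Z i2)); split => //.
- by apply: sumr_ge0 => k _; exact: ltW.
- by rewrite lt_min !Z0.
move=> rho delta eta N d0 eta0 N0.
have eta20 : 0 < eta / 2 by rewrite divr_gt0.
have Gt : (Gminus b X Z rho < (G rho + eta / 2)%:E)%E by rewrite -GE lte_fin ltrDl.
have [||||eps [r [mu [/andP[e0 e1] /andP[r0 r1] mun Gmu]]]] := conc M X Z b i1 i2 (Num.min (Z i1) (Z i2))
  (G rho + eta / 2) delta (eta / 2) N rho injX _ b0 Z0 _ _ _ d0 eta20 N0 Gt.
- by [].
- by rewrite lt_min !Z0.
- by rewrite ge_min lexx.
- by rewrite ge_min lexx orbT.
exists eps, r, mu; rewrite e0 r0; split => //; [lra|lra|].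
by apply: le_trans Gmu _; rewrite lee_fin -(addrA (G rho)) -splitr.
Qed.

(** A value of [G] strictly below [s_ n] leaves a gap that pays for concentration: the nonnegative
    gain is dropped, [N = 1], and [delta] is taken large. The concentrated measures then have a
    limit satisfying all the bounds at once. *)
Lemma reached_below (s_ : nat -> R) : (forall n m, (n <= m)%N -> s_ m <= s_ n) ->
  (forall n, exists rho, G rho < s_ n) -> exists rho, forall n, G rho <= s_ n.
Proof.
move=> s_dec hs; have [C [S [z0 [C0 S0 z00 est]]]] := concentration_estimate.
have [|rho hrho] := @concentrating_limit _ _ X b Z s_ M0 injX s_dec; last first.
  by exists rho => n; rewrite -lee_fin GE.
move=> n; have [rho rs] := hs n.
pose e := (s_ n - G rho) / 2.
have e0 : 0 < e by rewrite divr_gt0// subr_gt0.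
(* The 1 gives [C / delta^2 <= C / delta], the other summand [(C + S) / delta <= e]. *)
pose delta := 1 + (C + S) / e.
have CS0 : 0 <= (C + S) / e by rewrite divr_ge0 ?(ltW e0)// addr_ge0// ltW.
have d1 : 1 <= delta by rewrite /delta lerDl.
have d0 : 0 < delta by exact: lt_le_trans d1.
have eta0 : 0 < Num.min e n.+1%:R^-1 by rewrite lt_min e0 invr_gt0 ltr0n.
have [eps [r [mu []]]] := est rho delta _ 1 d0 eta0 isT.
rewrite !lt_min => /and3P[h1 _ h2] /and3P[h3 _ h4] mun Gmu.
exists eps, r, mu; rewrite h1 h2 h3 h4; split => //.
apply: le_trans Gmu _; rewrite lee_fin.
have k1 : Num.min e n.+1%:R^-1 <= e by rewrite ge_min lexx.
have k2 : C / delta ^+ 2 + S / (delta * 1%:R ^+ 2) <= e.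
  apply: (@le_trans _ _ ((C + S) / delta)).
    rewrite expr1n mulr1 mulrDl lerD2r ler_wpM2l ?(ltW C0)//.
    by rewrite lef_pV2 ?posrE ?exprn_gt0// expr2 ler_pMr.
  rewrite ler_pdivrMr// /delta mulrDr mulr1 [X in _ <= _ + X]mulrC divfK ?gt_eqF// lerDr.
  exact: ltW.
have k3 : 0 <= z0 * (1 - fine (rho (range X))) / (12 * delta * 1%:R).
  by rewrite divr_ge0 ?mulr_ge0 ?(ltW z00) ?(ltW d0)// subr_ge0 range_mass_le1.
have k4 : s_ n = G rho + e + e by rewrite /e; field.
rewrite k4; move: k1 k2 k3.
move: (Num.min _ _) (C / _ + _) (z0 * _ / _) => x y z; clear => *; lra.
Qed.

(** [reached_below] is applied to levels decreasing to the infimum, or to [- n] if there is no lower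
    bound; the latter would produce a measure with [G] below every [- n], which a real value cannot
    be. *)
Lemma minimizer_exists : exists rho, minimizer G rho.
Proof.
have [lb|nlb] := pselect (has_lbound (range G)).
  have hi : has_inf (range G) by split => //; exists (G \d_(X (Ordinal M0))); exists \d_(X (Ordinal M0)).
  pose I := inf (range G).
  have n0 n : 0 < n.+1%:R^-1 :> R by rewrite invr_gt0 ltr0n.
  have [||rho hrho] := @reached_below (fun n => I + n.+1%:R^-1).
  - by move=> n m nm; rewrite lerD2l lef_pV2 ?posrE ?ltr0n// ler_nat.
  - by move=> n; have [_ [rho _ <-] h] := inf_adherent (n0 n) hi; exists rho.
  exists rho => mu; apply: (@le_trans _ _ I); last by apply: ge_inf => //; exists mu.
  apply/ler_addgt0Pr => e e0; have [m /(_ m (leqnn m)) hm] := natSinv_small e0.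
  by apply: le_trans (hrho m) _; rewrite lerD2l ltW.
have [||rho hrho] := @reached_below (fun n => - n%:R).
- by move=> n m nm; rewrite lerN2 ler_nat.
- move=> n; apply: contrapT => h; apply: nlb; exists (- n%:R) => _ [rho _ <-].
  by rewrite leNgt; apply/negP => hr; apply: h; exists rho.
have [n hn] : exists n : nat, - G rho < n%:R.
  exists (Num.bound `|G rho|); apply: le_lt_trans (archi_boundP (normr_ge0 _)).
  by rewrite -normrN ler_norm.
by have := hrho n; rewrite lerNr leNgt hn.
Qed.

(** With a deficit [a > 0] the gain exceeds all errors for suitable [N] and [delta]. Concentration
    then produces a limit with energy at most [G rho - L / 2]. *)
Lemma minimizer_range_mass rho : minimizer G rho -> rho (range X) = 1%E.
Proof.
move=> mrho; have mX := measurable_range_ord X.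
have [C [S [z0 [C0 S0 z00 est]]]] := concentration_estimate.
pose a := 1 - fine (rho (range X)).
have a0 : 0 <= a by rewrite subr_ge0 range_mass_le1.
have [aE|an0] := eqVneq a 0.
  by rewrite -(fineK (fin_num_measure rho _ mX)); congr EFin; apply/eqP; rewrite eq_sym -subr_eq0 -/a aE.
have {}a0 : 0 < a by rewrite lt_def an0.
pose q := z0 * a / 12.
have q0 : 0 < q by rewrite divr_gt0// mulr_gt0.
pose N := (Num.bound ((S + 2) / q)).+1.
have Nq : S + 2 <= q * N%:R.
  have x0 : 0 <= (S + 2) / q by rewrite divr_ge0 ?(ltW q0)// addr_ge0.
  rewrite mulrC -ler_pdivrMr//; apply/ltW/(lt_le_trans (archi_boundP x0)).
  by rewrite ler_nat.
(* With this [delta] all terms are multiples of [L = 1 / (delta * N^2)]: kinetic [L], potential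
   [S * L], gain [q * N * L]. The choice of [N] makes the balance at most [- L], leaving [L / 2] for
   the slack. *)
pose delta := C * N%:R ^+ 2.
have d0 : 0 < delta by rewrite mulr_gt0// exprn_gt0.
pose L := (delta * N%:R ^+ 2)^-1.
have L0 : 0 < L by rewrite invr_gt0 mulr_gt0// exprn_gt0.
have gain : C / delta ^+ 2 + S / (delta * N%:R ^+ 2) - z0 * a / (12 * delta * N%:R) <= - L.
  have -> : C / delta ^+ 2 + S / (delta * N%:R ^+ 2) - z0 * a / (12 * delta * N%:R) =
      L * (1 + S - q * N%:R).
    by rewrite /L /q /delta; field; rewrite !gt_eqF.
  by rewrite -[leRHS]mulrN1 ler_pM2l//; lra.
have [||mu hmu] := @concentrating_limit _ _ X b Z (fun=> G rho - L / 2) M0 injX; last first.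
- have h2 : G rho <= G mu by exact: (mrho mu).
  have := hmu 0%N; rewrite -GE lee_fin /= => h1.
  by have := le_trans h2 h1; rewrite lerDl oppr_ge0 leNgt divr_gt0.
- move=> n; have e0 : 0 < Num.min (L / 2) n.+1%:R^-1.
    by rewrite lt_min divr_gt0// invr_gt0 ltr0n.
  have [eps [r [mu []]]] := est rho delta _ N d0 e0 isT.
  rewrite !lt_min => /and3P[h1 _ h2] /and3P[h3 _ h4] mun Gmu.
  exists eps, r, mu; rewrite h1 h2 h3 h4; split => //.
  apply: le_trans Gmu _; rewrite lee_fin -/a.
  have k1 : Num.min (L / 2) n.+1%:R^-1 <= L / 2 by rewrite ge_min lexx.
  move: gain k1; move: (Num.min _ _) (C / _ + _) (z0 * _ / _) => x y z; lra.
- by [].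
Qed.

(** Since the whole mass, at most 1, sits on the finite set of nuclei, the measure is determined by
    its atoms; injectivity of [X] keeps them from being counted twice. *)
Lemma minimizer_dirac_sum rho : minimizer G rho -> rho [set: R3 R] = 1%E /\
     exists alpha : 'I_M -> R,
       [/\ forall i, 0 <= alpha i,
           \sum_(i < M) alpha i = 1 &
           forall A : set (R3 R), measurable A ->
             rho A = (\sum_(i < M) (alpha i)%:E * \d_(X i) A)%E].
Proof.
move=> /minimizer_range_mass rX; have mX := measurable_range_ord X.
have rT : rho [set: R3 R] = 1%E.
  apply/eqP; rewrite eq_le sprobability_setT/= -rX.
  by apply: le_measure; rewrite ?inE.
have rC : rho (~` range X) = 0%E.
  have : (rho ([set: R3 R] `\` range X) = rho [set: R3 R] - rho ([set: R3 R] `&` range X))%E.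
    by apply: measureD => //; exact: le_lt_trans (@sprobability_setT _ _ _ rho) (ltry 1).
  by rewrite setTD setTI rT rX subee.
pose alpha i := fine (rho [set X i]).
have alphaE i : rho [set X i] = (alpha i)%:E.
  by rewrite fineK// (fin_num_measure rho)//; exact: measurable_point.
have rE A : measurable A -> rho A = (\sum_(i < M) (alpha i)%:E * \d_(X i) A)%E.
  move=> mA.
  have -> : rho A = rho (A `&` range X).
    rewrite [LHS](measureDI rho mA mX).
    rewrite [X in (X + _)%E](_ : _ = 0%E) ?add0e//.
    apply: (subset_measure0 (A := A `\` range X) (B := ~` range X)) => //.
    - exact: measurableD.
    - exact: measurableC.
  have -> : A `&` range X = \big[setU/set0]_(i < M) (A `&` [set X i]).
    rewrite -bigcup_seq; apply/seteqP; split => [x [Ax [i _ xi]]|x [i _ [Ax xi]]].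
      by exists i => //=; rewrite mem_index_enum.
    by split => //; exists i.
  rewrite measure_bigsetU_ord//; last first.
  - apply/trivIsetP => i j _ _ ij; apply/seteqP; split => // x [[_ ->] [_ /injX ji]].
    by move/eqP: ij; apply.
  - by move=> i; apply: measurableI => //; exact: measurable_point.
  apply: eq_bigr => i _; rewrite diracE; case: (boolP (X i \in A)) => [/set_mem AX|/negP nAX].
    by rewrite mule1 -alphaE; congr (rho _); apply/seteqP; split => [x []|x ->].
  rewrite mule0 (_ : _ `&` _ = set0) ?measure0//.
  by apply/seteqP; split => // x [+ xX]; rewrite xX => AX; apply: nAX; exact/mem_set.
split => //; exists alpha; split => //; first by move=> i; rewrite fine_ge0.
apply: EFin_inj; rewrite -rT rE// -sumEFin; apply: eq_bigr => i _.
by rewrite diracT mule1.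
Qed.

End gamma_limit.

Theorem theorem5p9 (R : realType) (M : nat) (hM : (2 <= M)%N)
    (b : R) (hb : 0 < b)
    (X : 'I_M -> R3 R) (hX : injective X)
    (Z : 'I_M -> R) (hZ : forall k, 0 < Z k)
    (G : subprobability (R3 R) R -> R) (hG : Gamma_limit b X Z G) :
  (exists rho : subprobability (R3 R) R, minimizer G rho) /\
  (forall rho : subprobability (R3 R) R, minimizer G rho ->
     rho [set: R3 R] = 1%E /\
     exists alpha : 'I_M -> R,
       [/\ forall i, 0 <= alpha i,
           \sum_(i < M) alpha i = 1 &
           forall A : set (R3 R), measurable A ->
             rho A = (\sum_(i < M) (alpha i)%:E * \d_(X i) A)%E]).
Proof.
have GE rho : (G rho)%:E = Gminus b X Z rho by case: (hG rho).
split; first exact: (minimizer_exists hM hb hX hZ GE).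
by move=> rho; exact: (minimizer_dirac_sum hM hb hX hZ GE).
Qed.
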